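(* Let $F,G\in\mathbb{C}\{\zeta\}$ be resurgent germs such that $F\odot G=\frac{1}{1-\zeta}$. Assume that, at every point of $\mathbb{C}^*$, every branch of the analytic continuation of $F$ and of $G$ has at most a simple singularity. If $F$ has only one singular point $\omega\in\mathbb{C}^*$ (i.e. $F$ admits analytic continuation along every path of $\mathbb{C}$ that starts at $0$ and avoids $\omega$, and it is singular at $\omega$), then $G$ is $\{0,\omega^{-1}\}$-continuable, i.e. the only possible singular points of $G$, on all sheets of its analytic continuation, are $0$ and $\omega^{-1}$.
   Context: $\mathbb{C}\{\zeta\}$ is the space of holomorphic germs at the origin (convergent power series). The Hadamard product is $\left(\sum_{n\ge0}a_n\zeta^n\right)\odot\left(\sum_{n\ge0}b_n\zeta^n\right)=\sum_{n\ge0}a_nb_n\zeta^n$. For a non-empty closed discrete subset $\Omega\subset\mathbb{C}$, a germ $f\in\mathbb{C}\{\zeta\}$ is called $\Omega$-continuable if it admits analytic continuation along any path of $\mathbb{C}\setminus\Omega$ that starts in the disc of convergence of $f$; $f$ is called resurgent if it is $\Omega$-continuable for some such $\Omega$. A branch $\phi$ of the analytic continuation of a resurgent germ (obtained by continuation along a path ending near $\omega'$) has at most a simple singularity at $\omega'\in\mathbb{C}^*$ if, near $\omega'$, $\phi(\omega'+\xi)=\frac{c}{\xi}+V(\xi)\frac{\log\xi}{2\pi i}+R(\xi)$ with $c\in\mathbb{C}$ and $V,R\in\mathbb{C}\{\xi\}$ (the case $c=0$, $V=0$, where $\phi$ is regular at $\omega'$, being allowed). *)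

(* Defs.v *)
From Stdlib Require Import Reals.
From Coquelicot Require Import Coquelicot.

Open Scope R_scope.

(* A germ at a point p is given by its sequence a of Taylor coefficients at p:
   it is the germ of z |-> sum_n a_n (z - p)^n. *)
Definition cseq := nat -> C.

Definition sums_to (a : cseq) (z s : C) : Prop :=
  is_pseries (K := C_AbsRing) (V := C_NormedModule) a z s.

Definition radius (a : cseq) : Rbar := CV_radius (fun n => Cmod (a n)).

Definition convergent (a : cseq) : Prop := Rbar_lt 0 (radius a).

Definition hadamard (a b : cseq) : cseq := fun n => (a n * b n)%C.

(* The sum of the germ (p, a) is defined around q, and (q, b) is its germ there. *)
Definition induces (p : C) (a : cseq) (q : C) (b : cseq) : Prop :=
  Rbar_lt (Cmod (q - p)) (radius a) /\
  locally q (fun z => exists s, sums_to a (z - p)%C s /\ sums_to b (z - q)%C s).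

Definition I01 (t : R) : Prop := 0 <= t <= 1.

(* Only the restriction of gamma to [0, 1] matters. *)
Definition is_path (gamma : R -> C) : Prop := continuous_on I01 gamma.

(* A t is the Taylor series at gamma t of the continuation along gamma of the
   germ f at the origin; gamma may start anywhere in the disc of convergence. *)
Definition continuation (f : cseq) (gamma : R -> C) (A : R -> cseq) : Prop :=
  induces 0 f (gamma 0) (A 0) /\
  forall t, I01 t ->
    convergent (A t) /\
    within I01 (locally t) (fun s => induces (gamma t) (A t) (gamma s) (A s)).

Definition continuable_along (f : cseq) (gamma : R -> C) : Prop :=
  exists A, continuation f gamma A.

Definition continuable (Omega : C -> Prop) (f : cseq) : Prop :=
  forall gamma, is_path gamma ->
    (forall t, I01 t -> ~ Omega (gamma t)) ->
    Rbar_lt (Cmod (gamma 0)) (radius f) ->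
    continuable_along f gamma.

Definition discrete (Omega : C -> Prop) : Prop :=
  forall w, Omega w -> locally w (fun z => Omega z -> z = w).

Definition resurgent (f : cseq) : Prop :=
  exists Omega : C -> Prop,
    (exists w, Omega w) /\ closed Omega /\ discrete Omega /\ continuable Omega f.

Definition branch (f : cseq) (z1 : C) (a : cseq) : Prop :=
  exists gamma A, is_path gamma /\ continuation f gamma A /\
    gamma 1 = z1 /\ A 1 = a.

(* A branch near w is the sum phi of a germ (z1, a), obtained by continuation
   along a path ending at z1, on the open disc centred at z1 whose boundary
   passes through w.  If the branches of f have no singularity in a punctured
   disc around w, continuation along any path ending close enough to w yields
   such a germ. *)
Definition touching_disc (w z1 z : C) : Prop := Cmod (z - z1) < Cmod (w - z1).

Definition branch_near (f : cseq) (w z1 : C) (a : cseq) : Prop :=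
  branch f z1 a /\ z1 <> w /\ Rbar_le (Cmod (w - z1)) (radius a).

Definition Cexp (z : C) : C := (exp (Re z) * cos (Im z), exp (Re z) * sin (Im z)).

Definition log_branch (D : C -> Prop) (L : C -> C) : Prop :=
  continuous_on D L /\ forall xi, D xi -> Cexp (L xi) = xi.

(* phi (w + xi) = R (xi) for xi close to 0 in the domain of the branch. *)
Definition regular_at (w z1 : C) (a : cseq) : Prop :=
  exists R : cseq, convergent R /\
    locally (0 : C) (fun xi => touching_disc w z1 (w + xi)%C ->
      exists r, sums_to R xi r /\ sums_to a (w + xi - z1)%C r).

(* phi (w + xi) = c / xi + V (xi) log xi / (2 pi i) + R (xi) for xi close to 0
   in the domain of the branch.  Changing the branch of log adds an integer
   multiple of V to R, so the choice of L is immaterial. *)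
Definition at_most_simple (w z1 : C) (a : cseq) : Prop :=
  exists (c : C) (V R : cseq) (L : C -> C),
    convergent V /\ convergent R /\
    log_branch (fun xi => touching_disc w z1 (w + xi)%C) L /\
    locally (0 : C) (fun xi => touching_disc w z1 (w + xi)%C ->
      exists v r, sums_to V xi v /\ sums_to R xi r /\
        sums_to a (w + xi - z1)%C
          (c / xi + v * (L xi / (2 * PI * Ci)) + r)%C).

Definition only_simple_singularities (f : cseq) : Prop :=
  forall w : C, w <> 0 ->
    forall z1 a, branch_near f w z1 a -> at_most_simple w z1 a.

Definition singular_at (f : cseq) (w : C) : Prop :=
  exists z1 a, branch_near f w z1 a /\ ~ regular_at w z1 a.

Definition only_singular_point (f : cseq) (w : C) : Prop :=
  (forall gamma, is_path gamma -> gamma 0 = 0 ->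
     (forall t, I01 t -> gamma t <> w) -> continuable_along f gamma) /\
  singular_at f w.

(* Main.v *)
Require Import Defs.
From Stdlib Require Import Reals ZArith Lra Lia Psatz.
From Stdlib Require Import FunctionalExtensionality Classical ClassicalEpsilon.
From Coquelicot Require Import Coquelicot.

(** The idea is to turn [F n * G n = 1] into a linear integral equation for [G]
    whose solutions can be continued wherever its right hand side can.

    The map [x |-> omega (1 - exp x)] is the universal covering of the plane
    without [omega].  Since [F] has no singularity but [omega] on any sheet, it
    lifts to an entire function [Phi] ([lift_entire]).  The simple singularity
    says that [Phi x = c exp (-x) + v (exp x) x + rho (exp x)] far to the left;
    comparing [Phi (x + 2 pi i)] with [Phi x] shows that [v], and then [rho], are
    entire ([lift_structure]).  Expanding at [exp x = 1], that is at the origin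
    of the plane of [F], gives
      [F n * omega^n = c - sum_(k < n) w k / (n - k) + rem n]
    with [w] and [rem] coefficients of entire functions ([coefficient_formula]).

    Put [g x = G (exp x / omega)].  Multiplying the formula by the coefficients
    of [g] and summing, the left hand side becomes [1 / (1 - exp x)], and the
    finite sums become a convolution: up to an entire function,
      [c * g x - int_(x1)^x K (x - y) g y dy = 1 / (1 - exp x)],
    where [K z = sum_k w k exp (k z)] is entire ([volterra_germ_start]).  Changing
    the base point [x1] changes the integral by an entire function
    ([volterra_recenter]), so the equation holds for every continuation of [g].
    The kernel is not zero: otherwise the coefficients of [F] would decrease so
    fast that their inverses could not belong to a convergent series
    ([kernel_nontrivial]).  For a nonzero entire kernel, the Taylor coefficients
    of [g] at [x1] are determined recursively by those of the right hand side,
    with a radius of convergence at least as large ([volterra_radius]).  The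
    right hand side is singular only where [exp x = 1], and [x |-> exp x / omega]
    misses only [0]; hence [G] can be continued along every path that avoids [0]
    and [/ omega] ([continuation_of_invariant]).

    All this needs some complex analysis.  A function is called holomorphic when
    it has a continuous complex derivative; Cauchy's formula for circles
    ([circle_contraction]) yields Taylor's theorem with the full radius of
    convergence ([hol_taylor]), from which recentring, composition and the
    uniqueness of continuation follow. *)

Open Scope R_scope.

(** * Complex limits and derivatives *)

Lemma locally_disc (z : C) (P : C -> Prop) :
  locally z P <->
  exists eps, 0 < eps /\ forall w, Cmod (w - z)%C < eps -> P w.
Proof.
  split.
  - intros [e He]. exists e. split; [apply e|].
    intros w Hw. apply He.
    exact (C_NormedModule_mixin_compat1 z w e Hw).
  - intros (e & He & H).
    assert (Hs : 0 < sqrt 2) by (apply sqrt_lt_R0; lra).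
    assert (Hd : 0 < e / sqrt 2) by (apply Rdiv_lt_0_compat; assumption).
    exists (mkposreal _ Hd). intros w Hw. apply H.
    apply Rlt_le_trans with (1 := C_NormedModule_mixin_compat2 z w _ Hw).
    simpl. right. field. lra.
Qed.

Lemma continuous_C_iff (f : C -> C) (z : C) :
  continuous f z <->
  forall eps, 0 < eps -> exists d, 0 < d /\
    forall w, Cmod (w - z)%C < d -> Cmod (f w - f z)%C < eps.
Proof.
  split.
  - intros H eps He.
    assert (Hl : locally (f z) (fun y => Cmod (y - f z)%C < eps)).
    { apply locally_disc. exists eps. split; auto. }
    apply H in Hl. apply locally_disc in Hl. exact Hl.
  - intros H P HP. apply locally_disc in HP. destruct HP as (e & He & HP).
    destruct (H e He) as (d & Hd & Hw).
    apply locally_disc. exists d. split; auto.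
Qed.

Lemma is_derive_C_iff (f : C -> C) (z l : C) :
  is_derive f z l <->
  forall eps, 0 < eps -> exists d, 0 < d /\
    forall w, Cmod (w - z)%C < d ->
      Cmod (f w - f z - (w - z) * l)%C <= eps * Cmod (w - z)%C.
Proof.
  split.
  - intros [_ H] eps He.
    specialize (H z (fun P H => H) (mkposreal eps He)).
    apply locally_C in H.
    apply locally_disc in H. exact H.
  - intros H. split; [apply is_linear_scal_l|].
    intros x Hx eps.
    pose proof (@is_filter_lim_locally_unique C_AbsRing
      (AbsRing_NormedModule C_AbsRing) z x Hx) as E.
    subst x.
    apply locally_C. apply locally_disc.
    destruct (H eps (cond_pos eps)) as (d & Hd & Hw).
    exists d. split; auto.
Qed.

Lemma is_derive_continuous (f : C -> C) (z l : C) :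
  is_derive f z l -> continuous f z.
Proof.
  intros H. apply continuous_C_iff. intros eps He.
  destruct (proj1 (is_derive_C_iff f z l) H 1 Rlt_0_1) as (d & Hd & Hw).
  pose proof (Cmod_ge_0 l) as Hl.
  exists (Rmin d (eps / (1 + Cmod l + 1))). split.
  - apply Rmin_pos; auto. apply Rdiv_lt_0_compat; lra.
  - intros w Hw1.
    assert (H1 := Rlt_le_trans _ _ _ Hw1 (Rmin_l _ _)).
    assert (H2 := Rlt_le_trans _ _ _ Hw1 (Rmin_r _ _)).
    specialize (Hw w H1).
    replace (f w - f z)%C with ((f w - f z - (w - z) * l) + (w - z) * l)%C by ring.
    eapply Rle_lt_trans; [apply Cmod_triangle|]. rewrite Cmod_mult.
    apply Rle_lt_trans with (Cmod (w - z)%C * (1 + Cmod l)); [lra|].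
    apply Rle_lt_trans with (Cmod (w - z)%C * (1 + Cmod l + 1)).
    + apply Rmult_le_compat_l; [apply Cmod_ge_0|lra].
    + apply Rmult_lt_reg_r with (/ (1 + Cmod l + 1)).
      * apply Rinv_0_lt_compat; lra.
      * rewrite Rmult_assoc, Rinv_r, Rmult_1_r by lra. exact H2.
Qed.

(** * Absolutely convergent complex series *)

Ltac nonneg := repeat first
  [ assumption | lra | apply Cmod_ge_0 | apply pos_INR | apply Rabs_pos
  | apply Rmult_le_pos | apply pow_le
  | left; apply Rinv_0_lt_compat; first [assumption | lra] ].

Lemma Rdiv_lt_one (a b : R) : 0 < b -> a < b -> a / b < 1.
Proof.
  intros Hb H. apply Rmult_lt_reg_r with b; auto.
  replace (a / b * b) with a by (field; lra). lra.
Qed.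

Definition CSeries (a : nat -> C) : C :=
  (Series (fun n => Re (a n)), Series (fun n => Im (a n))).

Lemma im_le_Cmod (z : C) : Rabs (Im z) <= Cmod z.
Proof. eapply Rle_trans; [|apply Rmax_Cmod]. apply Rmax_r. Qed.

Lemma Cmod_le_Re_Im (z : C) : Cmod z <= Rabs (Re z) + Rabs (Im z).
Proof.
  replace z with (RtoC (Re z) + RtoC (Im z) * Ci)%C at 1
    by (destruct z; apply injective_projections; simpl; ring).
  eapply Rle_trans; [apply Cmod_triangle|].
  rewrite Cmod_mult, Cmod_Ci, !Cmod_R. lra.
Qed.

(** This gives access to the real theory of series, Cauchy products included. *)
Lemma is_series_C_iff (a : nat -> C) (l : C) :
  is_series (a : nat -> C_NormedModule) l <->
  is_series (fun n => Re (a n)) (Re l) /\ is_series (fun n => Im (a n)) (Im l).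
Proof.
  assert (Hre : forall n, Re (sum_n (a : nat -> C_NormedModule) n)
                = sum_n (fun n => Re (a n)) n).
  { induction n; [rewrite !sum_O; reflexivity|].
    rewrite !sum_Sn, <- IHn. reflexivity. }
  assert (Him : forall n, Im (sum_n (a : nat -> C_NormedModule) n)
                = sum_n (fun n => Im (a n)) n).
  { induction n; [rewrite !sum_O; reflexivity|].
    rewrite !sum_Sn, <- IHn. reflexivity. }
  split.
  - intros H. split; intros P [e HP].
    + assert (L : locally (l : C_NormedModule) (fun z => P (Re z))).
      { exists e. intros y [Hy _]. apply HP. exact Hy. }
      apply H in L. unfold filtermap in *. simpl in *.
      revert L. apply filter_imp. intros n. rewrite Hre. auto.
    + assert (L : locally (l : C_NormedModule) (fun z => P (Im z))).
      { exists e. intros y [_ Hy]. apply HP. exact Hy. }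
      apply H in L. unfold filtermap in *. simpl in *.
      revert L. apply filter_imp. intros n. rewrite Him. auto.
  - intros [H1 H2] P [e HP].
    assert (L1 : locally (Re l) (ball (Re l) e)) by apply locally_ball.
    assert (L2 : locally (Im l) (ball (Im l) e)) by apply locally_ball.
    apply H1 in L1. apply H2 in L2. unfold filtermap in *.
    generalize (filter_and _ _ L1 L2). apply filter_imp.
    intros n [B1 B2]. apply HP. split.
    + change (ball (Re l) e (Re (sum_n (a : nat -> C_NormedModule) n))).
      rewrite Hre. exact B1.
    + change (ball (Im l) e (Im (sum_n (a : nat -> C_NormedModule) n))).
      rewrite Him. exact B2.
Qed.

Lemma is_series_CSeries_eq (a : nat -> C) (l : C) :
  is_series (a : nat -> C_NormedModule) l -> CSeries a = l.
Proof.
  intros H. apply is_series_C_iff in H. destruct H as [H1 H2].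
  unfold CSeries. rewrite (is_series_unique _ _ H1), (is_series_unique _ _ H2).
  destruct l; reflexivity.
Qed.

Definition summable (a : nat -> C) : Prop := ex_series (fun n => Cmod (a n)).

Lemma summable_le (a : nat -> C) (b : nat -> R) :
  (forall n, Cmod (a n) <= b n) -> ex_series b -> summable a.
Proof.
  intros H Hb. apply (ex_series_le (K := R_AbsRing) (V := R_CompleteNormedModule))
    with b; auto.
  intros n. change (Rabs (Cmod (a n)) <= b n).
  rewrite Rabs_pos_eq by apply Cmod_ge_0. apply H.
Qed.

Lemma is_series_CSeries (a : nat -> C) :
  summable a -> is_series (a : nat -> C_NormedModule) (CSeries a).
Proof.
  intros H. apply is_series_C_iff. split; simpl.
  - apply Series_correct.
    apply (ex_series_le (K := R_AbsRing) (V := R_CompleteNormedModule))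
      with (fun n => Cmod (a n)); auto. intros; apply re_le_Cmod.
  - apply Series_correct.
    apply (ex_series_le (K := R_AbsRing) (V := R_CompleteNormedModule))
      with (fun n => Cmod (a n)); auto. intros; apply im_le_Cmod.
Qed.

Lemma CSeries_ext (a b : nat -> C) :
  (forall n, a n = b n) -> CSeries a = CSeries b.
Proof.
  intros H. unfold CSeries. f_equal; apply Series_ext; intros n; rewrite H; auto.
Qed.

Lemma summable_ext (a b : nat -> C) :
  (forall n, a n = b n) -> summable a -> summable b.
Proof. intros H. apply ex_series_ext. intros n. rewrite H. auto. Qed.

Lemma summable_plus (a b : nat -> C) :
  summable a -> summable b -> summable (fun n => a n + b n)%C.
Proof.
  intros Ha Hb. apply summable_le with (fun n => Cmod (a n) + Cmod (b n)).
  - intros; apply Cmod_triangle.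
  - apply (ex_series_plus _ _ Ha Hb).
Qed.

Lemma summable_scal (c : C) (a : nat -> C) :
  summable a -> summable (fun n => c * a n)%C.
Proof.
  intros Ha. apply summable_le with (fun n => Cmod c * Cmod (a n)).
  - intros; rewrite Cmod_mult; lra.
  - apply (ex_series_scal (Cmod c) _ Ha).
Qed.

Lemma CSeries_plus (a b : nat -> C) :
  summable a -> summable b ->
  CSeries (fun n => a n + b n)%C = (CSeries a + CSeries b)%C.
Proof.
  intros Ha Hb. apply is_series_CSeries_eq.
  apply (is_series_plus (K := C_AbsRing) (V := C_NormedModule));
    apply is_series_CSeries; auto.
Qed.

Lemma CSeries_scal (c : C) (a : nat -> C) :
  summable a -> CSeries (fun n => c * a n)%C = (c * CSeries a)%C.
Proof.
  intros Ha. apply is_series_CSeries_eq.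
  apply (is_series_scal (K := C_AbsRing) (V := C_NormedModule)).
  apply is_series_CSeries; auto.
Qed.

Lemma CSeries_minus (a b : nat -> C) :
  summable a -> summable b ->
  CSeries (fun n => a n - b n)%C = (CSeries a - CSeries b)%C.
Proof.
  intros Ha Hb.
  rewrite (CSeries_ext _ (fun n => a n + (-(1)) * b n)%C) by (intros; ring).
  rewrite CSeries_plus, CSeries_scal; auto using summable_scal. ring.
Qed.

Lemma CSeries_incr_1 (a : nat -> C) :
  summable a -> CSeries a = (a O + CSeries (fun n => a (S n)))%C.
Proof.
  intros Ha.
  assert (Hd : summable (fun n => a (S n))).
  { apply (ex_series_incr_1 (fun n => Cmod (a n))). exact Ha. }
  apply is_series_CSeries_eq.
  apply (is_series_decr_1 (K := C_AbsRing) (V := C_NormedModule)).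
  match goal with |- is_series _ ?x =>
    replace x with (CSeries (fun n => a (S n))) end.
  - apply is_series_CSeries. exact Hd.
  - change (CSeries (fun n => a (S n))
      = (a O + CSeries (fun n => a (S n))) + - a O)%C. ring.
Qed.

Lemma summable_incr_1 (a : nat -> C) :
  summable a <-> summable (fun n => a (S n)).
Proof. apply (ex_series_incr_1 (fun n => Cmod (a n))). Qed.

Lemma Cmod_CSeries_le (a : nat -> C) (b : nat -> R) :
  (forall n, Cmod (a n) <= b n) -> ex_series b -> Cmod (CSeries a) <= Series b.
Proof.
  intros H Hb.
  assert (Ha := summable_le a b H Hb).
  apply Rle_trans with (Series (fun n => Cmod (a n))).
  2: { apply Series_le; auto. intros; split; auto. apply Cmod_ge_0. }
  assert (L : is_lim_seq
     (fun n => Cmod (sum_n (a : nat -> C_NormedModule) n)) (Cmod (CSeries a))).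
  { apply (filterlim_comp _ _ _ _ (fun z : C => Cmod z) _ (locally (CSeries a : C_NormedModule))).
    - apply is_series_CSeries; auto.
    - apply (filterlim_norm (K := C_AbsRing) (V := C_NormedModule)). }
  change (Rbar_le (Cmod (CSeries a)) (Series (fun n => Cmod (a n)))).
  assert (L' : is_lim_seq (sum_n (fun k => Cmod (a k)))
    (Series (fun n => Cmod (a n)))) by exact (Series_correct _ Ha).
  refine (is_lim_seq_le _ _ _ _ _ L L').
  intros n. apply (norm_sum_n_m (K := C_AbsRing) (V := C_NormedModule)).
Qed.

Lemma sum_n_le_Series (b : nat -> R) :
  (forall n, 0 <= b n) -> ex_series b -> forall n, b n <= Series b.
Proof.
  intros H Hb n.
  assert (L := Series_correct _ Hb).
  apply Rle_trans with (sum_n b n).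
  - destruct n; [rewrite sum_O; lra|]. rewrite sum_Sn. unfold plus; simpl.
    enough (0 <= sum_n b n) by lra.
    clear -H. induction n; [rewrite sum_O; auto|].
    rewrite sum_Sn. unfold plus; simpl. specialize (H (S n)). lra.
  - apply (is_lim_seq_incr_compare (sum_n b) (Series b)); auto.
    intros m. rewrite sum_Sn. unfold plus; simpl. specialize (H (S m)). lra.
Qed.

(** * Power series *)

Definition psum (a : cseq) (z : C) : C := CSeries (fun n => a n * z ^ n)%C.

(** Geometric domination on every smaller disc is the usable form of
    a radius of convergence at least [r]. *)
Definition cv_on (a : cseq) (r : R) : Prop :=
  forall rho, 0 <= rho < r -> exists M, forall n, Cmod (a n) * rho ^ n <= M.

Lemma cv_bound_nonneg (a : cseq) (rho M : R) :
  (forall n, Cmod (a n) * rho ^ n <= M) -> 0 <= M.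
Proof. intros H. eapply Rle_trans; [|apply (H O)]. simpl. nonneg. Qed.

Lemma ex_series_geom_le (q : R) : 0 <= q < 1 -> ex_series (fun n => q ^ n).
Proof.
  intros H. exists (/ (1 - q)). apply is_series_geom. rewrite Rabs_pos_eq; lra.
Qed.

Lemma cv_on_summable (a : cseq) (r rho : R) :
  cv_on a r -> 0 <= rho < r -> ex_series (fun n => Cmod (a n) * rho ^ n).
Proof.
  intros H Hr. destruct (H ((rho + r) / 2)) as [M HM]; [lra|].
  set (s := (rho + r) / 2) in *.
  apply (ex_series_le (K := R_AbsRing) (V := R_CompleteNormedModule))
    with (fun n => M * (rho / s) ^ n).
  - intros n. change (Rabs (Cmod (a n) * rho ^ n) <= M * (rho / s) ^ n).
    rewrite Rabs_pos_eq
      by (apply Rmult_le_pos; [apply Cmod_ge_0|apply pow_le; lra]).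
    replace (Cmod (a n) * rho ^ n)
      with (Cmod (a n) * s ^ n * (rho / s) ^ n).
    + apply Rmult_le_compat_r; auto. apply pow_le.
      apply Rmult_le_pos; [lra|]. left; apply Rinv_0_lt_compat. unfold s; lra.
    + rewrite Rmult_assoc, <- Rpow_mult_distr.
      f_equal. f_equal. unfold s. field. lra.
  - apply (ex_series_scal M (fun n => (rho / s) ^ n)).
    apply ex_series_geom_le. split.
    + apply Rdiv_le_0_compat; unfold s; lra.
    + apply Rdiv_lt_one; unfold s; lra.
Qed.

Lemma psum_summable (a : cseq) (r : R) (z : C) :
  cv_on a r -> Cmod z < r -> summable (fun n => a n * z ^ n)%C.
Proof.
  intros H Hz. apply summable_le with (fun n => Cmod (a n) * Cmod z ^ n).
  - intros n. rewrite Cmod_mult, Cmod_pow. lra.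
  - apply cv_on_summable with r; auto. split; auto. apply Cmod_ge_0.
Qed.

Lemma pow_n_Cpow (z : C) (n : nat) : pow_n (K := C_AbsRing) z n = (z ^ n)%C.
Proof. induction n; simpl; [reflexivity|]. rewrite IHn. reflexivity. Qed.

Lemma sums_to_iff_series (a : cseq) (z s : C) :
  sums_to a z s <-> is_series (fun n => a n * z ^ n : C_NormedModule)%C s.
Proof.
  unfold sums_to, is_pseries.
  assert (E : forall n, scal (pow_n (K := C_AbsRing) z n) (a n : C_NormedModule)
     = (a n * z ^ n)%C).
  { intros n. transitivity (pow_n (K := C_AbsRing) z n * a n)%C; [reflexivity|].
    rewrite (pow_n_Cpow z n). apply Cmult_comm. }
  split; apply is_series_ext; intros n; [apply E|symmetry; apply E].
Qed.

Lemma sums_to_psum (a : cseq) (r : R) (z : C) :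
  cv_on a r -> Cmod z < r -> sums_to a z (psum a z).
Proof.
  intros H Hz. apply sums_to_iff_series. apply is_series_CSeries.
  apply psum_summable with r; auto.
Qed.

Lemma sums_to_unique (a : cseq) (z s : C) : sums_to a z s -> psum a z = s.
Proof.
  intros H. apply is_series_CSeries_eq. apply sums_to_iff_series. exact H.
Qed.

Lemma cv_on_le (a : cseq) (r s : R) : s <= r -> cv_on a r -> cv_on a s.
Proof. intros Hs H rho Hrho. apply H. lra. Qed.

Lemma radius_cv_on (a : cseq) (r : R) :
  Rbar_le r (radius a) -> cv_on a r.
Proof.
  intros H rho Hrho. unfold radius in H.
  assert (L : Rbar_lt (Rabs rho) (CV_radius (fun n => Cmod (a n)))).
  { apply Rbar_lt_le_trans with r; auto. simpl. rewrite Rabs_pos_eq; lra. }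
  apply CV_disk_inside in L.
  exists (Series (fun n => Rabs (Cmod (a n) * rho ^ n))). intros n.
  eapply Rle_trans; [apply Rle_abs|].
  apply (sum_n_le_Series (fun n => Rabs (Cmod (a n) * rho ^ n))); auto.
  intros; apply Rabs_pos.
Qed.

Lemma cv_on_radius (a : cseq) (r : R) :
  cv_on a r -> Rbar_le r (radius a).
Proof.
  intros H. unfold radius.
  destruct (CV_radius_bounded (fun n => Cmod (a n))) as [Hub _].
  assert (B : forall rho, 0 <= rho < r -> Rbar_le rho (CV_radius (fun n => Cmod (a n)))).
  { intros rho Hrho. apply Hub. destruct (H rho Hrho) as [M HM].
    exists M. intros n. rewrite Rabs_pos_eq; auto.
    apply Rmult_le_pos; [apply Cmod_ge_0|apply pow_le; lra]. }
  pose proof (CV_radius_ge_0 (fun n => Cmod (a n))) as H0.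
  destruct (CV_radius (fun n => Cmod (a n))) as [x| |]; simpl in *; try tauto.
  apply Rnot_lt_le. intros Hx. specialize (B ((x + r) / 2)). lra.
Qed.

Lemma lt_radius_cv_on (a : cseq) (x : R) :
  0 <= x -> Rbar_lt x (radius a) -> exists r, x < r /\ cv_on a r.
Proof.
  intros H0 H. destruct (radius a) as [y| |] eqn:E; simpl in H; try tauto.
  - exists y. split; auto. apply radius_cv_on. rewrite E. simpl; lra.
  - exists (x + 1). split; [lra|]. apply radius_cv_on. rewrite E. exact I.
Qed.

Lemma convergent_cv_on (a : cseq) :
  convergent a <-> exists r, 0 < r /\ cv_on a r.
Proof.
  split.
  - intros H. apply lt_radius_cv_on; auto. lra.
  - intros (r & Hr & H). apply cv_on_radius in H.
    apply Rbar_lt_le_trans with r; auto.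
Qed.

(** Convergence at a single point bounds the terms, hence gives the whole disc. *)
Lemma cv_on_sums_to (a : cseq) (z s : C) : sums_to a z s -> cv_on a (Cmod z).
Proof.
  intros H. apply sums_to_iff_series in H.
  assert (L : is_lim_seq (fun n => Cmod (a n * z ^ n)) 0).
  { apply is_series_C_iff in H. destruct H as [H1 H2].
    assert (E1 : ex_series (fun n => Re (a n * z ^ n)%C)) by (eexists; apply H1).
    assert (E2 : ex_series (fun n => Im (a n * z ^ n)%C)) by (eexists; apply H2).
    apply ex_series_lim_0 in E1. apply ex_series_lim_0 in E2.
    apply is_lim_seq_abs_0 in E1. apply is_lim_seq_abs_0 in E2.
    apply is_lim_seq_le_le with (fun _ => 0)
      (fun n => Rabs (Re (a n * z ^ n)%C) + Rabs (Im (a n * z ^ n)%C)).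
    - intros n. split; [apply Cmod_ge_0|apply Cmod_le_Re_Im].
    - apply is_lim_seq_const.
    - replace 0 with (0 + 0) by ring. apply is_lim_seq_plus'; auto. }
  assert (B := filterlim_bounded (K := R_AbsRing) (V := R_NormedModule)
    (fun n => Cmod (a n * z ^ n)) (ex_intro _ 0 L)).
  destruct B as [M HM]. intros rho Hrho. exists M. intros n.
  apply Rle_trans with (Cmod (a n * z ^ n)).
  - rewrite Cmod_mult, Cmod_pow. apply Rmult_le_compat_l; [apply Cmod_ge_0|].
    apply pow_incr. lra.
  - eapply Rle_trans; [apply Rle_abs|]. apply (HM n).
Qed.

(** ** Differentiation of power series *)

Definition pder (a : cseq) : cseq := fun n => (INR (S n) * a (S n))%C.

(** Each of the [n + 1] first terms of the geometric series is at least [q ^ n]. *)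
Lemma INR_pow_bounded (q : R) :
  0 <= q < 1 -> exists M, forall n, INR (S n) * q ^ n <= M.
Proof.
  intros Hq. exists (Series (fun n => q ^ n)). intros n.
  assert (E := ex_series_geom_le q Hq).
  apply Rle_trans with (sum_n (fun n => q ^ n) n).
  - assert (H : forall m, (m <= n)%nat -> INR (S m) * q ^ n <= sum_n (fun k => q ^ k) m).
    { induction m; intros Hm.
      - rewrite sum_O. simpl. rewrite Rmult_1_l. rewrite <- (pow1 n).
        apply pow_incr. lra.
      - rewrite sum_Sn, S_INR. unfold plus; simpl (_ + _).
        assert (q ^ n <= q ^ (S m)).
        { replace n with (S m + (n - S m))%nat by lia. rewrite pow_add.
          rewrite <- (Rmult_1_r (q ^ S m)) at 2.
          apply Rmult_le_compat_l; [apply pow_le; lra|].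
          rewrite <- (pow1 (n - S m)). apply pow_incr; lra. }
        specialize (IHm ltac:(lia)). simpl in *. lra. }
    apply H; auto.
  - apply (is_lim_seq_incr_compare (sum_n (fun n => q ^ n))).
    + apply (Series_correct _ E).
    + intros m. rewrite sum_Sn. unfold plus; simpl.
      assert (0 <= q * q ^ m) by (apply (pow_le q (S m)); lra). lra.
Qed.

Lemma cv_on_pder (a : cseq) (r : R) : cv_on a r -> cv_on (pder a) r.
Proof.
  intros H rho Hrho. set (s := (rho + r) / 2).
  destruct (H s) as [M HM]; [unfold s; lra|].
  assert (Hs : rho < s /\ 0 < s) by (unfold s; lra).
  assert (Hq : 0 <= rho / s < 1).
  { split; [apply Rdiv_le_0_compat|apply Rdiv_lt_one]; lra. }
  destruct (INR_pow_bounded _ Hq) as [N HN].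
  assert (M0 := cv_bound_nonneg a s M HM).
  exists (M * N / s). intros n. unfold pder. rewrite Cmod_mult, Cmod_R.
  rewrite Rabs_pos_eq by apply pos_INR.
  replace (INR (S n) * Cmod (a (S n)) * rho ^ n)
    with ((Cmod (a (S n)) * s ^ S n) * (INR (S n) * (rho / s) ^ n) / s).
  - unfold Rdiv. apply Rmult_le_compat_r; [left; apply Rinv_0_lt_compat; lra|].
    apply Rmult_le_compat; auto.
    + apply Rmult_le_pos; [apply Cmod_ge_0|apply pow_le; lra].
    + apply Rmult_le_pos; [apply pos_INR|apply pow_le; lra].
  - unfold Rdiv. rewrite Rpow_mult_distr, pow_inv. simpl. field.
    split; try apply pow_nonzero; lra.
Qed.

(** If [e n] is the second order remainder of [z ^ n], then
    [e (n + 1) = (z + h) * e n + n * h ^ 2 * z ^ (n - 1)]. *)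
Lemma pow_increment_bound (z h : C) (rho : R) (n : nat) :
  Cmod z <= rho -> Cmod (z + h)%C <= rho ->
  Cmod ((z + h) ^ S (S n) - z ^ S (S n) - h * (INR (S (S n)) * z ^ S n))%C
  <= Cmod h ^ 2 * (INR (S (S n)) * INR (S n) * rho ^ n).
Proof.
  intros Hz Hzh. induction n.
  - replace ((z + h) ^ 2 - z ^ 2 - h * (INR 2 * z ^ 1))%C with (h ^ 2)%C.
    + rewrite Cmod_pow. simpl. assert (0 <= Cmod h) by apply Cmod_ge_0. nra.
    + simpl. rewrite RtoC_plus. ring.
  - set (e := (_ - _ - _)%C) in IHn.
    replace ((z + h) ^ S (S (S n)) - z ^ S (S (S n))
             - h * (INR (S (S (S n))) * z ^ S (S n)))%C
      with ((z + h) * e + h ^ 2 * (INR (S (S n)) * z ^ S n))%C.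
    + eapply Rle_trans; [apply Cmod_triangle|].
      rewrite !Cmod_mult, !Cmod_pow, Cmod_R.
      rewrite (Rabs_pos_eq (INR _)) by apply pos_INR.
      assert (R0 : 0 <= rho) by (eapply Rle_trans; [apply Cmod_ge_0|apply Hz]).
      assert (P1 : Cmod z ^ S n <= rho ^ S n)
        by (apply pow_incr; split; auto; apply Cmod_ge_0).
      assert (P2 : Cmod (z + h)%C * Cmod e <=
         rho * (Cmod h ^ 2 * (INR (S (S n)) * INR (S n) * rho ^ n)))
        by (apply Rmult_le_compat; auto; apply Cmod_ge_0).
      assert (H2 : 0 <= Cmod h ^ 2) by (apply pow2_ge_0).
      assert (I2 : 0 <= INR (S (S n))) by apply pos_INR.
      assert (P3 : Cmod h ^ 2 * (INR (S (S n)) * Cmod z ^ S n)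
         <= Cmod h ^ 2 * (INR (S (S n)) * rho ^ S n)).
      { apply Rmult_le_compat_l; auto. apply Rmult_le_compat_l; auto. }
      rewrite (S_INR (S (S n))).
      rewrite (S_INR n) in P2. rewrite (S_INR (S n)) in *. rewrite (S_INR n) in *.
      assert (N0 : 0 <= INR n) by apply pos_INR.
      assert (Rn : 0 <= rho ^ n) by (apply pow_le; auto).
      simpl pow in *.
      assert (X : 0 <= Cmod h * (Cmod h * 1) * (rho * rho ^ n) * (INR n + 1 + 1))
        by (repeat apply Rmult_le_pos; auto using Cmod_ge_0; lra).
      nra.
    + unfold e. rewrite (S_INR (S (S n))), RtoC_plus.
      rewrite !Cpow_S. ring.
Qed.

(** The second order remainders are summable, because the second formal
    derivative of [a] has the same disc of convergence. *)
Lemma is_derive_psum (a : cseq) (r : R) (z : C) :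
  cv_on a r -> Cmod z < r -> is_derive (psum a) z (psum (pder a) z).
Proof.
  intros H Hz. apply is_derive_C_iff. intros eps He.
  set (rho := (Cmod z + r) / 2).
  assert (Z0 := Cmod_ge_0 z).
  assert (Hrho : Cmod z < rho < r) by (unfold rho; lra).
  assert (H2 := cv_on_summable _ r rho (cv_on_pder _ _ (cv_on_pder _ _ H)) ltac:(lra)).
  set (K := Series (fun n => Cmod (pder (pder a) n) * rho ^ n)) in *.
  assert (K0 : 0 <= K).
  { eapply Rle_trans; [|apply (sum_n_le_Series _ (fun n => Rmult_le_pos _ _ (Cmod_ge_0 _) (pow_le rho n ltac:(lra))) H2 O)].
    apply Rmult_le_pos; [apply Cmod_ge_0|apply pow_le; lra]. }
  exists (Rmin (rho - Cmod z) (eps / (K + 1))). split.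
  { apply Rmin_pos; [lra|]. apply Rdiv_lt_0_compat; lra. }
  intros w Hw.
  assert (W1 := Rlt_le_trans _ _ _ Hw (Rmin_l _ _)).
  assert (W2 := Rlt_le_trans _ _ _ Hw (Rmin_r _ _)).
  set (h := (w - z)%C) in *.
  assert (Ew : w = (z + h)%C) by (unfold h; ring). rewrite Ew.
  assert (Hzh : Cmod (z + h)%C <= rho).
  { eapply Rle_trans; [apply Cmod_triangle|]. lra. }
  assert (S1 : summable (fun n => a n * (z + h) ^ n)%C)
    by (apply psum_summable with r; auto; lra).
  assert (S2 : summable (fun n => a n * z ^ n)%C)
    by (apply psum_summable with r; auto).
  assert (S3 : summable (fun n => pder a n * z ^ n)%C)
    by (apply psum_summable with r; auto using cv_on_pder).
  assert (S1' := S1). apply summable_incr_1 in S1'.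
  assert (S2' := S2). apply summable_incr_1 in S2'.
  assert (S1'' := S1'). apply summable_incr_1 in S1''.
  assert (S2'' := S2'). apply summable_incr_1 in S2''.
  assert (S3' := S3). apply summable_incr_1 in S3'.
  unfold psum.
  rewrite (CSeries_incr_1 _ S1), (CSeries_incr_1 _ S1').
  rewrite (CSeries_incr_1 _ S2), (CSeries_incr_1 _ S2').
  rewrite (CSeries_incr_1 _ S3).
  match goal with |- Cmod (?a0 + (?a1 + ?A) - (?b0 + (?b1 + ?B)) - h * (?c0 + ?D))%C <= _ =>
    replace (a0 + (a1 + A) - (b0 + (b1 + B)) - h * (c0 + D))%C
     with ((A - B) - h * D)%C end.
  2:{ unfold pder. simpl. ring. }
  rewrite <- CSeries_minus by auto.
  rewrite <- CSeries_scal by auto.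
  rewrite <- CSeries_minus; auto using summable_scal.
  2:{ apply (summable_ext (fun n => a (S (S n)) * (z + h) ^ S (S n) +
        (-(1)) * (a (S (S n)) * z ^ S (S n)))%C); [intros; ring|].
      apply summable_plus; auto using summable_scal. }
  apply Rle_trans with (Cmod h ^ 2 * K).
  - unfold K. rewrite <- Series_scal_l. apply Cmod_CSeries_le.
    + intros n.
      replace (a (S (S n)) * (z + h) ^ S (S n) - a (S (S n)) * z ^ S (S n)
         - h * (pder a (S n) * z ^ S n))%C
        with (a (S (S n)) * ((z + h) ^ S (S n) - z ^ S (S n) -
          h * (INR (S (S n)) * z ^ S n)))%C
        by (unfold pder; ring).
      rewrite Cmod_mult. unfold pder. rewrite !Cmod_mult, !Cmod_R.
      rewrite !(Rabs_pos_eq (INR _)) by apply pos_INR.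
      eapply Rle_trans.
      * apply Rmult_le_compat_l; [apply Cmod_ge_0|].
        apply (pow_increment_bound z h rho n); auto. lra.
      * right. ring.
    + apply (ex_series_scal (Cmod h ^ 2) _ H2).
  - assert (Hh := Cmod_ge_0 h).
    assert (W3 : Cmod h * (K + 1) <= eps).
    { apply Rmult_le_reg_r with (/ (K + 1)); [apply Rinv_0_lt_compat; lra|].
      rewrite Rmult_assoc, Rinv_r, Rmult_1_r by lra. left. exact W2. }
    simpl. nra.
Qed.

(** * Holomorphic functions *)

Lemma continuous_C_AbsRing {T : UniformSpace} (f : T -> C) (x : T) :
  continuous (U := C_UniformSpace) f x <->
  continuous (U := AbsRing_UniformSpace C_AbsRing) f x.
Proof.
  split; intros H P HP; apply H; apply locally_C; exact HP.
Qed.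

Lemma continuous_Cplus {T : UniformSpace} (f g : T -> C) (x : T) :
  continuous f x -> continuous g x -> continuous (fun y => f y + g y)%C x.
Proof.
  apply (continuous_plus (K := C_AbsRing) (V := C_NormedModule) f g x).
Qed.

Lemma continuous_Cminus {T : UniformSpace} (f g : T -> C) (x : T) :
  continuous f x -> continuous g x -> continuous (fun y => f y - g y)%C x.
Proof.
  apply (continuous_minus (K := C_AbsRing) (V := C_NormedModule) f g x).
Qed.

Lemma continuous_Cmult {T : UniformSpace} (f g : T -> C) (x : T) :
  continuous f x -> continuous g x -> continuous (fun y => f y * g y)%C x.
Proof.
  intros Hf Hg. apply continuous_C_AbsRing in Hf. apply continuous_C_AbsRing in Hg.
  apply continuous_C_AbsRing. apply (continuous_mult f g x Hf Hg).
Qed.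

Lemma continuous_Re {T : UniformSpace} (f : T -> C) (x : T) :
  continuous f x -> continuous (fun y => Re (f y)) x.
Proof.
  intros H. apply (continuous_comp f (fun z : C => Re z) x H).
  apply continuous_fst.
Qed.

Lemma continuous_Im {T : UniformSpace} (f : T -> C) (x : T) :
  continuous f x -> continuous (fun y => Im (f y)) x.
Proof.
  intros H. apply (continuous_comp f (fun z : C => Im z) x H).
  apply continuous_snd.
Qed.

Lemma continuous_pair {T : UniformSpace} (f g : T -> R) (x : T) :
  continuous f x -> continuous g x ->
  continuous (U := C_UniformSpace) (fun y => (f y, g y) : C) x.
Proof.
  intros Hf Hg P [e HP].
  assert (L1 := Hf (ball (f x) e) (locally_ball (f x) e)).
  assert (L2 := Hg (ball (g x) e) (locally_ball (g x) e)).
  unfold filtermap in *. generalize (filter_and _ _ L1 L2).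
  apply filter_imp. intros y [H1 H2]. apply HP. split; assumption.
Qed.

Lemma continuous_RtoC {T : UniformSpace} (f : T -> R) (x : T) :
  continuous f x -> continuous (U := C_UniformSpace) (fun y => RtoC (f y)) x.
Proof.
  intros H. apply continuous_pair; auto. apply continuous_const.
Qed.

Lemma is_derive_Cinv (z : C) :
  z <> 0 -> is_derive (fun w : C => (/ w)%C) z (- / (z * z))%C.
Proof.
  intros Hz. apply is_derive_C_iff. intros eps He.
  assert (Z0 : 0 < Cmod z) by (apply Cmod_gt_0; auto).
  set (m := Cmod z) in *.
  assert (Hd : 0 < eps * m ^ 3 / 2).
  { apply Rdiv_lt_0_compat; [|lra]. apply Rmult_lt_0_compat; auto.
    apply pow_lt; auto. }
  exists (Rmin (m / 2) (eps * m ^ 3 / 2)). split.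
  { apply Rmin_pos; lra. }
  intros w Hw.
  assert (W1 := Rlt_le_trans _ _ _ Hw (Rmin_l _ _)).
  assert (W2 := Rlt_le_trans _ _ _ Hw (Rmin_r _ _)).
  assert (Hmw : m / 2 <= Cmod w).
  { assert (T : m <= Cmod w + Cmod (w - z)%C).
    { unfold m. replace z with (w + - (w - z))%C at 1 by ring.
      eapply Rle_trans; [apply Cmod_triangle|]. rewrite Cmod_opp. lra. }
    lra. }
  assert (Hw0 : w <> 0).
  { intros E. rewrite E, Cmod_0 in Hmw. lra. }
  replace (/ w - / z - (w - z) * - / (z * z))%C
    with ((w - z) * (w - z) * / (w * (z * z)))%C by (field; auto).
  rewrite !Cmod_mult, Cmod_inv by (repeat apply Cmult_neq_0; auto).
  rewrite !Cmod_mult. fold m.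
  rewrite Rmult_assoc, Rmult_comm.
  apply Rmult_le_compat_r; [apply Cmod_ge_0|].
  apply Rle_trans with (eps * m ^ 3 / 2 * / (m / 2 * (m * m))).
  - apply Rmult_le_compat; [apply Cmod_ge_0| |lra|].
    + left. apply Rinv_0_lt_compat. apply Rmult_lt_0_compat; nra.
    + apply Rinv_le_contravar; [nra|]. apply Rmult_le_compat_r; nra.
  - right. field. lra.
Qed.

Lemma is_derive_C_AbsRing (f : C -> C) (z l : C) :
  is_derive (V := C_NormedModule) f z l <->
  is_derive (V := AbsRing_NormedModule C_AbsRing) f z l.
Proof. split; intros [_ H]; (split; [apply is_linear_scal_l|exact H]). Qed.

Lemma is_derive_Cmult (f g : C -> C) (z df dg : C) :
  is_derive f z df -> is_derive g z dg ->
  is_derive (fun w => f w * g w)%C z (df * g z + f z * dg)%C.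
Proof.
  intros Hf Hg. apply is_derive_C_AbsRing in Hf, Hg. apply is_derive_C_AbsRing.
  exact (is_derive_mult (K := C_AbsRing) f g z df dg Hf Hg Cmult_comm).
Qed.

(** Complex differentiability with a continuous derivative: the class in
    which Cauchy's integral formula is proved below. *)
Definition hol (U : C -> Prop) (f : C -> C) : Prop :=
  exists f' : C -> C, forall z, U z -> is_derive f z (f' z) /\ continuous f' z.

Lemma hol_const (U : C -> Prop) (c : C) : hol U (fun _ => c).
Proof.
  exists (fun _ => RtoC 0). intros z _. split.
  - apply (is_derive_const (K := C_AbsRing) (V := C_NormedModule)).
  - apply continuous_const.
Qed.

Lemma hol_id (U : C -> Prop) : hol U (fun z => z).
Proof.
  exists (fun _ => RtoC 1). intros z _. split.
  - apply is_derive_C_iff. intros eps He. exists 1. split; [lra|]. intros w _.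
    replace (w - z - (w - z) * 1)%C with (RtoC 0) by ring. rewrite Cmod_0.
    apply Rmult_le_pos; [lra|apply Cmod_ge_0].
  - apply continuous_const.
Qed.

Lemma hol_continuous (U : C -> Prop) (f : C -> C) (z : C) :
  hol U f -> U z -> continuous f z.
Proof. intros [f' H] Hz. apply is_derive_continuous with (f' z), H, Hz. Qed.

Lemma hol_plus (U : C -> Prop) (f g : C -> C) :
  hol U f -> hol U g -> hol U (fun z => f z + g z)%C.
Proof.
  intros [f' Hf] [g' Hg]. exists (fun z => f' z + g' z)%C. intros z Hz.
  destruct (Hf z Hz), (Hg z Hz). split.
  - apply (is_derive_plus (K := C_AbsRing) (V := C_NormedModule)); auto.
  - apply continuous_Cplus; auto.
Qed.

Lemma hol_mult (U : C -> Prop) (f g : C -> C) :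
  hol U f -> hol U g -> hol U (fun z => f z * g z)%C.
Proof.
  intros Hf0 Hg0. pose proof Hf0 as [f' Hf]. pose proof Hg0 as [g' Hg].
  exists (fun z => f' z * g z + f z * g' z)%C. intros z Hz.
  destruct (Hf z Hz), (Hg z Hz). split.
  - apply is_derive_Cmult; auto.
  - assert (continuous f z) by (apply hol_continuous with U; auto).
    assert (continuous g z) by (apply hol_continuous with U; auto).
    apply continuous_Cplus; apply continuous_Cmult; auto.
Qed.

Lemma hol_ext (U : C -> Prop) (f g : C -> C) :
  (forall z, f z = g z) -> hol U f -> hol U g.
Proof.
  intros E. replace g with f; auto. apply functional_extensionality; auto.
Qed.

Lemma hol_opp (U : C -> Prop) (f : C -> C) :
  hol U f -> hol U (fun z => - f z)%C.
Proof.
  intros H. apply hol_ext with (fun z => (-(1)) * f z)%C; [intros; ring|].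
  apply hol_mult; auto. apply hol_const.
Qed.

Lemma hol_minus (U : C -> Prop) (f g : C -> C) :
  hol U f -> hol U g -> hol U (fun z => f z - g z)%C.
Proof. intros Hf Hg. apply hol_plus; auto. apply hol_opp; auto. Qed.

Lemma hol_comp (U V : C -> Prop) (f g : C -> C) :
  hol V f -> hol U g -> (forall z, U z -> V (g z)) -> hol U (fun z => f (g z)).
Proof.
  intros [f' Hf] Hg0 HUV. pose proof Hg0 as [g' Hg].
  exists (fun z => g' z * f' (g z))%C. intros z Hz.
  destruct (Hf _ (HUV z Hz)), (Hg z Hz). split.
  - apply (is_derive_comp (K := C_AbsRing) (V := C_NormedModule)); auto.
    apply is_derive_C_AbsRing; auto.
  - apply continuous_Cmult; auto. apply continuous_comp; auto.
    apply hol_continuous with U; auto.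
Qed.

Lemma hol_inv (U : C -> Prop) (f : C -> C) :
  hol U f -> (forall z, U z -> f z <> 0) -> hol U (fun z => / f z)%C.
Proof.
  intros Hf Hn.
  apply (hol_comp U (fun w => w <> 0) (fun w => / w)%C f); auto.
  exists (fun z => - / (z * z))%C. intros z Hz. split.
  - apply is_derive_Cinv; auto.
  - assert (E : forall y : C, ((-(1)) * (/ y * / y) = - / (y * y))%C).
    { intros y. destruct (Ceq_dec y 0) as [->|Hy]; [|field; auto].
      rewrite Cmult_0_l.
      replace (/ 0)%C with (RtoC 0); [ring|].
      apply injective_projections; simpl; unfold Rdiv; ring. }
    apply (continuous_ext _ _ z E).
    assert (continuous (fun w : C => (/ w)%C) z)
      by (eapply is_derive_continuous; apply is_derive_Cinv; auto).
    apply continuous_Cmult; [apply continuous_const|].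
    apply continuous_Cmult; auto.
Qed.

Lemma hol_subset (U V : C -> Prop) (f : C -> C) :
  (forall z, U z -> V z) -> hol V f -> hol U f.
Proof. intros H [f' Hf]. exists f'. auto. Qed.

(** Local derivatives glue to a function because a derivative is unique. *)
Lemma hol_local (U : C -> Prop) (f : C -> C) :
  (forall z, U z -> exists r g, 0 < r /\ hol (fun w => Cmod (w - z)%C < r) g /\
     forall w, Cmod (w - z)%C < r -> f w = g w) ->
  hol U f.
Proof.
  intros H. exists (C_derive f). intros z Hz.
  destruct (H z Hz) as (r & g & Hr & [g' Hg] & E).
  assert (D : forall w, Cmod (w - z)%C < r -> is_derive f w (g' w)).
  { intros w Hw. destruct (Hg w Hw) as [Dg _].
    apply (is_derive_ext_loc (K := C_AbsRing) (V := C_NormedModule) g f).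
    - apply locally_C. apply locally_disc. exists (r - Cmod (w - z)%C). split; [lra|].
      intros y Hy. symmetry. apply E.
      replace (y - z)%C with ((y - w) + (w - z))%C by ring.
      eapply Rle_lt_trans; [apply Cmod_triangle|]. lra.
    - exact Dg. }
  assert (Dz : Cmod (z - z)%C < r).
  { replace (z - z)%C with (RtoC 0) by ring. rewrite Cmod_0; auto. }
  assert (DE : forall w, Cmod (w - z)%C < r -> C_derive f w = g' w).
  { intros w Hw. apply is_C_derive_unique. auto. }
  split.
  - rewrite DE; auto.
  - apply continuous_ext_loc with g'.
    + apply locally_disc. exists r. split; auto. intros w Hw. symmetry; auto.
    + apply (Hg z Dz).
Qed.

Lemma hol_psum (a : cseq) (r : R) (p : C) :
  cv_on a r -> hol (fun z => Cmod (z - p)%C < r) (fun z => psum a (z - p)%C).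
Proof.
  intros H.
  apply (hol_comp _ (fun w => Cmod w < r) (psum a) (fun z => z - p)%C).
  - exists (psum (pder a)). intros z Hz. split.
    + apply is_derive_psum with r; auto.
    + eapply is_derive_continuous. apply is_derive_psum with r; auto.
      apply cv_on_pder; auto.
  - apply hol_minus; [apply hol_id|apply hol_const].
  - auto.
Qed.

(** * Cauchy's integral formula and Taylor's theorem *)

Lemma is_derive_R_iff (f : R -> R) (x l : R) :
  is_derive f x l <->
  forall eps, 0 < eps -> exists d, 0 < d /\
    forall y, Rabs (y - x) < d ->
      Rabs (f y - f x - (y - x) * l) <= eps * Rabs (y - x).
Proof.
  split.
  - intros [_ H] eps He.
    specialize (H x (fun P H => H) (mkposreal eps He)).
    destruct H as [d Hd]. exists d. split; [apply cond_pos|].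
    intros y Hy. apply (Hd y Hy).
  - intros H. split; [apply is_linear_scal_l|].
    intros y Hy eps. 
    pose proof (@is_filter_lim_locally_unique R_AbsRing
      (AbsRing_NormedModule R_AbsRing) x y Hy) as E. subst y.
    destruct (H eps (cond_pos eps)) as (d & Hd & Hw).
    exists (mkposreal d Hd). intros y Hy'. apply (Hw y Hy').
Qed.

Definition rpath_derive (g : R -> C) (t : R) (v : C) : Prop :=
  is_derive (fun s => Re (g s)) t (Re v) /\ is_derive (fun s => Im (g s)) t (Im v).

Lemma rpath_derive_iff (g : R -> C) (t : R) (v : C) :
  rpath_derive g t v <->
  forall eps, 0 < eps -> exists d, 0 < d /\
    forall s, Rabs (s - t) < d ->
      Cmod (g s - g t - (s - t)%R * v)%C <= eps * Rabs (s - t).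
Proof.
  assert (ER : forall s, Re (g s - g t - (s - t)%R * v)%C
     = Re (g s) - Re (g t) - (s - t) * Re v) by (intros; unfold Re, Im; simpl; ring).
  assert (EI : forall s, Im (g s - g t - (s - t)%R * v)%C
     = Im (g s) - Im (g t) - (s - t) * Im v) by (intros; unfold Re, Im; simpl; ring).
  split.
  - intros [H1 H2] eps He.
    destruct (proj1 (is_derive_R_iff _ _ _) H1 (eps / 2)) as (d1 & Hd1 & W1); [lra|].
    destruct (proj1 (is_derive_R_iff _ _ _) H2 (eps / 2)) as (d2 & Hd2 & W2); [lra|].
    exists (Rmin d1 d2). split; [apply Rmin_pos; auto|]. intros s Hs.
    specialize (W1 s (Rlt_le_trans _ _ _ Hs (Rmin_l _ _))).
    specialize (W2 s (Rlt_le_trans _ _ _ Hs (Rmin_r _ _))).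
    rewrite <- ER in W1. rewrite <- EI in W2.
    eapply Rle_trans; [apply Cmod_le_Re_Im|]. lra.
  - intros H. split; apply is_derive_R_iff; intros eps He;
      destruct (H eps He) as (d & Hd & W); exists d; split; auto;
      intros s Hs; specialize (W s Hs); [rewrite <- ER|rewrite <- EI];
      (eapply Rle_trans; [|apply W]); [apply re_le_Cmod|apply im_le_Cmod].
Qed.

Lemma rpath_derive_comp (f : C -> C) (g : R -> C) (t : R) (l v : C) :
  is_derive f (g t) l -> rpath_derive g t v ->
  rpath_derive (fun s => f (g s)) t (v * l)%C.
Proof.
  intros Hf Hg. apply rpath_derive_iff. intros eps He.
  assert (V0 := Cmod_ge_0 v). assert (L0 := Cmod_ge_0 l).
  set (e1 := eps / (2 * (Cmod v + 1))).
  assert (He1 : 0 < e1) by (apply Rdiv_lt_0_compat; lra).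
  set (e2 := eps / (2 * (Cmod l + 1))).
  assert (He2 : 0 < e2) by (apply Rdiv_lt_0_compat; lra).
  destruct (proj1 (is_derive_C_iff _ _ _) Hf e1 He1) as (d1 & Hd1 & W1).
  destruct (proj1 (rpath_derive_iff _ _ _) Hg e2 He2) as (d2 & Hd2 & W2).
  destruct (proj1 (rpath_derive_iff _ _ _) Hg 1 Rlt_0_1) as (d3 & Hd3 & W3).
  set (d4 := d1 / (Cmod v + 1)).
  assert (Hd4 : 0 < d4) by (apply Rdiv_lt_0_compat; lra).
  exists (Rmin (Rmin d2 d3) d4). split; [repeat apply Rmin_pos; auto|].
  intros s Hs.
  assert (A2 : Rabs (s - t) < d2) by
    (eapply Rlt_le_trans; [apply Hs|]; eapply Rle_trans; [apply Rmin_l|apply Rmin_l]).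
  assert (A3 : Rabs (s - t) < d3) by
    (eapply Rlt_le_trans; [apply Hs|]; eapply Rle_trans; [apply Rmin_l|apply Rmin_r]).
  assert (A4 : Rabs (s - t) < d4) by
    (eapply Rlt_le_trans; [apply Hs|]; apply Rmin_r).
  specialize (W2 s A2). specialize (W3 s A3).
  set (h := Rabs (s - t)) in *. assert (H0 : 0 <= h) by apply Rabs_pos.
  assert (G : Cmod (g s - g t)%C <= (Cmod v + 1) * h).
  { replace (g s - g t)%C with ((g s - g t - (s - t)%R * v) + (s - t)%R * v)%C by ring.
    eapply Rle_trans; [apply Cmod_triangle|].
    rewrite Cmod_mult, Cmod_R. fold h. lra. }
  assert (A1 : Cmod (g s - g t)%C < d1).
  { eapply Rle_lt_trans; [apply G|].
    apply Rlt_le_trans with ((Cmod v + 1) * d4).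
    - apply Rmult_lt_compat_l; lra.
    - right. unfold d4. field. lra. }
  specialize (W1 _ A1).
  replace (f (g s) - f (g t) - (s - t)%R * (v * l))%C with
    ((f (g s) - f (g t) - (g s - g t) * l) + (g s - g t - (s - t)%R * v) * l)%C by ring.
  eapply Rle_trans; [apply Cmod_triangle|]. rewrite Cmod_mult.
  assert (B1 : e1 * Cmod (g s - g t)%C <= eps / 2 * h).
  { apply Rle_trans with (e1 * ((Cmod v + 1) * h)).
    - apply Rmult_le_compat_l; lra.
    - right. unfold e1. field. lra. }
  assert (B2 : Cmod (g s - g t - (s - t)%R * v)%C * Cmod l <= eps / 2 * h).
  { apply Rle_trans with (e2 * h * (Cmod l + 1)).
    - apply Rmult_le_compat; auto; try apply Cmod_ge_0. lra.
    - right. unfold e2. field. lra. }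
  lra.
Qed.

Definition cis (t : R) : C := (cos t, sin t).

Lemma Cmod_cis (t : R) : Cmod (cis t) = 1.
Proof.
  transitivity (sqrt 1); [|apply sqrt_1]. unfold Cmod, cis; simpl. f_equal.
  transitivity (Rsqr (sin t) + Rsqr (cos t)); [unfold Rsqr; ring|apply sin2_cos2].
Qed.

Lemma continuous_cis (t : R) : continuous cis t.
Proof.
  apply continuous_pair; [apply continuous_cos|apply continuous_sin].
Qed.

Lemma rpath_derive_cis (t : R) : rpath_derive cis t (Ci * cis t)%C.
Proof.
  split; simpl.
  - replace (0 * cos t - 1 * sin t) with (- sin t) by ring. apply is_derive_cos.
  - replace (0 * sin t + 1 * cos t) with (cos t) by ring. apply is_derive_sin.
Qed.

Lemma cis_period (t : R) : cis (t + 2 * PI) = cis t.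
Proof.
  unfold cis. rewrite <- (cos_period t 1), <- (sin_period t 1). simpl.
  f_equal; f_equal; ring.
Qed.

Lemma rpath_derive_affine (p v : C) (t : R) :
  rpath_derive (fun s => p + s * v)%C t v.
Proof.
  apply rpath_derive_iff. intros eps He. exists 1. split; [lra|]. intros s _.
  replace (p + s * v - (p + t * v) - (s - t)%R * v)%C with (RtoC 0)
    by (rewrite RtoC_minus; ring).
  rewrite Cmod_0. apply Rmult_le_pos; [lra|apply Rabs_pos].
Qed.

Lemma is_derive_affine (a b z : C) : is_derive (fun w : C => a + b * w)%C z b.
Proof.
  apply is_derive_C_iff. intros eps He. exists 1. split; [lra|]. intros w _.
  replace (a + b * w - (a + b * z) - (w - z) * b)%C with (RtoC 0) by ring.
  rewrite Cmod_0. apply Rmult_le_pos; [lra|apply Cmod_ge_0].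
Qed.

Definition circle_kernel (r : R) (z : C) (t : R) : C := (r * cis t / (r * cis t - z))%C.

Lemma circle_kernel_nz (r : R) (z : C) (t : R) : Cmod z < r -> (r * cis t - z)%C <> 0.
Proof.
  intros Hz E. assert (r0 : 0 < r) by (generalize (Cmod_ge_0 z); lra).
  assert (E' : (RtoC r * cis t)%C = z).
  { replace z with ((r * cis t) - (r * cis t - z))%C by ring. rewrite E. ring. }
  rewrite <- E', Cmod_mult, Cmod_cis, Cmod_R, Rabs_pos_eq in Hz; lra.
Qed.

Lemma continuous_circle_kernel (r : R) (z : C) (t : R) :
  Cmod z < r -> continuous (circle_kernel r z) t.
Proof.
  intros Hz. unfold circle_kernel, Cdiv.
  assert (C1 : continuous (fun y : R => (r * cis y)%C) t)
    by (apply continuous_Cmult; [apply continuous_const|apply continuous_cis]).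
  apply continuous_Cmult; auto.
  apply (continuous_comp (fun y : R => (r * cis y - z)%C) (fun w : C => (/ w)%C)).
  - apply continuous_Cminus; auto. apply continuous_const.
  - eapply is_derive_continuous, is_derive_Cinv, circle_kernel_nz, Hz.
Qed.

Lemma is_derive_Cscal (c : C) (f : C -> C) (z l : C) :
  is_derive f z l -> is_derive (fun w => c * f w)%C z (c * l)%C.
Proof.
  intros H. replace (c * l)%C with (0 * f z + c * l)%C by ring.
  apply (is_derive_Cmult (fun _ => c) f); auto.
  apply (is_derive_const (K := C_AbsRing) (V := C_NormedModule)).
Qed.

(** The contour [|w - p| = r] shrinks to the point [p + z] along segments; the
    Cauchy kernel [k] makes the integral constant during the contraction, since
    its derivative in [u] is the integral of an exact form. *)
Lemma circle_contraction (f : C -> C) (p : C) (R0 r : R) (z c : C) :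
  hol (fun w => Cmod (w - p)%C < R0) f -> 0 < r < R0 -> Cmod z < r ->
  let k := circle_kernel r z in
  RInt (fun t => Re (c * (f (p + r * cis t) * k t))%C) 0 (2 * PI) =
  RInt (fun t => Re (c * (f (p + z) * k t))%C) 0 (2 * PI).
Proof.
  intros [f' Hf] Hr Hz k.
  set (Ga := fun u t => (p + (z + RtoC u * (r * cis t - z)))%C).
  set (e := (R0 - r) / (4 * r)).
  assert (He : 0 < e) by (apply Rdiv_lt_0_compat; lra).
  assert (Hk := fun t => circle_kernel_nz r z t Hz).
  assert (HG : forall u t, - e < u < 1 + e -> Cmod (Ga u t - p)%C < R0).
  { intros u t Hu. unfold Ga.
    replace (p + (z + RtoC u * (r * cis t - z)) - p)%C
      with (RtoC (1 - u) * z + RtoC u * (r * cis t))%C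
      by (rewrite RtoC_minus; ring).
    eapply Rle_lt_trans; [apply Cmod_triangle|].
    rewrite !Cmod_mult, Cmod_cis, !Cmod_R, (Rabs_pos_eq r) by lra.
    assert (A : Rabs (1 - u) + Rabs u <= 1 + 2 * e)
      by (unfold Rabs; repeat destruct Rcase_abs; lra).
    assert (B : Rabs (1 - u) * Cmod z <= Rabs (1 - u) * r)
      by (apply Rmult_le_compat_l; [apply Rabs_pos|lra]).
    apply Rle_lt_trans with ((1 + 2 * e) * r); [nra|].
    replace ((1 + 2 * e) * r) with (r + (R0 - r) / 2) by (unfold e; field; lra).
    lra. }
  set (D := fun u t => Re (c * (f' (Ga u t) * (r * cis t)))%C).
  assert (Hcis2 : forall (u t : R), continuous (fun y : R * R => cis (snd y)) (u, t)).
  { intros u t. apply (continuous_comp (fun y : R * R => snd y) cis).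
    - apply continuous_snd.
    - apply continuous_cis. }
  assert (HGc : forall u t, continuous (fun y : R * R => Ga (fst y) (snd y)) (u, t)).
  { intros u t. unfold Ga.
    apply continuous_Cplus; [apply continuous_const|].
    apply continuous_Cplus; [apply continuous_const|].
    apply continuous_Cmult; [apply continuous_RtoC; apply continuous_fst|].
    apply continuous_Cminus; [|apply continuous_const].
    apply continuous_Cmult; [apply continuous_const|apply Hcis2]. }
  assert (HGt : forall u t, continuous (fun y : R => Ga u y) t).
  { intros u t. unfold Ga.
    apply continuous_Cplus; [apply continuous_const|].
    apply continuous_Cplus; [apply continuous_const|].
    apply continuous_Cmult; [apply continuous_const|].
    apply continuous_Cminus; [|apply continuous_const].
    apply continuous_Cmult; [apply continuous_const|apply continuous_cis]. }
  assert (Hkc : forall t, continuous k t) by (intros; apply continuous_circle_kernel; auto).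
  assert (HD : forall u t, - e < u < 1 + e ->
    is_derive (fun u => Re (c * (f (Ga u t) * k t))%C) u (D u t)).
  { intros u t Hu. destruct (Hf _ (HG u t Hu)) as [Df _].
    assert (DF : is_derive (fun w => c * (f w * k t))%C (Ga u t)
       (c * (f' (Ga u t) * k t))%C).
    { apply (is_derive_ext (K := C_AbsRing) (V := C_NormedModule) (fun w => c * k t * f w)%C).
      - intros w. change (c * k t * f w = c * (f w * k t))%C. ring.
      - replace (c * (f' (Ga u t) * k t))%C with (c * k t * f' (Ga u t))%C by ring.
        apply is_derive_Cscal; auto. }
    assert (DG : rpath_derive (fun u => Ga u t) u (r * cis t - z)%C).
    { assert (X := rpath_derive_affine (p + z) (r * cis t - z) u).
      unfold Ga. destruct X as [X1 X2]. split.
      - apply is_derive_ext with (2 := X1). intros; f_equal; ring.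
      - apply is_derive_ext with (2 := X2). intros; f_equal; ring. }
    destruct (rpath_derive_comp _ (fun u => Ga u t) _ _ _ DF DG) as [X _].
    replace (D u t) with (Re ((r * cis t - z) * (c * (f' (Ga u t) * k t)))%C); auto.
    unfold D, k, circle_kernel. f_equal. field. apply Hk. }
  assert (Int : forall u, - e < u < 1 + e ->
    ex_RInt (fun t => Re (c * (f (Ga u t) * k t))%C) 0 (2 * PI)).
  { intros u Hu. apply (ex_RInt_continuous (V := R_CompleteNormedModule)).
    intros t _. apply continuous_Re. apply continuous_Cmult; [apply continuous_const|].
    apply continuous_Cmult; auto. apply (continuous_comp (fun y => Ga u y) f); auto.
    eapply is_derive_continuous. apply (Hf _ (HG u t Hu)). }
  assert (Zero : forall u, 0 <= u <= 1 -> RInt (D u) 0 (2 * PI) = 0).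
  { intros u Hu.
    assert (Hu' : - e < u < 1 + e) by lra.
    assert (HDc : forall t, continuous (D u) t).
    { intros t. apply continuous_Re. apply continuous_Cmult; [apply continuous_const|].
      apply continuous_Cmult.
      - apply (continuous_comp (fun y => Ga u y) f'); auto.
        apply (Hf _ (HG u t Hu')).
      - apply continuous_Cmult; [apply continuous_const|apply continuous_cis]. }
    (* The primitive divides by [u], so the centre of the contraction, where the
     path is constant, is treated apart. *)
  assert (Prim : exists P : R -> R, (forall t, is_derive P t (D u t)) /\
       P (2 * PI) = P 0).
    { destruct (Req_dec u 0) as [->|Hu0].
      - exists (fun t => Re (c * (f' (p + z) * r) * / Ci * cis t)%C). split.
        + intros t.
          destruct (rpath_derive_comp (fun w => 0 + c * (f' (p + z) * r) * / Ci * w)%C cis t _ _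
            (is_derive_affine _ _ _) (rpath_derive_cis t)) as [X _].
          replace (D 0 t) with
            (Re (Ci * cis t * (c * (f' (p + z) * r) * / Ci))%C).
          * revert X. apply is_derive_ext. intros s. f_equal. ring.
          * unfold D, Ga. f_equal.
            replace (p + (z + 0 * (r * cis t - z)))%C with (p + z)%C by ring.
            field. apply Ci_nz.
        + rewrite <- (Rplus_0_l (2 * PI)), cis_period. reflexivity.
      - assert (Hu1 : (Ci * RtoC u)%C <> 0).
        { apply Cmult_neq_0; [apply Ci_nz|]. intros E. apply Hu0.
          apply RtoC_inj. exact E. }
        exists (fun t => Re (c * / (Ci * u) * f (Ga u t))%C). split.
        + intros t. destruct (Hf _ (HG u t Hu')) as [Df _].
          assert (DF := is_derive_Cscal (c * / (Ci * u)) f _ _ Df).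
          assert (DG : rpath_derive (fun t => Ga u t) t (Ci * cis t * (u * r))%C).
          { assert (X := rpath_derive_comp
              (fun w => (p + (z - u * z)) + (u * r) * w)%C cis t _ _
              (is_derive_affine _ _ _) (rpath_derive_cis t)).
            unfold Ga. destruct X as [X1 X2]. split.
            - apply is_derive_ext with (2 := X1). intros; f_equal; ring.
            - apply is_derive_ext with (2 := X2). intros; f_equal; ring. }
          destruct (rpath_derive_comp _ (fun t => Ga u t) _ _ _ DF DG) as [X _].
          replace (D u t) with
            (Re (Ci * cis t * (u * r) * (c * / (Ci * u) * f' (Ga u t)))%C); auto.
          unfold D. f_equal. field. split; [|apply Ci_nz].
          intros E; apply Hu0; apply RtoC_inj; exact E.
        + unfold Ga. rewrite <- (Rplus_0_l (2 * PI)), cis_period. reflexivity. }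
    destruct Prim as (P & HP & EP).
    apply is_RInt_unique.
    replace 0 with (minus (P (2 * PI)) (P 0)) at 2
      by (rewrite EP; unfold minus, plus, opp; simpl; ring).
    apply (is_RInt_derive (V := R_CompleteNormedModule)); auto. }
  set (phi := fun u => RInt (fun t => Re (c * (f (Ga u t) * k t))%C) 0 (2 * PI)).
  assert (E : phi 0 = phi 1).
  { apply (eq_is_derive phi 0 1); [|lra]. intros u Hu.
    assert (Hu' : - e < u < 1 + e) by lra.
    assert (Loc : locally u (fun v => - e < v < 1 + e)).
    { apply (open_and _ _ (open_gt (- e)) (open_lt (1 + e)) u Hu'). }
    assert (X := is_derive_RInt_param
      (fun u t => Re (c * (f (Ga u t) * k t))%C) 0 (2 * PI) u).
    assert (Z : RInt (fun t => Derive (fun u => Re (c * (f (Ga u t) * k t))%C) u)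
      0 (2 * PI) = 0).
    { transitivity (RInt (D u) 0 (2 * PI)); [|apply Zero; auto].
      apply RInt_ext. intros t _. apply is_derive_unique. apply HD; auto. }
    cbv beta in X. rewrite Z in X.
    apply X; clear X.
    - revert Loc. apply filter_imp. intros v Hv t _. eexists. apply HD; auto.
    - intros t _.
        apply (continuity_2d_pt_ext_loc D).
      + destruct Loc as [d Hd]. exists d. intros v s Hv _.
          symmetry. apply is_derive_unique. apply HD. apply Hd. exact Hv.
      + apply continuity_2d_pt_filterlim.
          apply (continuous_Re (fun y : R * R => (c * (f' (Ga (fst y) (snd y)) * (r * cis (snd y))))%C) (u, t)).
          apply continuous_Cmult; [apply continuous_const|].
          apply continuous_Cmult.
        * apply (continuous_comp (fun y : R * R => Ga (fst y) (snd y)) f'); auto.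
             apply (Hf _ (HG u t Hu')).
        * apply continuous_Cmult; [apply continuous_const|apply Hcis2].
    - revert Loc. apply filter_imp. intros v Hv. apply Int; auto.
  }
  unfold phi in E.
  transitivity (RInt (fun t => Re (c * (f (Ga 1 t) * k t))%C) 0 (2 * PI)).
  - apply RInt_ext. intros t _. unfold Ga. do 4 f_equal. ring.
  - rewrite <- E. apply RInt_ext. intros t _. unfold Ga. do 4 f_equal. ring.
Qed.

Lemma is_series_C_of_bound (a : nat -> C) (l : C) (u : nat -> R) :
  (forall N, Cmod (sum_n (a : nat -> C_NormedModule) N - l)%C <= u N) ->
  is_lim_seq u 0 -> is_series (a : nat -> C_NormedModule) l.
Proof.
  intros H Hu P HP. apply locally_disc in HP. destruct HP as (e & He & HP).
  apply is_lim_seq_spec in Hu. destruct (Hu (mkposreal e He)) as [N HN].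
  exists N. intros n Hn. apply HP. specialize (HN n Hn). simpl in HN.
  eapply Rle_lt_trans; [apply H|]. eapply Rle_lt_trans; [apply Rle_abs|].
  rewrite Rminus_0_r in HN. exact HN.
Qed.

Lemma psum_shift (a : cseq) (r : R) (z : C) :
  cv_on a r -> Cmod z < r ->
  psum a z = (a O + z * psum (fun n => a (S n)) z)%C.
Proof.
  intros H Hz. assert (S1 := psum_summable a r z H Hz).
  unfold psum. rewrite (CSeries_incr_1 _ S1). f_equal; [simpl; ring|].
  destruct (Ceq_dec z 0) as [->|Hz0].
  - rewrite Cmult_0_l.
    rewrite (CSeries_ext _ (fun n => 0 * 0)%C) by (intros; simpl; ring).
    rewrite CSeries_scal; [ring|].
    apply summable_le with (fun _ => 0); [intros; rewrite Cmod_0; lra|].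
    exists 0. apply is_series_Reals. intros e He. exists O. intros n _.
    rewrite sum_cte, Rmult_0_l. unfold Rdist. rewrite Rminus_0_r, Rabs_R0. exact He.
  - apply summable_incr_1 in S1. rewrite <- CSeries_scal.
    + apply CSeries_ext. intros; simpl; ring.
    + apply summable_ext with (fun n => / z * (a (S n) * z ^ S n))%C.
      * intros; simpl; field; auto.
      * apply summable_scal; auto.
Qed.

Lemma cv_on_shift (a : cseq) (r : R) : cv_on a r -> cv_on (fun n => a (S n)) r.
Proof.
  intros H rho Hr. set (s := (rho + r) / 2).
  destruct (H s) as [M HM]; [unfold s; lra|].
  assert (Hs : rho <= s /\ 0 < s) by (unfold s; lra).
  exists (M / s). intros n. specialize (HM (S n)).
  apply Rle_trans with (Cmod (a (S n)) * s ^ n).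
  - apply Rmult_le_compat_l; [apply Cmod_ge_0|]. apply pow_incr; lra.
  - apply Rmult_le_reg_r with s; [lra|].
    replace (M / s * s) with M by (field; lra). simpl in HM. lra.
Qed.

Lemma psum_0 (a : cseq) (r : R) : 0 < r -> cv_on a r -> psum a 0 = a O.
Proof.
  intros Hr H. rewrite (psum_shift a r) by (auto; rewrite Cmod_0; auto). ring.
Qed.

Lemma psum_zero_real (n : nat) : forall (a : cseq) (r : R),
  0 < r -> cv_on a r -> (forall x, 0 < x < r -> psum a x = 0) -> a n = 0.
Proof.
  assert (B : forall (a : cseq) (r : R),
    0 < r -> cv_on a r -> (forall x, 0 < x < r -> psum a x = 0) -> a O = 0).
  { intros a r Hr H Hz. apply Cmod_eq_0. apply Rle_antisym; [|apply Cmod_ge_0].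
    apply le_epsilon. intros eps He.
    assert (Hc : continuous (psum a) (RtoC 0)).
    { eapply is_derive_continuous. apply is_derive_psum with r; auto.
      rewrite Cmod_0; auto. }
    destruct (proj1 (continuous_C_iff _ _) Hc eps He) as (d & Hd & W).
    specialize (Hz (Rmin d r / 2)).
    assert (0 < Rmin d r) by (apply Rmin_pos; auto).
    assert (Rmin d r <= d) by apply Rmin_l. assert (Rmin d r <= r) by apply Rmin_r.
    specialize (W (RtoC (Rmin d r / 2))). rewrite Hz in W by lra.
    rewrite (psum_0 a r) in W by auto.
    replace (0 - a O)%C with (- a O)%C in W by ring. rewrite Cmod_opp in W.
    rewrite Rplus_0_l. left. apply W.
    replace (RtoC (Rmin d r / 2) - 0)%C with (RtoC (Rmin d r / 2)) by ring.
    rewrite Cmod_R, Rabs_pos_eq; lra. }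
  induction n; auto.
  intros a r Hr H Hz. apply (IHn (fun n => a (S n)) r Hr (cv_on_shift a r H)).
  intros x Hx. assert (E := Hz x Hx).
  rewrite (psum_shift a r) in E; auto.
  2:{ rewrite Cmod_R, Rabs_pos_eq; lra. }
  rewrite (B a r Hr H Hz) in E. rewrite Cplus_0_l in E.
  assert (X : RtoC x <> 0) by (intros F; apply RtoC_inj in F; lra).
  replace (psum (fun n => a (S n)) x)
    with (/ x * (x * psum (fun n => a (S n)) x))%C by (field; auto).
  rewrite E. ring.
Qed.

Lemma cv_on_lin (a b : cseq) (c : C) (r : R) :
  cv_on a r -> cv_on b r -> cv_on (fun n => a n + c * b n)%C r.
Proof.
  intros Ha Hb rho Hr. destruct (Ha rho Hr) as [M HM]. destruct (Hb rho Hr) as [N HN].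
  exists (M + Cmod c * N). intros n. specialize (HM n). specialize (HN n).
  assert (P : 0 <= rho ^ n) by (apply pow_le; lra).
  apply Rle_trans with ((Cmod (a n) + Cmod c * Cmod (b n)) * rho ^ n).
  - apply Rmult_le_compat_r; auto. rewrite <- Cmod_mult. apply Cmod_triangle.
  - assert (0 <= Cmod c) by apply Cmod_ge_0.
    assert (Cmod c * (Cmod (b n) * rho ^ n) <= Cmod c * N)
      by (apply Rmult_le_compat_l; auto). lra.
Qed.

Lemma psum_lin (a b : cseq) (c : C) (r : R) (z : C) :
  cv_on a r -> cv_on b r -> Cmod z < r ->
  psum (fun n => a n + c * b n)%C z = (psum a z + c * psum b z)%C.
Proof.
  intros Ha Hb Hz.
  assert (Sa := psum_summable a r z Ha Hz). assert (Sb := psum_summable b r z Hb Hz).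
  unfold psum. rewrite <- CSeries_scal, <- CSeries_plus; auto using summable_scal.
  apply CSeries_ext. intros; ring.
Qed.

(** A function that vanishes on a real segment starting at [0] has all its
    coefficients zero, one after the other.  The segment is open at [0], so that it
    may consist of values of the exponential. *)
Lemma psum_unique (a b : cseq) (r : R) :
  0 < r -> cv_on a r -> cv_on b r ->
  (forall x, 0 < x < r -> psum a x = psum b x) -> forall n, a n = b n.
Proof.
  intros Hr Ha Hb H n. apply Ceq_minus.
  replace (a n - b n)%C with (a n + (- (1)) * b n)%C by ring.
  apply (psum_zero_real n (fun n => a n + (- (1)) * b n)%C r); auto using cv_on_lin.
  intros x Hx. rewrite (psum_lin a b _ r); auto.
  - rewrite H; auto. ring.
  - rewrite Cmod_R, Rabs_pos_eq; lra.
Qed.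

(** ** Integrals over the circle *)

Definition cint (h : R -> C) : C :=
  (RInt (fun t => Re (h t)) 0 (2 * PI), RInt (fun t => Im (h t)) 0 (2 * PI)).

Lemma ex_RInt_continuous_everywhere (g : R -> R) (a b : R) :
  (forall t, continuous g t) -> ex_RInt g a b.
Proof.
  intros H. apply (ex_RInt_continuous (V := R_CompleteNormedModule)). auto.
Qed.

Lemma cint_ext (g h : R -> C) : (forall t, g t = h t) -> cint g = cint h.
Proof.
  intros H. unfold cint. f_equal; apply RInt_ext; intros t _; rewrite H; auto.
Qed.

Lemma cint_plus (g h : R -> C) :
  (forall t, continuous g t) -> (forall t, continuous h t) ->
  cint (fun t => g t + h t)%C = (cint g + cint h)%C.
Proof.
  intros Hg Hh. unfold cint. apply injective_projections; simpl;
    apply (RInt_plus (V := R_CompleteNormedModule));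
    apply ex_RInt_continuous_everywhere; intros t;
    auto using continuous_Re, continuous_Im.
Qed.

Lemma cint_scal (c : C) (h : R -> C) :
  (forall t, continuous h t) -> cint (fun t => c * h t)%C = (c * cint h)%C.
Proof.
  intros Hh.
  assert (H1 : ex_RInt (fun t => Re (h t)) 0 (2 * PI))
    by (apply ex_RInt_continuous_everywhere; intros; apply continuous_Re; auto).
  assert (H2 : ex_RInt (fun t => Im (h t)) 0 (2 * PI))
    by (apply ex_RInt_continuous_everywhere; intros; apply continuous_Im; auto).
  apply (RInt_correct (V := R_CompleteNormedModule)) in H1.
  apply (RInt_correct (V := R_CompleteNormedModule)) in H2.
  unfold cint. apply injective_projections; simpl; apply is_RInt_unique.
  - apply (is_RInt_minus (V := R_NormedModule) (fun t => fst c * Re (h t))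
      (fun t => snd c * Im (h t)));
    apply (is_RInt_scal (V := R_NormedModule)); auto.
  - apply (is_RInt_plus (V := R_NormedModule) (fun t => fst c * Im (h t))
      (fun t => snd c * Re (h t)));
    apply (is_RInt_scal (V := R_NormedModule)); auto.
Qed.

Lemma Cmod_cint_le (h : R -> C) (M : R) :
  (forall t, continuous h t) -> (forall t, 0 <= t <= 2 * PI -> Cmod (h t) <= M) ->
  Cmod (cint h) <= 4 * PI * M.
Proof.
  intros Hh HM. assert (P := PI_RGT_0).
  assert (B : forall g : R -> R, (forall t, continuous g t) ->
    (forall t, 0 <= t <= 2 * PI -> Rabs (g t) <= M) ->
    Rabs (RInt g 0 (2 * PI)) <= 2 * PI * M).
  { intros g Hg Hb.
    replace (2 * PI * M) with ((2 * PI - 0) * M) by ring.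
    apply (abs_RInt_le_const g 0 (2 * PI) M); auto; [lra|].
    apply ex_RInt_continuous_everywhere; auto. }
  eapply Rle_trans; [apply Cmod_le_Re_Im|]. unfold cint; simpl.
  assert (B1 := B (fun t => Re (h t)) (fun t => continuous_Re h t (Hh t))).
  assert (B2 := B (fun t => Im (h t)) (fun t => continuous_Im h t (Hh t))).
  assert (C1 : forall t, 0 <= t <= 2 * PI -> Rabs (Re (h t)) <= M)
    by (intros; eapply Rle_trans; [apply re_le_Cmod|auto]).
  assert (C2 : forall t, 0 <= t <= 2 * PI -> Rabs (Im (h t)) <= M)
    by (intros; eapply Rle_trans; [apply im_le_Cmod|auto]).
  specialize (B1 C1). specialize (B2 C2). lra.
Qed.

Lemma continuous_bounded (h : R -> C) (a b : R) :
  a <= b -> (forall t, continuous h t) ->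
  exists M, 0 <= M /\ forall t, a <= t <= b -> Cmod (h t) <= M.
Proof.
  intros Hab H.
  destruct (continuity_ab_maj (fun t => Cmod (h t)) a b Hab) as (m & Hm & _).
  - intros t _. apply continuity_pt_filterlim.
    apply (filterlim_comp _ _ _ h (fun z : C => Cmod z) _ _ _ (H t)).
    apply (filterlim_norm (K := C_AbsRing) (V := C_NormedModule)).
  - exists (Cmod (h m)). split; [apply Cmod_ge_0|auto].
Qed.

Lemma cis_opp_mult (t : R) : (cis t * cis (- t))%C = 1.
Proof.
  unfold cis. rewrite cos_neg, sin_neg.
  apply injective_projections; simpl; [|ring].
  transitivity (Rsqr (sin t) + Rsqr (cos t)); [unfold Rsqr; ring|apply sin2_cos2].
Qed.

Lemma continuous_cis_opp_pow (n : nat) (t : R) :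
  continuous (fun t => cis (- t) ^ n)%C t.
Proof.
  induction n; simpl; [apply continuous_const|].
  apply continuous_Cmult; auto.
  apply (continuous_comp (fun t : R => - t) cis).
  - apply (continuous_opp (V := R_NormedModule)). apply continuous_id.
  - apply continuous_cis.
Qed.

Lemma Cmod_cis_pow (n : nat) (t : R) : Cmod (cis t ^ n)%C = 1.
Proof. rewrite Cmod_pow, Cmod_cis, pow1. reflexivity. Qed.

Definition circle_coef (h : R -> C) (r : R) : cseq :=
  fun n => (cint (fun t => h t * cis (- t) ^ n) / RtoC r ^ n)%C.

(** On the circle the Cauchy kernel is the geometric series in [z / (r cis t)],
    which can be integrated term by term. *)
Lemma circle_expansion (h : R -> C) (r : R) (z : C) :
  (forall t, continuous h t) -> Cmod z < r ->
  cv_on (circle_coef h r) r /\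
  cint (fun t => h t * circle_kernel r z t)%C = psum (circle_coef h r) z.
Proof.
  intros Hh Hz. assert (Z0 := Cmod_ge_0 z). assert (P := PI_RGT_0).
  assert (r0 : 0 < r) by lra.
  assert (Hr : RtoC r <> 0) by (intros E; apply RtoC_inj in E; lra).
  destruct (continuous_bounded h 0 (2 * PI)) as (M & M0 & HM); auto; [lra|].
  split.
  - intros rho Hrho. exists (4 * PI * M). intros n. unfold circle_coef.
    rewrite Cmod_div by (apply Cpow_nz; auto).
    rewrite Cmod_pow, Cmod_R, Rabs_pos_eq by lra.
    assert (B : Cmod (cint (fun t => h t * cis (- t) ^ n)%C) <= 4 * PI * M).
    { apply Cmod_cint_le.
      - intros t. apply continuous_Cmult; auto. apply continuous_cis_opp_pow.
      - intros t Ht. rewrite Cmod_mult, Cmod_cis_pow, Rmult_1_r. auto. }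
    assert (0 < r ^ n) by (apply pow_lt; lra).
    assert (rho ^ n <= r ^ n) by (apply pow_incr; lra).
    assert (Q : / r ^ n * rho ^ n <= 1).
    { apply Rmult_le_reg_l with (r ^ n); auto.
      rewrite <- Rmult_assoc, Rinv_r, Rmult_1_l, Rmult_1_r; lra. }
    unfold Rdiv. rewrite Rmult_assoc. rewrite <- (Rmult_1_r (4 * PI * M)).
    apply Rmult_le_compat; auto; [apply Cmod_ge_0|].
    apply Rmult_le_pos; [left; apply Rinv_0_lt_compat; auto|apply pow_le; lra].
  - set (k := circle_kernel r z).
    set (q := fun t => (z / r * cis (- t))%C).
    assert (Hk := fun t => circle_kernel_nz r z t Hz).
    assert (Hkc : forall t, continuous k t) by (intros; apply continuous_circle_kernel; auto).
    assert (Hqk : forall t, k t = (1 + q t * k t)%C).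
    { intros t. unfold k, circle_kernel, q.
      replace (z / r * cis (- t) * (r * cis t / (r * cis t - z)))%C
        with (z * (cis t * cis (- t)) / (r * cis t - z))%C by (field; auto).
      rewrite cis_opp_mult. field. auto. }
    assert (Hqc : forall n t, continuous (fun t => q t ^ n)%C t).
    { intros n t. apply continuous_ext with (fun t => (z / r) ^ n * cis (- t) ^ n)%C.
      - intros s. symmetry. apply Cpow_mult_l.
      - apply continuous_Cmult; [apply continuous_const|apply continuous_cis_opp_pow]. }
    set (Q := Cmod z / r).
    assert (HQ : 0 <= Q < 1).
    { unfold Q. split; [apply Rdiv_le_0_compat|apply Rdiv_lt_one]; lra. }
    assert (HqQ : forall t, Cmod (q t) = Q).
    { intros t. unfold q. rewrite Cmod_mult, Cmod_cis, Cmod_div by auto.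
      rewrite Cmod_R, Rabs_pos_eq by lra. unfold Q; ring. }
    destruct (continuous_bounded k 0 (2 * PI)) as (K & K0 & HK); auto; [lra|].
    assert (PS : forall N,
      (sum_n (fun n => circle_coef h r n * z ^ n : C_NormedModule)%C N : C)
      = (cint (fun t => h t * k t) - cint (fun t => (h t * k t) * q t ^ S N))%C).
    { assert (T : forall n, (circle_coef h r n * z ^ n)%C = cint (fun t => h t * q t ^ n)%C).
      { intros n. unfold circle_coef.
        rewrite (cint_ext (fun t => h t * q t ^ n)%C
          (fun t => (z / r) ^ n * (h t * cis (- t) ^ n))%C).
        - rewrite cint_scal.
          + unfold Cdiv. rewrite Cpow_mult_l, Cpow_inv by auto. ring.
          + intros t. apply continuous_Cmult; auto. apply continuous_cis_opp_pow.
        - intros t. unfold q. rewrite Cpow_mult_l. ring. }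
      assert (ST : forall n, cint (fun t => (h t * k t) * q t ^ n)%C =
        (cint (fun t => h t * q t ^ n) + cint (fun t => (h t * k t) * q t ^ S n))%C).
      { intros n. rewrite <- cint_plus.
        - apply cint_ext. intros t. rewrite (Hqk t) at 1. simpl. ring.
        - intros t. apply continuous_Cmult; auto.
        - intros t. apply continuous_Cmult; auto. apply continuous_Cmult; auto. }
      induction N.
      - rewrite sum_O. transitivity (circle_coef h r O * z ^ O)%C; [reflexivity|].
        rewrite T. rewrite (cint_ext (fun t => h t * k t)%C
          (fun t => (h t * k t) * q t ^ O)%C) by (intros; simpl; ring).
        rewrite (ST O). ring.
      - rewrite sum_Sn.
        transitivity ((sum_n (fun n => circle_coef h r n * z ^ n : C_NormedModule)%C N : C)
          + circle_coef h r (S N) * z ^ (S N))%C; [reflexivity|].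
        rewrite IHN, T, (ST (S N)). ring. }
    symmetry. apply is_series_CSeries_eq.
    apply (is_series_C_of_bound _ _ (fun N => 4 * PI * (M * K) * Q ^ S N)).
    + intros N. rewrite PS.
      replace (cint (fun t => h t * k t) - cint (fun t => h t * k t * q t ^ S N)
         - cint (fun t => h t * k t))%C
        with (- cint (fun t => h t * k t * q t ^ S N))%C by ring.
      rewrite Cmod_opp, Rmult_assoc. apply Cmod_cint_le.
      * intros t. apply continuous_Cmult; auto. apply continuous_Cmult; auto.
      * intros t Ht. rewrite !Cmod_mult, Cmod_pow, HqQ.
        apply Rmult_le_compat_r; [apply pow_le; lra|].
        apply Rmult_le_compat; auto; apply Cmod_ge_0.
    + replace 0 with (4 * PI * (M * K) * 0) by ring.
      apply (is_lim_seq_scal_l _ (4 * PI * (M * K)) 0).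
      apply (is_lim_seq_incr_1 (fun n => Q ^ n)).
      apply is_lim_seq_geom. rewrite Rabs_pos_eq; lra.
Qed.

Lemma cint_cis_opp_pow (n : nat) : cint (fun t => cis (- t) ^ S n)%C = 0.
Proof.
  assert (N0 : INR (S n) <> 0) by (apply not_0_INR; lia).
  assert (E : forall m t, (cis (- t) ^ m)%C = (cos (INR m * t), - sin (INR m * t))).
  { intros m t. induction m.
    - simpl. rewrite Rmult_0_l, cos_0, sin_0. apply injective_projections; simpl; ring.
    - rewrite Cpow_S, IHm, S_INR. unfold cis. rewrite cos_neg, sin_neg.
      replace ((INR m + 1) * t) with (INR m * t + t) by ring.
      rewrite cos_plus, sin_plus. apply injective_projections; simpl; ring. }
  assert (P1 : sin (INR (S n) * (2 * PI)) = 0).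
  { replace (INR (S n) * (2 * PI)) with (0 + 2 * INR (S n) * PI) by ring.
    rewrite sin_period. apply sin_0. }
  assert (P2 : cos (INR (S n) * (2 * PI)) = 1).
  { replace (INR (S n) * (2 * PI)) with (0 + 2 * INR (S n) * PI) by ring.
    rewrite cos_period. apply cos_0. }
  specialize (E (S n)). revert N0 E P1 P2. generalize (INR (S n)). intros m N0 E P1 P2.
  unfold cint. apply injective_projections; cbn [fst snd RtoC].
  - rewrite (RInt_ext _ (fun t => cos (m * t)))
      by (intros t _; rewrite E; reflexivity).
    apply is_RInt_unique.
    replace 0 with (minus (sin (m * (2 * PI)) / m) (sin (m * 0) / m)) at 2.
    + apply (is_RInt_derive (V := R_CompleteNormedModule) (fun t => sin (m * t) / m)).
      * intros t _. auto_derive; auto. field. auto.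
      * intros t _. apply (continuous_comp (fun t => m * t) cos).
        -- apply (continuous_scal_r (V := R_NormedModule)). apply continuous_id.
        -- apply continuous_cos.
    + unfold minus, plus, opp; simpl. rewrite P1, Rmult_0_r, sin_0. field. auto.
  - rewrite (RInt_ext _ (fun t => - sin (m * t)))
      by (intros t _; rewrite E; reflexivity).
    apply is_RInt_unique.
    replace 0 with (minus (cos (m * (2 * PI)) / m) (cos (m * 0) / m)) at 2.
    + apply (is_RInt_derive (V := R_CompleteNormedModule) (fun t => cos (m * t) / m)).
      * intros t _. auto_derive; auto. field. auto.
      * intros t _. apply (continuous_opp (V := R_NormedModule)).
        apply (continuous_comp (fun t => m * t) sin).
        -- apply (continuous_scal_r (V := R_NormedModule)). apply continuous_id.
        -- apply continuous_sin.
    + unfold minus, plus, opp; simpl. rewrite P2, Rmult_0_r, cos_0. field. auto.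
Qed.

Lemma psum_const (a : cseq) (z : C) : (forall n, a (S n) = 0) -> psum a z = a O.
Proof.
  intros H.
  assert (S1 : summable (fun n => a n * z ^ n)%C).
  { apply summable_incr_1. exists 0. apply is_series_Reals. intros e He. exists O.
    intros n _. unfold Rdist. rewrite Rminus_0_r.
    replace (sum_f_R0 _ n) with 0; [rewrite Rabs_R0; exact He|].
    symmetry. rewrite <- (Rmult_0_l (INR (S n))), <- sum_cte. apply sum_eq.
    intros i _. rewrite H, Cmult_0_l, Cmod_0. reflexivity. }
  unfold psum. rewrite (CSeries_incr_1 _ S1).
  apply summable_incr_1 in S1.
  rewrite (CSeries_ext (fun n => a (S n) * z ^ S n)%C
    (fun n => 0 * (a (S n) * z ^ S n))%C) by (intros; rewrite H; ring).
  rewrite CSeries_scal by auto. simpl. ring.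
Qed.

(** Contracting the circle replaces the integral of [f] against the kernel by
    [f (p + z)] times the integral of the kernel alone, and the latter is found by
    expanding the constant function [1]. *)
Lemma cauchy_circle (f : C -> C) (p : C) (R0 r : R) :
  hol (fun w => Cmod (w - p)%C < R0) f -> 0 < r < R0 ->
  exists a, cv_on a r /\ forall z, Cmod z < r -> f (p + z)%C = psum a z.
Proof.
  intros Hf Hr. assert (P := PI_RGT_0).
  set (h := fun t => f (p + r * cis t)%C).
  assert (Hh : forall t, continuous h t).
  { intros t. unfold h. apply (continuous_comp (fun t => p + r * cis t)%C f).
    - apply continuous_Cplus; [apply continuous_const|].
      apply continuous_Cmult; [apply continuous_const|apply continuous_cis].
    - apply hol_continuous with (fun w => Cmod (w - p)%C < R0); auto.
      replace (p + r * cis t - p)%C with (r * cis t)%C by ring.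
      rewrite Cmod_mult, Cmod_cis, Cmod_R, Rabs_pos_eq; lra. }
  assert (T0 : RtoC (2 * PI) <> 0) by (intros E; apply RtoC_inj in E; lra).
  exists (fun n => / RtoC (2 * PI) * circle_coef h r n)%C. split.
  - destruct (circle_expansion h r 0 Hh) as [H _]; [rewrite Cmod_0; lra|].
    intros rho Hrho. destruct (H rho Hrho) as [M HM].
    exists (Cmod (/ RtoC (2 * PI)) * M). intros n. rewrite Cmod_mult, Rmult_assoc.
    apply Rmult_le_compat_l; [apply Cmod_ge_0|auto].
  - intros z Hz.
    destruct (circle_expansion h r z Hh Hz) as [Hcv E1].
    destruct (circle_expansion (fun _ => RtoC 1) r z) as [_ E2];
      [intros; apply continuous_const|auto|].
    set (k := circle_kernel r z) in *.
    assert (Hkc : forall t, continuous k t) by (intros; apply continuous_circle_kernel; auto).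
    assert (K2 : cint k = RtoC (2 * PI)).
    { rewrite (cint_ext k (fun t => 1 * k t)%C) by (intros; ring).
      rewrite E2, psum_const.
      - unfold circle_coef. simpl. unfold Cdiv. 
        replace (cint (fun _ => 1 * 1)%C) with (RtoC (2 * PI)).
        + field.
        + unfold cint. apply injective_projections; simpl;
            rewrite (RInt_const (V := R_CompleteNormedModule)); unfold scal; simpl;
            unfold mult; simpl; ring.
      - intros n. unfold circle_coef.
        rewrite (cint_ext _ (fun t => cis (- t) ^ S n)%C) by (intros; ring).
        rewrite cint_cis_opp_pow. unfold Cdiv. ring. }
    assert (EQ : cint (fun t => h t * k t)%C = (f (p + z)%C * RtoC (2 * PI))%C).
    { rewrite <- K2, <- cint_scal by auto.
      unfold cint. apply injective_projections; cbn [fst snd].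
      - assert (X := circle_contraction f p R0 r z 1 Hf Hr Hz). cbv zeta in X.
        transitivity (RInt (fun t => Re (1 * (f (p + r * cis t) * k t))%C) 0 (2 * PI)).
        { apply RInt_ext. intros t _. unfold h. f_equal. ring. }
        fold k in X. rewrite X. apply RInt_ext. intros t _. f_equal. ring.
      - assert (X := circle_contraction f p R0 r z (- Ci) Hf Hr Hz). cbv zeta in X.
        transitivity (RInt (fun t => Re (- Ci * (f (p + r * cis t) * k t))%C) 0 (2 * PI)).
        { apply RInt_ext. intros t _. unfold h. unfold Re, Im. simpl. ring. }
        fold k in X. rewrite X. apply RInt_ext. intros t _.
        unfold Re, Im. simpl. ring. }
    assert (S1 := psum_summable _ _ _ Hcv Hz).
    transitivity (/ RtoC (2 * PI) * psum (circle_coef h r) z)%C.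
    + rewrite <- E1, EQ. field. auto.
    + unfold psum. rewrite <- CSeries_scal by auto. apply CSeries_ext. intros; ring.
Qed.

(** Taylor's theorem.  The expansions obtained from the circles of radius less
    than [R0] coincide by uniqueness, so one sequence serves the whole disc. *)
Theorem hol_taylor (f : C -> C) (p : C) (R0 : R) :
  0 < R0 -> hol (fun w => Cmod (w - p)%C < R0) f ->
  exists a, cv_on a R0 /\
    forall z, Cmod (z - p)%C < R0 -> f z = psum a (z - p)%C.
Proof.
  intros HR Hf.
  destruct (cauchy_circle f p R0 (R0 / 2) Hf) as (a & Ha & Ea); [lra|].
  assert (U : forall r b, R0 / 2 <= r -> cv_on b r ->
    (forall z, Cmod z < r -> f (p + z)%C = psum b z) -> forall n, a n = b n).
  { intros r b Hr Hb Eb. apply (psum_unique a b (R0 / 2)); auto; [lra| |].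
    - apply cv_on_le with r; auto.
    - intros x Hx. rewrite <- Ea, <- Eb; auto; rewrite Cmod_R, Rabs_pos_eq; lra. }
  exists a. split.
  - intros rho Hrho.
    destruct (cauchy_circle f p R0 (Rmax (R0 / 2) ((rho + R0) / 2)) Hf)
      as (b' & Hb' & Eb').
    { split; [eapply Rlt_le_trans; [|apply Rmax_l]; lra|apply Rmax_lub_lt; lra]. }
    assert (E := U _ b' (Rmax_l _ _) Hb' Eb').
    destruct (Hb' rho) as [M HM].
    { split; [lra|]. eapply Rlt_le_trans; [|apply Rmax_r]; lra. }
    exists M. intros n. rewrite E. auto.
  - intros z Hz.
    assert (Z0 := Cmod_ge_0 (z - p)%C).
    destruct (cauchy_circle f p R0 (Rmax (R0 / 2) ((Cmod (z - p)%C + R0) / 2)) Hf)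
      as (b' & Hb' & Eb').
    { split; [eapply Rlt_le_trans; [|apply Rmax_l]; lra|apply Rmax_lub_lt; lra]. }
    assert (E := U _ b' (Rmax_l _ _) Hb' Eb').
    replace z with (p + (z - p))%C at 1 by ring. rewrite Eb'.
    + apply CSeries_ext. intros n. rewrite E. reflexivity.
    + eapply Rlt_le_trans; [|apply Rmax_r]; lra.
Qed.

(** * Germs and their continuation *)

Lemma Cmod_sub_comm (x y : C) : Cmod (x - y)%C = Cmod (y - x)%C.
Proof. replace (x - y)%C with (- (y - x))%C by ring. apply Cmod_opp. Qed.

Lemma Cmod_sub_triangle (x y z : C) :
  Cmod (x - z)%C <= Cmod (x - y)%C + Cmod (y - z)%C.
Proof.
  replace (x - z)%C with ((x - y) + (y - z))%C by ring. apply Cmod_triangle.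
Qed.

(** Taylor's theorem spares the rearrangement of a double series. *)
Lemma psum_recenter (a : cseq) (r : R) (h : C) :
  cv_on a r -> Cmod h < r ->
  exists b, cv_on b (r - Cmod h) /\
    forall w, Cmod w < r - Cmod h -> psum a (h + w)%C = psum b w.
Proof.
  intros Ha Hh.
  destruct (hol_taylor (psum a) h (r - Cmod h)) as (b & Hb & E); [lra| |].
  - apply hol_subset with (fun z => Cmod (z - 0)%C < r).
    + intros z Hz. replace (z - 0)%C with ((z - h) + h)%C by ring.
      eapply Rle_lt_trans; [apply Cmod_triangle|]. lra.
    + apply hol_ext with (fun z => psum a (z - 0)%C); [intros; f_equal; ring|].
      apply hol_psum; auto.
  - exists b. split; auto. intros w Hw. rewrite E.
    + f_equal. ring.
    + replace (h + w - h)%C with w by ring. auto.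
Qed.

Lemma psum_unique_disc (a b : cseq) (r : R) :
  0 < r -> cv_on a r -> cv_on b r ->
  (forall z, Cmod z < r -> psum a z = psum b z) -> a = b.
Proof.
  intros Hr Ha Hb H. apply functional_extensionality.
  apply (psum_unique a b r); auto. intros x Hx. apply H.
  rewrite Cmod_R, Rabs_pos_eq; lra.
Qed.

Lemma induces_radius (p : C) (a : cseq) (q : C) (b : cseq) :
  induces p a q b -> exists r, Cmod (q - p)%C < r /\ cv_on a r.
Proof. intros [H _]. apply lt_radius_cv_on; auto. apply Cmod_ge_0. Qed.

(** The definition only compares the two sums close to [q]; uniqueness of Taylor
    series extends the comparison to the largest disc around [q] inside the disc
    of convergence around [p]. *)
Lemma induces_spec (p : C) (a : cseq) (q : C) (b : cseq) (r : R) :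
  cv_on a r -> Cmod (q - p)%C < r -> induces p a q b ->
  cv_on b (r - Cmod (q - p)%C) /\
  forall z, Cmod (z - q)%C < r - Cmod (q - p)%C ->
    psum a (z - p)%C = psum b (z - q)%C.
Proof.
  intros Ha Hq [_ H].
  destruct (psum_recenter a r (q - p)%C Ha Hq) as (b' & Hb' & E).
  apply locally_disc in H. destruct H as (e & He & H).
  assert (Hbe : cv_on b (e / 2)).
  { destruct (H (q + RtoC (e / 2))%C) as (s & _ & Hs).
    - replace (q + RtoC (e / 2) - q)%C with (RtoC (e / 2)) by ring.
      rewrite Cmod_R, Rabs_pos_eq; lra.
    - replace (q + RtoC (e / 2) - q)%C with (RtoC (e / 2)) in Hs by ring.
      apply cv_on_sums_to in Hs. rewrite Cmod_R, Rabs_pos_eq in Hs by lra. auto. }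
  set (d := Rmin (e / 2) (r - Cmod (q - p)%C)).
  assert (Hd : 0 < d) by (apply Rmin_pos; lra).
  assert (Hd1 : d <= e / 2) by apply Rmin_l.
  assert (Hd2 : d <= r - Cmod (q - p)%C) by apply Rmin_r.
  assert (Eb : b = b').
  { apply (psum_unique_disc b b' d); auto.
    - apply cv_on_le with (e / 2); auto.
    - apply cv_on_le with (r - Cmod (q - p)%C); auto.
    - intros z Hz. rewrite <- E by lra.
      destruct (H (q + z)%C) as (s & Hs1 & Hs2).
      { replace (q + z - q)%C with z by ring. lra. }
      replace (q + z - p)%C with (q - p + z)%C in Hs1 by ring.
      replace (q + z - q)%C with z in Hs2 by ring.
      apply sums_to_unique in Hs1. apply sums_to_unique in Hs2. congruence. }
  subst b'. split; auto. intros z Hz. rewrite <- E; auto. f_equal. ring.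
Qed.

Lemma induces_intro (p : C) (a : cseq) (q : C) (b : cseq) (r s : R) :
  cv_on a r -> Cmod (q - p)%C < r -> cv_on b s -> 0 < s ->
  (forall z, Cmod (z - q)%C < s -> psum a (z - p)%C = psum b (z - q)%C) ->
  induces p a q b.
Proof.
  intros Ha Hq Hb Hs H. split.
  - apply Rbar_lt_le_trans with r; auto. apply cv_on_radius; auto.
  - apply locally_disc. exists (Rmin s (r - Cmod (q - p)%C)).
    split; [apply Rmin_pos; lra|]. intros z Hz.
    assert (Z1 := Rlt_le_trans _ _ _ Hz (Rmin_l _ _)).
    assert (Z2 := Rlt_le_trans _ _ _ Hz (Rmin_r _ _)).
    exists (psum a (z - p)%C). split.
    + apply sums_to_psum with r; auto.
      eapply Rle_lt_trans; [apply (Cmod_sub_triangle z q p)|]. lra.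
    + rewrite H; auto. apply sums_to_psum with s; auto.
Qed.

Lemma induces_exists (p : C) (a : cseq) (q : C) (r : R) :
  cv_on a r -> Cmod (q - p)%C < r -> exists b, induces p a q b.
Proof.
  intros Ha Hq.
  destruct (psum_recenter a r (q - p)%C Ha Hq) as (b & Hb & E).
  exists b. apply (induces_intro p a q b r (r - Cmod (q - p)%C)); auto; [lra|].
  intros z Hz. rewrite <- E; auto. f_equal. ring.
Qed.

Lemma induces_refl (p : C) (a : cseq) : convergent a -> induces p a p a.
Proof.
  intros H. apply convergent_cv_on in H. destruct H as (r & Hr & H).
  apply (induces_intro p a p a r r); auto.
  replace (p - p)%C with (RtoC 0) by ring. rewrite Cmod_0. auto.
Qed.

Lemma induces_unique (p : C) (a : cseq) (q : C) (b b' : cseq) :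
  induces p a q b -> induces p a q b' -> b = b'.
Proof.
  intros H H'. destruct (induces_radius _ _ _ _ H) as (r & Hr & Ha).
  destruct (induces_spec _ _ _ _ r Ha Hr H) as [C1 E1].
  destruct (induces_spec _ _ _ _ r Ha Hr H') as [C2 E2].
  apply (psum_unique_disc b b' (r - Cmod (q - p)%C)); auto; [lra|].
  intros z Hz. specialize (E1 (q + z)%C). specialize (E2 (q + z)%C).
  replace (q + z - q)%C with z in E1, E2 by ring.
  rewrite <- E1, <- E2; auto.
Qed.

Lemma induces_trans (p : C) (a : cseq) (q : C) (b : cseq) (s : C) (c : cseq) (r : R) :
  cv_on a r -> Cmod (q - p)%C + Cmod (s - q)%C < r ->
  induces p a q b -> induces q b s c -> induces p a s c.
Proof.
  intros Ha Hr H1 H2.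
  assert (Q0 := Cmod_ge_0 (s - q)%C). assert (Q1 := Cmod_ge_0 (q - p)%C).
  destruct (induces_spec p a q b r Ha ltac:(lra) H1) as [C1 E1].
  destruct (induces_spec q b s c _ C1 ltac:(lra) H2) as [C2 E2].
  assert (T := Cmod_sub_triangle s q p).
  apply (induces_intro p a s c r _ Ha ltac:(lra) C2); [lra|].
  intros z Hz. rewrite <- E2 by auto. apply E1.
  assert (T' := Cmod_sub_triangle z s q). lra.
Qed.

Lemma induces_sym (p : C) (a : cseq) (q : C) (b : cseq) (r : R) :
  cv_on a r -> 2 * Cmod (q - p)%C < r -> induces p a q b -> induces q b p a.
Proof.
  intros Ha Hr H. assert (Q1 := Cmod_ge_0 (q - p)%C).
  destruct (induces_spec p a q b r Ha ltac:(lra) H) as [C1 E1].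
  apply (induces_intro q b p a _ (r - 2 * Cmod (q - p)%C) C1).
  - rewrite Cmod_sub_comm. lra.
  - apply cv_on_le with r; auto. lra.
  - lra.
  - intros z Hz. symmetry. apply E1.
    assert (T := Cmod_sub_triangle z p q). rewrite (Cmod_sub_comm p q) in T. lra.
Qed.

(** Connectedness of the unit interval, in the form that suits properties of
    the germs along a path. *)
Lemma I01_locally_constant (P : R -> Prop) :
  (forall t, I01 t -> exists d, 0 < d /\
     forall s, I01 s -> Rabs (s - t) < d -> (P s <-> P t)) ->
  P 0 -> forall t, I01 t -> P t.
Proof.
  intros HL H0.
  set (E := fun t => I01 t /\ forall s, 0 <= s <= t -> P s).
  assert (E0 : E 0).
  { split; [unfold I01; lra|]. intros s Hs. replace s with 0 by lra. auto. }
  destruct (completeness E) as [m [Hub Hlub]].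
  { exists 1. intros t [Ht _]. unfold I01 in Ht. lra. }
  { exists 0. auto. }
  assert (Hm : I01 m).
  { split; [apply Hub; auto|]. apply Hlub. intros t [Ht _]. unfold I01 in Ht. lra. }
  destruct (HL m Hm) as (d & Hd & HP).
  assert (X : exists t, E t /\ m - d < t).
  { apply NNPP. intros N. assert (m <= m - d); [|lra].
    apply Hlub. intros t Ht. apply Rnot_lt_le. intros F. apply N. exists t. split; assumption. }
  destruct X as (t & [Ht HtP] & Hmt).
  assert (Htm : t <= m) by (apply Hub; split; auto).
  assert (Pm : P m).
  { apply (proj1 (HP t Ht ltac:(rewrite Rabs_left1; lra))). apply HtP.
    unfold I01 in Ht. lra. }
  assert (Eall : forall s, I01 s -> s < m + d -> P s).
  { intros s Hs Hsd. destruct (Rle_dec s t) as [L|L].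
    - apply HtP. unfold I01 in Hs; lra.
    - apply (proj2 (HP s Hs ltac:(apply Rabs_def1; lra))). exact Pm. }
  assert (M1 : m = 1).
  { destruct (Rlt_dec m 1) as [L|L]; [|unfold I01 in Hm; lra].
    assert (F : Rmin 1 (m + d / 2) <= m).
    { apply Hub. unfold I01 in Hm. split.
      - split; [apply Rmin_glb; lra|apply Rmin_l].
      - intros s Hs. apply Eall.
        + split; [lra|]. eapply Rle_trans; [apply Hs|apply Rmin_l].
        + assert (Rmin 1 (m + d / 2) <= m + d / 2) by apply Rmin_r. lra. }
    assert (m < Rmin 1 (m + d / 2)) by (apply Rmin_glb_lt; lra). lra. }
  intros s Hs. apply Eall; auto. unfold I01 in Hs. lra.
Qed.

Lemma continuous_on_I01_eps (g : R -> C) (t eps : R) :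
  is_path g -> I01 t -> 0 < eps ->
  exists d, 0 < d /\ forall s, I01 s -> Rabs (s - t) < d -> Cmod (g s - g t)%C < eps.
Proof.
  intros H Ht He.
  assert (L : locally (g t) (fun z => Cmod (z - g t)%C < eps)).
  { apply locally_disc. exists eps. auto. }
  destruct (H t Ht _ L) as [d Hd]. exists d. split; [apply cond_pos|].
  intros s Hs Hst. apply (Hd s); auto.
Qed.

Lemma continuation_eps (f : cseq) (g : R -> C) (A : R -> cseq) (t : R) :
  continuation f g A -> I01 t ->
  exists d, 0 < d /\ forall s, I01 s -> Rabs (s - t) < d ->
    induces (g t) (A t) (g s) (A s).
Proof.
  intros [_ H] Ht. destruct (H t Ht) as [_ [d Hd]].
  exists d. split; [apply cond_pos|]. intros s Hs Hst. apply (Hd s); auto.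
Qed.

(** The germs depend on the parameter in such a way that a lower bound for the
    radius at one parameter holds, up to a factor, at all nearby ones. *)
Lemma continuation_radius (f : cseq) (g : R -> C) (A : R -> cseq) :
  is_path g -> continuation f g A ->
  exists d, 0 < d /\ forall t, I01 t -> cv_on (A t) d.
Proof.
  intros Hg HA.
  set (P := fun t => exists d, 0 < d /\ forall s, I01 s -> s <= t -> cv_on (A s) d).
  assert (Hcv : forall t, I01 t -> exists r, 0 < r /\ cv_on (A t) r).
  { intros t Ht. apply convergent_cv_on. apply (proj2 HA t Ht). }
  destruct (I01_locally_constant P) with (t := 1) as (d & Hd & H).
  - intros t Ht. destruct (Hcv t Ht) as (r & Hr & Hc).
    destruct (continuous_on_I01_eps g t (r / 2) Hg Ht) as (d1 & Hd1 & W1); [lra|].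
    destruct (continuation_eps f g A t HA Ht) as (d2 & Hd2 & W2).
    assert (B : forall s, I01 s -> Rabs (s - t) < Rmin d1 d2 -> cv_on (A s) (r / 2)).
    { intros s Hs Hst.
      assert (S1 := W1 s Hs (Rlt_le_trans _ _ _ Hst (Rmin_l _ _))).
      assert (S2 := W2 s Hs (Rlt_le_trans _ _ _ Hst (Rmin_r _ _))).
      destruct (induces_spec (g t) (A t) (g s) (A s) r Hc ltac:(lra) S2) as [C1 _].
      apply cv_on_le with (2 := C1). lra. }
    assert (G : forall s s', I01 s -> I01 s' -> Rabs (s - t) < Rmin d1 d2 ->
      Rabs (s' - t) < Rmin d1 d2 -> P s -> P s').
    { intros s s' Hs Hs' Hst Hst' (d & Hd & H).
      exists (Rmin d (r / 2)). split; [apply Rmin_pos; lra|].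
      intros v Hv Hvs. destruct (Rle_dec v s) as [L|L].
      - apply cv_on_le with d; [apply Rmin_l|]. auto.
      - apply cv_on_le with (r / 2); [apply Rmin_r|]. apply B; auto.
        apply Rabs_def2 in Hst. apply Rabs_def2 in Hst'. apply Rabs_def1; lra. }
    exists (Rmin d1 d2). assert (0 < Rmin d1 d2) by (apply Rmin_pos; auto).
    split; auto. intros s Hs Hst.
    assert (Rabs (t - t) < Rmin d1 d2) by (rewrite Rminus_diag, Rabs_R0; auto).
    split; apply G; auto.
  - assert (I0 : I01 0) by (unfold I01; lra).
    destruct (Hcv 0 I0) as (r & Hr & Hc). exists r. split; auto.
    intros s Hs Hs0. replace s with 0; auto. unfold I01 in Hs. lra.
  - unfold I01; lra.
  - exists d. split; auto. intros t Ht. apply H; auto. apply Ht.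
Qed.

(** Continuations along uniformly close paths agree: each germ on the
    perturbed path is the expansion of the corresponding germ on the original
    one.  The agreement is an open and closed condition on the parameter. *)
Lemma continuation_stable (f : cseq) (g g' : R -> C) (A A' : R -> cseq) (d : R) :
  is_path g -> is_path g' -> continuation f g A -> continuation f g' A' ->
  g 0 = g' 0 ->
  (forall t, I01 t -> cv_on (A t) d /\ Cmod (g' t - g t)%C < d) ->
  forall t, I01 t -> induces (g t) (A t) (g' t) (A' t).
Proof.
  intros Hg Hg' HA HA' E0 Hd.
  apply I01_locally_constant.
  - intros t Ht. destruct (Hd t Ht) as [Hc Hgt].
    destruct (proj1 (convergent_cv_on (A' t))) as (r' & Hr' & Hc').
    { apply (proj2 HA' t Ht). }
    set (D := Cmod (g' t - g t)%C) in *.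
    assert (D0 : 0 <= D) by apply Cmod_ge_0.
    set (eta := Rmin (d - D) r' / 8).
    assert (He : 0 < eta) by (apply Rdiv_lt_0_compat; [apply Rmin_pos; lra|lra]).
    assert (He1 : 8 * eta <= d - D).
    { replace (8 * eta) with (Rmin (d - D) r') by (unfold eta; lra). apply Rmin_l. }
    assert (He2 : 8 * eta <= r').
    { replace (8 * eta) with (Rmin (d - D) r') by (unfold eta; lra). apply Rmin_r. }
    destruct (continuous_on_I01_eps g t eta Hg Ht He) as (d1 & Hd1 & W1).
    destruct (continuous_on_I01_eps g' t eta Hg' Ht He) as (d2 & Hd2 & W2).
    destruct (continuation_eps f g A t HA Ht) as (d3 & Hd3 & W3).
    destruct (continuation_eps f g' A' t HA' Ht) as (d4 & Hd4 & W4).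
    exists (Rmin (Rmin d1 d2) (Rmin d3 d4)). split; [repeat apply Rmin_pos; auto|].
    intros s Hs Hst.
    assert (M1 := Rmin_l (Rmin d1 d2) (Rmin d3 d4)).
    assert (M2 := Rmin_r (Rmin d1 d2) (Rmin d3 d4)).
    assert (M3 := Rmin_l d1 d2). assert (M4 := Rmin_r d1 d2).
    assert (M5 := Rmin_l d3 d4). assert (M6 := Rmin_r d3 d4).
    specialize (W1 s Hs ltac:(lra)). specialize (W2 s Hs ltac:(lra)).
    specialize (W3 s Hs ltac:(lra)). specialize (W4 s Hs ltac:(lra)).
    destruct (Hd s Hs) as [Hcs Hgs].
    assert (T1 := Cmod_sub_triangle (g' s) (g' t) (g t)). fold D in T1.
    assert (W1' := W1). rewrite Cmod_sub_comm in W1'.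
    assert (W2' := W2). rewrite Cmod_sub_comm in W2'.
    assert (T2 := Cmod_sub_triangle (g' s) (g t) (g s)).
    split; intros HP.
    + assert (X1 : induces (g t) (A t) (g' s) (A' s)).
      { apply (induces_trans (g t) (A t) (g s) (A s) (g' s) (A' s) d); auto. lra. }
      apply (induces_trans (g t) (A t) (g' s) (A' s) (g' t) (A' t) d); auto; [lra|].
      apply induces_sym with r'; auto. lra.
    + assert (X1 : induces (g t) (A t) (g' s) (A' s)).
      { apply (induces_trans (g t) (A t) (g' t) (A' t) (g' s) (A' s) d); auto.
        fold D. lra. }
      apply (induces_trans (g s) (A s) (g t) (A t) (g' s) (A' s) d); auto; [lra|].
      apply induces_sym with d; auto. lra.
  - destruct HA as [S1 H1]. destruct HA' as [S2 H2].
    rewrite <- E0 in S2 |- *. rewrite (induces_unique _ _ _ _ _ S2 S1).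
    apply induces_refl. apply H1. unfold I01; lra.
Qed.

(** * The exponential and the logarithm *)

Lemma Cexp_cis (z : C) : Cexp z = (exp (Re z) * cis (Im z))%C.
Proof. apply injective_projections; simpl; ring. Qed.

Lemma Cexp_plus (a b : C) : Cexp (a + b)%C = (Cexp a * Cexp b)%C.
Proof.
  unfold Cexp. rewrite re_plus, im_plus, exp_plus, cos_plus, sin_plus.
  apply injective_projections; simpl; ring.
Qed.

Lemma Cexp_0 : Cexp 0 = 1.
Proof.
  unfold Cexp. simpl. rewrite exp_0, cos_0, sin_0.
  apply injective_projections; simpl; ring.
Qed.

Lemma Cexp_opp_mult (z : C) : (Cexp z * Cexp (- z))%C = 1.
Proof. rewrite <- Cexp_plus, <- Cexp_0. f_equal. ring. Qed.

Lemma Cexp_nz (z : C) : Cexp z <> 0.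
Proof.
  intros E. apply C1_nz. rewrite <- (Cexp_opp_mult z), E. ring.
Qed.

Lemma Cmod_Cexp (z : C) : Cmod (Cexp z) = exp (Re z).
Proof.
  rewrite Cexp_cis, Cmod_mult, Cmod_cis, Cmod_R, Rabs_pos_eq; [ring|].
  left; apply exp_pos.
Qed.

Lemma Cexp_RtoC (x : R) : Cexp x = exp x.
Proof.
  unfold Cexp. simpl. rewrite cos_0, sin_0.
  apply injective_projections; simpl; ring.
Qed.

Lemma is_derive_Cexp_0 : is_derive Cexp (RtoC 0) (RtoC 1).
Proof.
  apply is_derive_C_iff. intros eps He.
  destruct (proj1 (is_derive_R_iff exp 0 1)) with (eps := eps / 3) as (d1 & Hd1 & W1);
    [rewrite <- exp_0; apply is_derive_exp|lra|].
  destruct (proj1 (rpath_derive_iff _ _ _) (rpath_derive_cis 0) (eps / 3))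
    as (d2 & Hd2 & W2); [lra|].
  destruct (proj1 (rpath_derive_iff _ _ _) (rpath_derive_cis 0) 1)
    as (d3 & Hd3 & W3); [lra|].
  assert (C0 : cis 0 = 1) by (unfold cis; rewrite cos_0, sin_0; reflexivity).
  rewrite C0 in W2, W3.
  set (d := Rmin (Rmin d1 d2) (Rmin d3 (eps / 6))).
  assert (M1 := Rmin_l (Rmin d1 d2) (Rmin d3 (eps / 6))).
  assert (M2 := Rmin_r (Rmin d1 d2) (Rmin d3 (eps / 6))).
  assert (M3 := Rmin_l d1 d2). assert (M4 := Rmin_r d1 d2).
  assert (M5 := Rmin_l d3 (eps / 6)). assert (M6 := Rmin_r d3 (eps / 6)).
  fold d in M1, M2.
  exists d. split; [unfold d; repeat apply Rmin_pos; lra|].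
  intros h Hh. replace (h - 0)%C with h in * by ring.
  set (a := Re h). set (b := Im h).
  assert (Ha : Rabs a <= Cmod h) by apply re_le_Cmod.
  assert (Hb : Rabs b <= Cmod h) by apply im_le_Cmod.
  specialize (W1 a). specialize (W2 b). specialize (W3 b).
  rewrite Rminus_0_r in W1, W2, W3. rewrite exp_0 in W1.
  specialize (W1 ltac:(lra)). specialize (W2 ltac:(lra)). specialize (W3 ltac:(lra)).
  rewrite Cexp_0, Cexp_cis. fold a b.
  replace (exp a * cis b - 1 - h * 1)%C with
    (RtoC (exp a - 1 - a * 1) * cis b + RtoC a * (cis b - 1) + (cis b - 1 - b * (Ci * 1)))%C.
  2:{ assert (Eh : h = (RtoC a + RtoC b * Ci)%C).
      { unfold a, b, Re, Im. destruct h. apply injective_projections; simpl; ring. }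
      transitivity (exp a * cis b - 1 - (RtoC a + RtoC b * Ci) * 1)%C.
      - rewrite !RtoC_minus, RtoC_mult. ring.
      - rewrite <- Eh. reflexivity. }
  assert (B3 : Cmod (cis b - 1)%C <= 2 * Cmod h).
  { replace (cis b - 1)%C with ((cis b - 1 - b * (Ci * 1)) + b * (Ci * 1))%C by ring.
    eapply Rle_trans; [apply Cmod_triangle|].
    rewrite (Cmod_mult b), Cmod_mult, Cmod_Ci, Cmod_1, Cmod_R. lra. }
  eapply Rle_trans; [apply Cmod_triangle|].
  eapply Rle_trans; [apply Rplus_le_compat_r, Cmod_triangle|].
  rewrite !Cmod_mult, !Cmod_R, Cmod_cis.
  assert (H0 : 0 <= Cmod h) by apply Cmod_ge_0.
  assert (B2 : Rabs a * Cmod (cis b - 1)%C <= eps / 3 * Cmod h).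
  { apply Rle_trans with (Cmod h * (2 * Cmod h)).
    - apply Rmult_le_compat; auto using Rabs_pos, Cmod_ge_0.
    - rewrite <- Rmult_assoc, (Rmult_comm (Cmod h)). apply Rmult_le_compat_r; lra. }
  assert (B1 : eps / 3 * Rabs a <= eps / 3 * Cmod h) by (apply Rmult_le_compat_l; lra).
  assert (B4 : eps / 3 * Rabs b <= eps / 3 * Cmod h) by (apply Rmult_le_compat_l; lra).
  lra.
Qed.

Lemma is_derive_Cexp (z : C) : is_derive Cexp z (Cexp z).
Proof.
  apply is_derive_C_iff. intros eps He.
  assert (Z0 : 0 < Cmod (Cexp z)) by (apply Cmod_gt_0, Cexp_nz).
  destruct (proj1 (is_derive_C_iff _ _ _) is_derive_Cexp_0 (eps / Cmod (Cexp z)))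
    as (d & Hd & W); [apply Rdiv_lt_0_compat; auto|].
  exists d. split; auto. intros w Hw.
  specialize (W (w - z)%C). replace (w - z - 0)%C with (w - z)%C in W by ring.
  specialize (W Hw). rewrite Cexp_0 in W.
  replace (Cexp w - Cexp z - (w - z) * Cexp z)%C
    with (Cexp z * (Cexp (w - z) - 1 - (w - z) * 1))%C.
  - rewrite Cmod_mult.
    replace (eps * Cmod (w - z)%C)
      with (Cmod (Cexp z) * (eps / Cmod (Cexp z) * Cmod (w - z)%C)) by (field; lra).
    apply Rmult_le_compat_l; lra.
  - replace (Cexp w) with (Cexp z * Cexp (w - z))%C; [ring|].
    rewrite <- Cexp_plus. f_equal. ring.
Qed.

Lemma hol_Cexp (U : C -> Prop) (f : C -> C) :
  hol U f -> hol U (fun z => Cexp (f z)).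
Proof.
  intros H. apply (hol_comp U (fun _ => True) Cexp f); auto.
  exists Cexp. intros z _. split; [apply is_derive_Cexp|].
  eapply is_derive_continuous. apply is_derive_Cexp.
Qed.

(** Both properties come from the derivative of [exp] at the origin being [1]. *)
Lemma Cexp_near_0 :
  exists d, 0 < d <= 1 /\
    (forall h, Cmod h < d -> Cexp h = 1 -> h = 0) /\
    (forall h, Cmod h < d -> Cmod (Cexp h - 1)%C <= 2 * Cmod h).
Proof.
  destruct (proj1 (is_derive_C_iff _ _ _) is_derive_Cexp_0 (1 / 2)) as (d & Hd & W); [lra|].
  exists (Rmin d 1). split; [split; [apply Rmin_pos; lra|apply Rmin_r]|].
  assert (W' : forall h, Cmod h < Rmin d 1 ->
    Cmod (Cexp h - 1 - h)%C <= 1 / 2 * Cmod h).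
  { intros h Hh. specialize (W h). replace (h - 0)%C with h in W by ring.
    rewrite Cexp_0 in W. replace (h * 1)%C with h in W by ring. apply W.
    eapply Rlt_le_trans; [apply Hh|apply Rmin_l]. }
  split; intros h Hh; specialize (W' h Hh); assert (H0 := Cmod_ge_0 h).
  - intros E. rewrite E in W'. replace (1 - 1 - h)%C with (- h)%C in W' by ring.
    rewrite Cmod_opp in W'. apply Cmod_eq_0. lra.
  - replace (Cexp h - 1)%C with ((Cexp h - 1 - h) + h)%C by ring.
    eapply Rle_trans; [apply Cmod_triangle|]. lra.
Qed.

Lemma Cexp_eq_1 (h : C) : Cexp h = 1 -> exists k : Z, h = (IZR k * (2 * PI) * Ci)%C.
Proof.
  intros E.
  assert (E1 := f_equal Cmod E). rewrite Cmod_Cexp, Cmod_1, <- exp_0 in E1.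
  apply exp_inv in E1.
  unfold Cexp in E. rewrite E1, exp_0 in E.
  assert (Ec := f_equal fst E). assert (Es := f_equal snd E). simpl in Ec, Es.
  rewrite Rmult_1_l in Ec, Es.
  destruct (sin_eq_0_0 _ Es) as [k Hk].
  assert (Hp : Z.Even k).
  { destruct (Z.Even_or_Odd k) as [|[m Hm]]; auto. exfalso.
    rewrite Hk, Hm, plus_IZR, mult_IZR in Ec.
    replace ((2 * IZR m + 1) * PI) with (IZR m * (2 * PI) + PI) in Ec by ring.
    rewrite neg_cos in Ec.
    assert (P : cos (IZR m * (2 * PI)) = 1).
    { destruct (Z.le_gt_cases 0 m) as [L|L].
      - rewrite <- (Z2Nat.id m L), <- INR_IZR_INZ.
        replace (INR (Z.to_nat m) * (2 * PI)) with (0 + 2 * INR (Z.to_nat m) * PI) by ring.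
        rewrite cos_period. apply cos_0.
      - rewrite <- cos_neg. replace (- (IZR m * (2 * PI))) with (IZR (- m) * (2 * PI))
          by (rewrite opp_IZR; ring).
        rewrite <- (Z2Nat.id (- m)) by lia. rewrite <- INR_IZR_INZ.
        replace (INR (Z.to_nat (- m)) * (2 * PI))
          with (0 + 2 * INR (Z.to_nat (- m)) * PI) by ring.
        rewrite cos_period. apply cos_0. }
    lra. }
  destruct Hp as [m Hm]. exists m.
  rewrite Hm, mult_IZR in Hk.
  apply injective_projections.
  - change (fst h) with (Re h). rewrite E1. simpl. ring.
  - change (snd h) with (Im h). rewrite Hk. simpl. ring.
Qed.

(** The argument comes from [acos], with the sign of the imaginary part. *)
Lemma Cexp_surj (p : C) : p <> 0 -> exists x, Cexp x = p.
Proof.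
  intros Hp. assert (P : 0 < Cmod p) by (apply Cmod_gt_0; auto).
  set (m := Cmod p) in *. set (a := Re p / m). set (b := Im p / m).
  assert (Eab : a ^ 2 + b ^ 2 = 1).
  { unfold a, b. replace ((Re p / m) ^ 2 + (Im p / m) ^ 2)
      with ((Re p ^ 2 + Im p ^ 2) / m ^ 2) by (field; lra).
    rewrite <- Cmod2_alt. fold m. field. lra. }
  assert (Ha : -1 <= a <= 1) by (split; nra).
  assert (Hs : sin (acos a) = Rabs b).
  { rewrite sin_acos by auto. rewrite <- sqrt_Rsqr_abs. f_equal. unfold Rsqr. nra. }
  assert (Hc : cos (acos a) = a) by (apply cos_acos; auto).
  assert (X : exists t, cos t = a /\ sin t = b).
  { destruct (Rle_dec 0 b) as [L|L].
    - exists (acos a). rewrite Rabs_pos_eq in Hs by auto. auto.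
    - exists (- acos a). rewrite cos_neg, sin_neg, Hs. split; auto.
      rewrite Rabs_left; lra. }
  destruct X as (t & Ht1 & Ht2).
  exists (ln m, t). unfold Cexp. simpl. rewrite exp_ln by auto. rewrite Ht1, Ht2.
  apply injective_projections; simpl; unfold a, b; unfold Re, Im; field; lra.
Qed.

Lemma derive_zero_const (f : C -> C) (p : C) (r : R) :
  (forall w, Cmod (w - p)%C < r -> is_derive f w (RtoC 0)) ->
  forall z, Cmod (z - p)%C < r -> f z = f p.
Proof.
  intros H z Hz.
  assert (G : forall t, 0 <= t <= 1 -> rpath_derive (fun t => f (p + RtoC t * (z - p))%C) t 0).
  { intros t Ht. replace (RtoC 0) with ((z - p) * 0)%C by ring.
    apply (rpath_derive_comp f (fun t => p + t * (z - p))%C).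
    - apply H. replace (p + t * (z - p) - p)%C with (t * (z - p))%C by ring.
      rewrite Cmod_mult, Cmod_R, Rabs_pos_eq by lra.
      assert (0 <= Cmod (z - p)%C) by apply Cmod_ge_0. nra.
    - apply rpath_derive_affine. }
  replace (f z) with (f (p + RtoC 1 * (z - p))%C) by (f_equal; ring).
  replace (f p) with (f (p + RtoC 0 * (z - p))%C) by (f_equal; ring).
  apply injective_projections; symmetry.
  - apply (eq_is_derive (fun t => Re (f (p + RtoC t * (z - p))%C)) 0 1); [|lra].
    intros t Ht. apply (proj1 (G t Ht)).
  - apply (eq_is_derive (fun t => Im (f (p + RtoC t * (z - p))%C)) 0 1); [|lra].
    intros t Ht. apply (proj2 (G t Ht)).
Qed.

Lemma INR_S_nz (n : nat) : RtoC (INR (S n)) <> 0.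
Proof. intros E. apply RtoC_inj in E. revert E. apply not_0_INR. lia. Qed.

(** Taylor coefficients at the origin of [log (1 - s)]. *)
Definition log1m : cseq := fun n => match n with O => RtoC 0 | S _ => (- / INR n)%C end.

Lemma cv_on_log1m : cv_on log1m 1.
Proof.
  intros rho Hr. exists 1. intros n.
  assert (P : rho ^ n <= 1) by (rewrite <- (pow1 n); apply pow_incr; lra).
  assert (P0 : 0 <= rho ^ n) by (apply pow_le; lra).
  destruct n as [|n]; unfold log1m.
  - rewrite Cmod_0. lra.
  - assert (N1 : 1 <= INR (S n)) by (rewrite S_INR; generalize (pos_INR n); lra).
    rewrite Cmod_opp, <- RtoC_inv, Cmod_R by lra.
    assert (I0 : 0 < / INR (S n)) by (apply Rinv_0_lt_compat; lra).
    assert (I1 : / INR (S n) <= 1).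
    { rewrite <- Rinv_1. apply Rinv_le_contravar; lra. }
    rewrite Rabs_pos_eq by lra. nra.
Qed.

Definition Clog1m (s : C) : C := psum log1m s.

Lemma one_minus_nz (s : C) : Cmod s < 1 -> (1 - s)%C <> 0.
Proof.
  intros Hs E. replace s with (1 - (1 - s))%C in Hs by ring.
  rewrite E in Hs. replace (1 - 0)%C with (RtoC 1) in Hs by ring.
  rewrite Cmod_1 in Hs. lra.
Qed.

Lemma is_derive_Clog1m (s : C) :
  Cmod s < 1 -> is_derive Clog1m s (- / (1 - s))%C.
Proof.
  intros Hs.
  assert (N := one_minus_nz s Hs).
  replace (- / (1 - s))%C with (psum (pder log1m) s).
  - apply is_derive_psum with 1; auto. apply cv_on_log1m.
  - assert (Hc := cv_on_pder _ _ cv_on_log1m).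
    assert (E1 : forall n, pder log1m n = (- (1))%C).
    { intros n. unfold pder, log1m. field. apply INR_S_nz. }
    assert (E := psum_shift _ 1 s Hc Hs).
    assert (E2 : psum (fun n => pder log1m (S n)) s = psum (pder log1m) s).
    { apply CSeries_ext. intros n. rewrite !E1. reflexivity. }
    rewrite E2, E1 in E.
    replace (psum (pder log1m) s) with ((psum (pder log1m) s - s * psum (pder log1m) s) / (1 - s))%C
      by (field; auto).
    rewrite E at 1. field. auto.
Qed.

(** The function [exp (- log (1 - s)) * (1 - s)] has derivative zero. *)
Lemma Cexp_Clog1m (s : C) : Cmod s < 1 -> Cexp (Clog1m s) = (1 - s)%C.
Proof.
  intros Hs.
  assert (L0 : Clog1m 0 = 0) by (apply (psum_0 log1m 1); [lra|apply cv_on_log1m]).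
  set (u := fun s => (Cexp (- Clog1m s) * (1 - s))%C).
  assert (E : u s = u 0).
  { apply (derive_zero_const u 0 1).
    2:{ replace (s - 0)%C with s by ring. auto. }
    intros w Hw. replace (w - 0)%C with w in Hw by ring.
    assert (N := one_minus_nz w Hw).
    assert (D1 : is_derive (fun s => Cexp (- Clog1m s)%C) w
       ((- (1)) * - / (1 - w) * Cexp (- Clog1m w))%C).
    { apply (is_derive_comp (K := C_AbsRing) (V := C_NormedModule) Cexp (fun s => - Clog1m s)%C).
      - apply is_derive_Cexp.
      - apply is_derive_C_AbsRing.
        assert (X := is_derive_Cscal (- (1)) Clog1m w _ (is_derive_Clog1m w Hw)).
        apply (is_derive_ext (K := C_AbsRing) (V := C_NormedModule)) with (2 := X).
        intros t. change (- (1) * Clog1m t = - Clog1m t)%C. ring. }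
    assert (D2 := is_derive_affine 1 (- (1)) w).
    assert (D3 := is_derive_Cmult _ _ _ _ _ D1 D2).
    replace (RtoC 0) with (- (1) * - / (1 - w) * Cexp (- Clog1m w) * (1 + - (1) * w) +
          Cexp (- Clog1m w) * - (1))%C by (field; auto).
    apply (is_derive_ext (K := C_AbsRing) (V := C_NormedModule)) with (2 := D3).
    intros t. unfold u. change (Cexp (- Clog1m t) * (1 + - (1) * t) =
      Cexp (- Clog1m t) * (1 - t))%C. ring. }
  unfold u in E. rewrite L0 in E.
  replace (- 0)%C with (RtoC 0) in E by ring. rewrite Cexp_0 in E.
  replace (1 * (1 - 0))%C with (RtoC 1) in E by ring.
  replace (1 - s)%C with ((Cexp (Clog1m s) * Cexp (- Clog1m s)) * (1 - s))%C
    by (rewrite Cexp_opp_mult; ring).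
  rewrite <- Cmult_assoc, E. ring.
Qed.

Lemma hol_Clog1m (U : C -> Prop) (f : C -> C) :
  hol U f -> (forall z, U z -> Cmod (f z) < 1) -> hol U (fun z => Clog1m (f z)).
Proof.
  intros H HU. apply (hol_comp U (fun w => Cmod (w - 0)%C < 1) Clog1m f); auto.
  - apply hol_ext with (fun z => psum log1m (z - 0)%C).
    + intros z. unfold Clog1m. f_equal. ring.
    + apply hol_psum, cv_on_log1m.
  - intros z Hz. replace (f z - 0)%C with (f z) by ring. auto.
Qed.

Lemma Clog1m_0 : Clog1m 0 = 0.
Proof. apply (psum_0 log1m 1); [lra|apply cv_on_log1m]. Qed.

Lemma Clog1m_small (eps : R) :
  0 < eps -> exists d, 0 < d <= 1 /\ forall s, Cmod s < d -> Cmod (Clog1m s) < eps.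
Proof.
  intros He.
  assert (Hc : continuous Clog1m (RtoC 0)).
  { eapply is_derive_continuous. apply is_derive_Clog1m. rewrite Cmod_0; lra. }
  destruct (proj1 (continuous_C_iff _ _) Hc eps He) as (d & Hd & W).
  exists (Rmin d 1). split; [split; [apply Rmin_pos; lra|apply Rmin_r]|].
  intros s Hs. specialize (W s). rewrite Clog1m_0 in W.
  replace (s - 0)%C with s in W by ring.
  replace (Clog1m s - 0)%C with (Clog1m s) in W by ring.
  apply W. eapply Rlt_le_trans; [apply Hs|apply Rmin_l].
Qed.

(** * The lift of [F] to the universal covering *)

Lemma continuous_is_path (g : R -> C) : (forall t, continuous g t) -> is_path g.
Proof.
  intros H t _ P HP. destruct (H t P HP) as [d Hd]. exists d.
  intros s Hs _. apply Hd. exact Hs.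
Qed.

Lemma continuation_const (f : cseq) : convergent f ->
  continuation f (fun _ => RtoC 0) (fun _ => f).
Proof.
  intros H. split; [apply induces_refl; auto|].
  intros t _. split; auto. exists (mkposreal 1 Rlt_0_1). intros s _ _.
  apply induces_refl; auto.
Qed.

Lemma Rmult_lt_1_of_lt_Rdiv (x a b : R) : 0 < b -> x < a / b -> b * x < a.
Proof.
  intros Hb H. apply (Rmult_lt_compat_l b) in H; auto.
  replace (b * (a / b)) with a in H by (field; lra). exact H.
Qed.

(** [x |-> omega (1 - exp x)] is the universal covering of the plane without
    [omega], normalised at [0]; a germ with no other singularity becomes an
    entire function of [x].  The value at [x] is read off the continuation along
    the image of the segment from [0] to [x], and [continuation_stable] shows
    that nearby segments give the same function. *)
Lemma lift_entire (F : cseq) (omega : C) :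
  convergent F -> omega <> 0 ->
  (forall gamma, is_path gamma -> gamma 0 = 0 ->
     (forall t, I01 t -> gamma t <> omega) -> continuable_along F gamma) ->
  exists Phi, hol (fun _ => True) Phi /\
    exists d, 0 < d /\ forall x, Cmod x < d -> Phi x = psum F (omega * (1 - Cexp x))%C.
Proof.
  intros hF Ho Hs.
  set (g := fun (x : C) (t : R) => (omega * (1 - Cexp (t * x)))%C).
  assert (Hg : forall x t, continuous (g x) t).
  { intros x t. unfold g. apply continuous_Cmult; [apply continuous_const|].
    apply continuous_Cminus; [apply continuous_const|].
    apply (continuous_comp (fun t => RtoC t * x)%C Cexp).
    - apply continuous_Cmult; [apply continuous_RtoC, continuous_id|apply continuous_const].
    - eapply is_derive_continuous, is_derive_Cexp. }
  assert (Hex : forall x, exists A, continuation F (g x) A).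
  { intros x. apply Hs.
    - apply continuous_is_path; auto.
    - unfold g. rewrite Cmult_0_l, Cexp_0. ring.
    - intros t _ E. apply (Cexp_nz (t * x)). unfold g in E.
      replace (Cexp (t * x)) with (1 - (omega * (1 - Cexp (t * x))) / omega)%C
        by (field; auto).
      rewrite E. field; auto. }
  set (A := fun x => proj1_sig (constructive_indefinite_description _ (Hex x))).
  assert (HA : forall x, continuation F (g x) (A x)).
  { intros x. exact (proj2_sig (constructive_indefinite_description _ (Hex x))). }
  destruct Cexp_near_0 as (d0 & Hd0 & _ & Lip).
  assert (O0 : 0 < Cmod omega) by (apply Cmod_gt_0; auto).
  assert (Close : forall x x' t, I01 t -> Cmod (x' - x)%C < d0 ->
    Cmod (g x' t - g x t)%C <= Cmod omega * exp (Cmod x) * 2 * Cmod (x' - x)%C).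
  { intros x x' t Ht Hx. unfold g.
    replace (omega * (1 - Cexp (t * x')) - omega * (1 - Cexp (t * x)))%C
      with (- (omega * Cexp (t * x) * (Cexp (t * (x' - x)) - 1)))%C.
    2:{ replace (Cexp (t * x')) with (Cexp (t * x) * Cexp (t * (x' - x)))%C; [ring|].
        rewrite <- Cexp_plus. f_equal. ring. }
    rewrite Cmod_opp, !Cmod_mult, Cmod_Cexp.
    assert (Ht' : Cmod (t * (x' - x))%C <= Cmod (x' - x)%C).
    { rewrite Cmod_mult, Cmod_R, Rabs_pos_eq by (apply Ht).
      assert (0 <= Cmod (x' - x)%C) by apply Cmod_ge_0. destruct Ht. nra. }
    assert (L := Lip (t * (x' - x))%C ltac:(lra)).
    assert (E1 : exp (Re (t * x)) <= exp (Cmod x)).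
    { destruct (Rle_lt_or_eq (Re (t * x)%C) (Cmod x)) as [K|K].
      - eapply Rle_trans; [apply Rle_abs|]. eapply Rle_trans; [apply re_le_Cmod|].
        rewrite Cmod_mult, Cmod_R, Rabs_pos_eq by (apply Ht).
        assert (0 <= Cmod x) by apply Cmod_ge_0. destruct Ht. nra.
      - left. apply exp_increasing; auto.
      - rewrite K. lra. }
    rewrite !Rmult_assoc. apply Rmult_le_compat_l; [lra|].
    apply Rmult_le_compat; [left; apply exp_pos|apply Cmod_ge_0|auto|lra]. }
  assert (Agree : forall x d, 0 < d -> exists r, 0 < r /\
    forall x', Cmod (x' - x)%C < r -> forall t, I01 t -> Cmod (g x' t - g x t)%C < d).
  { intros x d Hd.
    set (K := Cmod omega * exp (Cmod x) * 2).
    assert (K0 : 0 < K).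
    { apply Rmult_lt_0_compat; [apply Rmult_lt_0_compat; auto; apply exp_pos|lra]. }
    exists (Rmin d0 (d / K)). split.
    { apply Rmin_pos; [lra|]. apply Rdiv_lt_0_compat; auto. }
    intros x' Hx t Ht.
    eapply Rle_lt_trans; [apply Close; auto|].
    - eapply Rlt_le_trans; [apply Hx|apply Rmin_l].
    - fold K. apply Rmult_lt_1_of_lt_Rdiv; auto.
      eapply Rlt_le_trans; [apply Hx|apply Rmin_r]. }
  assert (I1 : I01 1) by (unfold I01; lra).
  assert (Start : forall x, g x 0 = 0).
  { intros x. unfold g. rewrite Cmult_0_l, Cexp_0. ring. }
  assert (Val : forall p a q b d, cv_on a d -> Cmod (q - p)%C < d -> induces p a q b ->
    b O = psum a (q - p)%C).
  { intros p a q b d Ha Hq H.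
    destruct (induces_spec p a q b d Ha Hq H) as [Hb E].
    specialize (E q). replace (q - q)%C with (RtoC 0) in E by ring.
    rewrite E by (rewrite Cmod_0; lra).
    symmetry. apply (psum_0 b (d - Cmod (q - p)%C)); auto. lra. }
  exists (fun x => A x 1 O). split.
  - apply hol_local. intros x _.
    destruct (continuation_radius F (g x) (A x)) as (d & Hd & Hcv); auto.
    { apply continuous_is_path; auto. }
    destruct (Agree x d Hd) as (r & Hr & Hag).
    exists r, (fun w => psum (A x 1) (g w 1 - g x 1)%C). split; [auto|split].
    + apply (hol_comp _ (fun z => Cmod (z - g x 1)%C < d)
        (fun z => psum (A x 1) (z - g x 1)%C) (fun w => g w 1)).
      * apply hol_psum. auto.
      * unfold g. apply hol_mult; [apply hol_const|].
        apply hol_minus; [apply hol_const|].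
        apply hol_Cexp. apply hol_mult; [apply hol_const|apply hol_id].
      * intros w Hw. auto.
    + intros w Hw. apply (Val _ _ _ _ d); auto.
      apply (continuation_stable F (g x) (g w) (A x) (A w) d); auto using continuous_is_path.
      rewrite !Start. reflexivity.
  - destruct (proj1 (convergent_cv_on F) hF) as (d & Hd & Hcv).
    destruct (Agree 0 d Hd) as (r & Hr & Hag).
    assert (G0 : forall t, g 0 t = 0).
    { intros t. unfold g. replace (t * 0)%C with (RtoC 0) by ring. rewrite Cexp_0. ring. }
    exists r. split; auto. intros x Hx.
    assert (Hx' : forall t, I01 t -> Cmod (g x t - 0)%C < d).
    { intros t Ht. rewrite <- (G0 t). apply Hag; auto.
      replace (x - 0)%C with x by ring. auto. }
    replace (omega * (1 - Cexp x))%C with (g x 1 - 0)%C.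
    + apply (Val _ _ _ _ d); auto.
      apply (continuation_stable F (fun _ => RtoC 0) (g x) (fun _ => F) (A x) d);
        auto using continuous_is_path.
      * apply continuous_is_path. intros; apply continuous_const.
      * apply continuation_const; auto.
    + unfold g. replace (1 * x)%C with x by ring. ring.
Qed.

(** ** The lift near the singular point *)

Lemma cv_on_scale (a : cseq) (r s : R) (k : C) :
  cv_on a r -> Cmod k * s <= r -> 0 < Cmod k -> cv_on (fun n => a n * k ^ n)%C s.
Proof.
  intros H Hk K0 rho Hrho.
  destruct (H (Cmod k * rho)) as [M HM].
  - split; [apply Rmult_le_pos; lra|]. nra.
  - exists M. intros n. rewrite Cmod_mult, Cmod_pow, Rmult_assoc, <- Rpow_mult_distr. auto.
Qed.

Lemma psum_scale (a : cseq) (k z : C) :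
  psum (fun n => a n * k ^ n)%C z = psum a (k * z)%C.
Proof. apply CSeries_ext. intros n. rewrite Cpow_mult_l. ring. Qed.

(** A continuous logarithm of a constant is constant: logarithms differ by
    elements of a discrete group. *)
Lemma Cexp_const_path (h : R -> C) :
  is_path h -> (forall t, I01 t -> Cexp (h t) = Cexp (h 0)) ->
  forall t, I01 t -> h t = h 0.
Proof.
  intros Hh HE. destruct Cexp_near_0 as (d0 & Hd0 & Inj & _).
  apply (I01_locally_constant (fun t => h t = h 0)); auto.
  intros t Ht. destruct (continuous_on_I01_eps h t d0 Hh Ht) as (d & Hd & W); [lra|].
  exists d. split; auto. intros s Hs Hst. specialize (W s Hs Hst).
  assert (E : (h s - h t)%C = 0).
  { apply Inj; auto.
    replace (Cexp (h s - h t)) with (Cexp (h s) * Cexp (- h t))%C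
      by (rewrite <- Cexp_plus; f_equal).
    rewrite (HE s Hs), <- (HE t Ht). apply Cexp_opp_mult. }
  assert (E' : h s = h t) by (apply Ceq_minus; exact E). rewrite E'. tauto.
Qed.

(** The disc around [0] through [omega] lifts by the principal logarithm, so [F]
    extends to it and Taylor's theorem gives the radius. *)
Lemma lift_on_disc (F : cseq) (omega : C) (Phi : C -> C) (d : R) :
  convergent F -> omega <> 0 -> hol (fun _ => True) Phi -> 0 < d ->
  (forall x, Cmod x < d -> Phi x = psum F (omega * (1 - Cexp x))%C) ->
  cv_on F (Cmod omega) /\
  forall z, Cmod z < Cmod omega -> psum F z = Phi (Clog1m (z / omega)%C).
Proof.
  intros hF Ho HPhi Hd HE.
  assert (O0 : 0 < Cmod omega) by (apply Cmod_gt_0; auto).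
  assert (Hz : forall z, Cmod z < Cmod omega -> Cmod (z / omega)%C < 1).
  { intros z Hz. rewrite Cmod_div by auto. apply Rdiv_lt_one; auto. }
  destruct (hol_taylor (fun z => Phi (Clog1m (z / omega)%C)) 0 (Cmod omega)) as (a & Ha & Ea);
    auto.
  { apply (hol_comp _ (fun _ => True) Phi); auto.
    apply hol_Clog1m.
    - unfold Cdiv. apply hol_mult; [apply hol_id|apply hol_const].
    - intros z Hz'. replace (z - 0)%C with z in Hz' by ring. auto. }
  apply convergent_cv_on in hF. destruct hF as (r & Hr & HF).
  destruct (Clog1m_small d Hd) as (e & He & Hlog).
  set (r' := Rmin r (e * Cmod omega)).
  assert (Hr' : 0 < r') by (apply Rmin_pos; auto; apply Rmult_lt_0_compat; lra).
  assert (r' <= r) by apply Rmin_l.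
  assert (Hr2 : r' <= e * Cmod omega) by apply Rmin_r.
  assert (Hr3 : e * Cmod omega <= Cmod omega) by nra.
  assert (E : F = a).
  { apply (psum_unique_disc F a r'); auto.
    - apply cv_on_le with r; auto.
    - apply cv_on_le with (Cmod omega); auto. lra.
    - intros z Hzr. replace z with (z - 0)%C at 2 by ring. rewrite <- Ea.
      2:{ replace (z - 0)%C with z by ring. lra. }
      rewrite HE.
      + rewrite Cexp_Clog1m by (apply Hz; lra). f_equal. field. auto.
      + apply Hlog. rewrite Cmod_div by auto.
        apply Rmult_lt_reg_r with (Cmod omega); auto.
        unfold Rdiv. rewrite Rmult_assoc, Rinv_l; lra. }
  subst a. split; auto. intros z Hzr. rewrite Ea; [f_equal; ring|].
  replace (z - 0)%C with z by ring. auto.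
Qed.

Lemma one_minus_exp_range (x : R) : x < 0 -> Cmod (1 - Cexp x)%C < 1.
Proof.
  intros Hx. rewrite Cexp_RtoC, <- RtoC_minus, Cmod_R.
  assert (exp x < 1) by (rewrite <- exp_0; apply exp_increasing; auto).
  assert (0 < exp x) by apply exp_pos. rewrite Rabs_pos_eq; lra.
Qed.

Lemma Clog1m_one_minus_exp (x : R) : x < 0 -> Clog1m (1 - Cexp x)%C = x.
Proof.
  intros Hx.
  set (h := fun t : R => (Clog1m (1 - Cexp (RtoC (t * x))) - RtoC (t * x))%C).
  assert (Hr : forall t, I01 t -> Cmod (1 - Cexp (RtoC (t * x)))%C < 1).
  { intros t Ht. destruct (Req_dec t 0) as [->|T].
    - rewrite Rmult_0_l, Cexp_0. replace (1 - 1)%C with (RtoC 0) by ring.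
      rewrite Cmod_0; lra.
    - apply one_minus_exp_range. destruct Ht. nra. }
  assert (H0 : h 0 = 0).
  { unfold h. rewrite Rmult_0_l, Cexp_0. replace (1 - 1)%C with (RtoC 0) by ring.
    rewrite Clog1m_0. ring. }
  assert (HE : forall t, I01 t -> Cexp (h t) = 1).
  { intros t Ht. unfold h, Cminus. rewrite Cexp_plus.
    change (1 + - Cexp (RtoC (t * x)))%C with (1 - Cexp (RtoC (t * x)))%C.
    rewrite Cexp_Clog1m by auto.
    replace (1 - (1 - Cexp (RtoC (t * x))))%C with (Cexp (RtoC (t * x))) by ring.
    apply Cexp_opp_mult. }
  assert (Hp : is_path h).
  { intros t Ht P HP.
    assert (Hc : continuous h t).
    { assert (Ct : continuous (fun t : R => RtoC (t * x)) t).
      { apply continuous_RtoC. apply (continuous_scal_l (V := R_NormedModule)).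
        apply continuous_id. }
      apply continuous_Cminus; auto.
      apply (continuous_comp (fun t : R => (1 - Cexp (RtoC (t * x)))%C) Clog1m).
      - apply continuous_Cminus; [apply continuous_const|].
        apply (continuous_comp (fun t : R => RtoC (t * x)) Cexp); auto.
        eapply is_derive_continuous, is_derive_Cexp.
      - eapply is_derive_continuous, is_derive_Clog1m. auto. }
    destruct (Hc P HP) as [d Hd]. exists d. intros s Hs _. apply Hd, Hs. }
  assert (E : h 1 = h 0).
  { apply (Cexp_const_path h Hp); [|unfold I01; lra].
    intros t Ht. rewrite H0, Cexp_0. auto. }
  rewrite H0 in E. unfold h in E. rewrite Rmult_1_l in E. apply Ceq_minus. exact E.
Qed.

(** Along the ray that ends at [omega] the given branch of the logarithm is
    [x + l], whichever branch it is. *)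
Lemma log_branch_ray (omega : C) (L : C -> C) :
  omega <> 0 -> log_branch (fun xi => touching_disc omega 0 (omega + xi)%C) L ->
  exists l, forall x, x < 0 -> L (- (omega * Cexp (RtoC x)))%C = (RtoC x + l)%C.
Proof.
  intros Ho [Hc HL].
  assert (O0 : 0 < Cmod omega) by (apply Cmod_gt_0; auto).
  set (xi := fun x : R => (- (omega * Cexp (RtoC x)))%C).
  assert (Hxi : forall x, x < 0 -> touching_disc omega 0 (omega + xi x)%C).
  { intros x Hx. unfold touching_disc, xi.
    replace (omega + - (omega * Cexp x) - 0)%C with (omega * (1 - Cexp x))%C by ring.
    replace (omega - 0)%C with omega by ring. rewrite Cmod_mult.
    assert (Y := one_minus_exp_range x Hx). nra. }
  set (u := fun x : R => (L (xi x) - x)%C).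
  exists (u (-1)). intros x Hx.
  set (y := fun t : R => -1 + t * (x - -1)).
  assert (Hy : forall t, I01 t -> y t < 0) by (intros t [T1 T2]; unfold y; nra).
  assert (Cy : forall t, continuous y t).
  { intros t. apply (continuous_plus (V := R_NormedModule)); [apply continuous_const|].
    apply (continuous_scal_l (V := R_NormedModule)). apply continuous_id. }
  assert (Cxi : forall x, continuous xi x).
  { intros z. apply continuous_ext with (fun x : R => (- omega * Cexp (RtoC x))%C).
    - intros w. unfold xi.
      change (- omega * Cexp (RtoC w) = - (omega * Cexp (RtoC w)))%C. ring.
    - apply continuous_Cmult; [apply continuous_const|].
      apply (continuous_comp (fun x : R => RtoC x) Cexp).
      + apply continuous_RtoC, continuous_id.
      + eapply is_derive_continuous, is_derive_Cexp. }
  assert (E : u (y 1) = u (y 0)).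
  { apply (Cexp_const_path (fun t => u (y t))); [| |unfold I01; lra].
    - intros t Ht P HP. apply locally_disc in HP. destruct HP as (e & He & HP).
      assert (C1 : locally (L (xi (y t))) (fun z => Cmod (z - L (xi (y t)))%C < e / 2)).
      { apply locally_disc. exists (e / 2). split; auto. lra. }
      apply (Hc _ (Hxi _ (Hy t Ht))) in C1.
      assert (C2 := continuous_comp y xi t (Cy t) (Cxi (y t)) _ C1).
      assert (C3 : locally (RtoC (y t)) (fun z => Cmod (z - RtoC (y t))%C < e / 2)).
      { apply locally_disc. exists (e / 2). split; auto. lra. }
      assert (C4 := continuous_RtoC y t (Cy t) _ C3).
      unfold filtermap, within in *.
      generalize (filter_and _ _ C2 C4). apply filter_imp.
      intros s [B1 B2] Hs. specialize (B1 (Hxi _ (Hy s Hs))).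
      apply HP. unfold u.
      replace (L (xi (y s)) - y s - (L (xi (y t)) - y t))%C
        with ((L (xi (y s)) - L (xi (y t))) + - (y s - y t))%C by ring.
      eapply Rle_lt_trans; [apply Cmod_triangle|]. rewrite Cmod_opp. lra.
    - assert (EU : forall x, x < 0 -> Cexp (u x) = (- omega)%C).
      { intros z Hz. unfold u, Cminus. rewrite Cexp_plus, (HL _ (Hxi z Hz)).
        unfold xi. rewrite <- (Cmult_1_r (- omega)), <- (Cexp_opp_mult z). ring. }
      intros t Ht. rewrite !EU; auto; apply Hy; auto. unfold I01; lra. }
  replace (y 1) with x in E by (unfold y; ring).
  replace (y 0) with (-1) in E by (unfold y; ring).
  rewrite <- E. unfold u, xi. ring.
Qed.

Lemma ln_threshold (r : R) : 0 < r -> forall x, x < ln r -> exp x < r.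
Proof. intros Hr x Hx. rewrite <- (exp_ln r Hr). apply exp_increasing. auto. Qed.

(** The constant path at [0] ends at a branch whose disc of convergence touches
    [omega].  The assumed expansion of this branch, read along the ray from [0] to
    [omega], is an identity for real [x]. *)
Lemma lift_near_singularity (F : cseq) (omega : C) (Phi : C -> C) :
  omega <> 0 -> only_simple_singularities F -> cv_on F (Cmod omega) -> 
  (forall z, Cmod z < Cmod omega -> psum F z = Phi (Clog1m (z / omega)%C)) ->
  exists (N r : R) (c : C) (v rho : cseq),
    0 < r /\ cv_on v r /\ cv_on rho r /\ exp (- N) <= r /\
    forall x : R, x < - N ->
      Phi x = (c * Cexp (- x) + psum v (Cexp x) * x + psum rho (Cexp x))%C.
Proof.
  intros Ho sF HF HPhi.
  assert (O0 : 0 < Cmod omega) by (apply Cmod_gt_0; auto).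
  assert (hF : convergent F) by (apply convergent_cv_on; exists (Cmod omega); auto).
  destruct (sF omega Ho 0 F) as (c & V & R & L & HV & HR & HL & Hloc).
  { split; [|split].
    - exists (fun _ => RtoC 0), (fun _ => F). split; [|split; auto].
      + apply continuous_is_path. intros; apply continuous_const.
      + apply continuation_const; auto.
    - intros E; apply Ho; auto.
    - replace (omega - 0)%C with omega by ring. apply cv_on_radius; auto. }
  destruct (log_branch_ray omega L Ho HL) as [l Hl].
  apply convergent_cv_on in HV, HR.
  destruct HV as (r1 & Hr1 & HV). destruct HR as (r2 & Hr2 & HR).
  apply locally_disc in Hloc. destruct Hloc as (e & He & Hloc).
  set (r := Rmin r1 r2 / Cmod omega).
  assert (Hr : 0 < r) by (apply Rdiv_lt_0_compat; auto; apply Rmin_pos; auto).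
  assert (Er : Cmod omega * r = Rmin r1 r2) by (unfold r; field; lra).
  assert (M1 : Rmin r1 r2 <= r1) by apply Rmin_l.
  assert (M2 : Rmin r1 r2 <= r2) by apply Rmin_r.
  assert (K : Cmod (- omega)%C = Cmod omega) by apply Cmod_opp.
  assert (TP : (2 * PI * Ci)%C <> 0).
  { assert (P := PI_RGT_0). apply Cmult_neq_0; [|apply Ci_nz].
    rewrite <- RtoC_mult. intros E. apply RtoC_inj in E. lra. }
  set (v := fun n => (0 + / (2 * PI * Ci) * (V n * (- omega) ^ n))%C).
  set (rho0 := fun n => (R n * (- omega) ^ n)%C).
  assert (HV' : cv_on (fun n => V n * (- omega) ^ n)%C r)
    by (apply cv_on_scale with r1; auto; rewrite K; lra).
  assert (HR' : cv_on rho0 r) by (apply cv_on_scale with r2; auto; rewrite K; lra).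
  assert (H0 : cv_on (fun _ => RtoC 0) r).
  { intros s Hs. exists 0. intros n. rewrite Cmod_0. lra. }
  assert (Hv : cv_on v r) by (apply (cv_on_lin _ _ _ _ H0 HV')).
  exists (Rmax (Rmax 0 (- ln r)) (- ln (e / Cmod omega))), r, (- c / omega)%C, v,
    (fun n => rho0 n + l * v n)%C.
  assert (N1 := Rmax_l (Rmax 0 (- ln r)) (- ln (e / Cmod omega))).
  assert (N2 := Rmax_r (Rmax 0 (- ln r)) (- ln (e / Cmod omega))).
  assert (N3 := Rmax_l 0 (- ln r)). assert (N4 := Rmax_r 0 (- ln r)).
  set (N := Rmax (Rmax 0 (- ln r)) (- ln (e / Cmod omega))) in *.
  split; [auto|]. split; [auto|]. split; [apply cv_on_lin; auto|].
  assert (HN : exp (- N) <= r).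
  { destruct (Req_dec (- N) (ln r)) as [->|D]; [rewrite exp_ln; lra|].
    left. apply ln_threshold; auto. lra. }
  split; auto. intros x Hx.
  assert (Hx0 : x < 0) by lra.
  assert (Ex : exp x < r) by (apply Rlt_le_trans with (2 := HN); apply exp_increasing; auto).
  assert (Ee : exp x < e / Cmod omega)
    by (apply ln_threshold; [apply Rdiv_lt_0_compat; auto|lra]).
  set (xi := (- (omega * Cexp x))%C).
  assert (Cx : Cmod (Cexp x) = exp x) by (rewrite Cmod_Cexp; reflexivity).
  destruct (Hloc xi) as (sv & sr & S1 & S2 & S3).
  - replace (xi - 0)%C with xi by ring. unfold xi. rewrite Cmod_opp, Cmod_mult, Cx.
    apply Rmult_lt_1_of_lt_Rdiv; auto.
  - unfold touching_disc, xi.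
    replace (omega + - (omega * Cexp x) - 0)%C with (omega * (1 - Cexp x))%C by ring.
    replace (omega - 0)%C with omega by ring. rewrite Cmod_mult.
    assert (Y := one_minus_exp_range x Hx0). nra.
  - apply sums_to_unique in S1, S2, S3.
    assert (Z : (omega + xi - 0)%C = (omega * (1 - Cexp x))%C) by (unfold xi; ring).
    rewrite Z, HPhi in S3.
    2:{ rewrite Cmod_mult. assert (Y := one_minus_exp_range x Hx0). nra. }
    replace (omega * (1 - Cexp x) / omega)%C with (1 - Cexp x)%C in S3 by (field; auto).
    rewrite Clog1m_one_minus_exp in S3 by auto. rewrite S3.
    assert (Xi : xi = (- omega * Cexp x)%C) by (unfold xi; ring).
    assert (Lx : L xi = (x + l)%C) by (apply Hl; auto). rewrite Lx.
    assert (Ev : psum v (Cexp x) = (/ (2 * PI * Ci) * sv)%C).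
    { unfold v. rewrite (psum_lin _ _ _ _ _ H0 HV') by (rewrite Cx; auto).
      rewrite psum_scale, <- Xi, S1, (psum_const (fun _ => RtoC 0)); auto. ring. }
    rewrite (psum_lin rho0 v l r) by (auto; rewrite Cx; auto).
    rewrite Ev. unfold rho0. rewrite psum_scale, <- Xi, S2.
    assert (En : Cexp (- x)%C = (/ Cexp x)%C).
    { rewrite <- (Cmult_1_l (/ Cexp x)), <- (Cexp_opp_mult x). field. apply Cexp_nz. }
    rewrite En, Xi. field. split; [apply Ci_nz|].
    split; [|split; [apply Cexp_nz|auto]].
    intros E. apply RtoC_inj in E. generalize PI_RGT_0. lra.
Qed.

(** ** Entire functions *)

Definition entire : (C -> C) -> Prop := hol (fun _ => True).

Definition entire_seq (a : cseq) : Prop := forall r, cv_on a r.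

Lemma hol_identity (f g : C -> C) (p : C) (r e : R) :
  0 < r -> 0 < e ->
  hol (fun z => Cmod (z - p)%C < r) f -> hol (fun z => Cmod (z - p)%C < r) g ->
  (forall x : R, 0 < x < e -> f (p + x)%C = g (p + x)%C) ->
  forall z, Cmod (z - p)%C < r -> f z = g z.
Proof.
  intros Hr He Hf Hg H z Hz.
  destruct (hol_taylor f p r Hr Hf) as (a & Ha & Ea).
  destruct (hol_taylor g p r Hr Hg) as (b & Hb & Eb).
  rewrite Ea, Eb by auto. apply CSeries_ext. intros n. f_equal.
  apply (psum_unique a b (Rmin e r)); [apply Rmin_pos; auto| | |].
  - apply cv_on_le with r; auto. apply Rmin_r.
  - apply cv_on_le with r; auto. apply Rmin_r.
  - intros x Hx. assert (M1 := Rmin_l e r). assert (M2 := Rmin_r e r).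
    assert (X : (p + x - p)%C = x) by ring.
    specialize (Ea (p + x)%C). specialize (Eb (p + x)%C). rewrite X in Ea, Eb.
    rewrite <- Ea, <- Eb by (rewrite Cmod_R, Rabs_pos_eq; lra).
    apply H. lra.
Qed.

(** A disc of large radius tangent to the boundary of a half plane contains any
    given point of it. *)
Lemma half_plane_disc (N : R) (z : C) :
  Re z < - N -> exists p : R, p < - N /\ Cmod (z - p)%C < - N - p.
Proof.
  intros Hz. set (d := - N - Re z). assert (Hd : 0 < d) by (unfold d; lra).
  set (y := Im z). set (M := (y ^ 2) / d + 1).
  assert (HM : M * d = y ^ 2 + d) by (unfold M; field; lra).
  assert (M0 : 0 < M).
  { unfold M. assert (0 <= y ^ 2 / d); [|lra].
    apply Rmult_le_pos; [apply pow2_ge_0|left; apply Rinv_0_lt_compat; auto]. }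
  exists (Re z - M). split; [unfold d in *; lra|].
  replace (- N - (Re z - M)) with (d + M) by (unfold d; ring).
  apply Rsqr_incrst_0; [|apply Cmod_ge_0|lra].
  unfold Rsqr.
  replace (Cmod (z - RtoC (Re z - M))%C * Cmod (z - RtoC (Re z - M))%C)
    with (M * M + y * y).
  2:{ transitivity (Cmod (z - RtoC (Re z - M))%C ^ 2); [|ring].
      rewrite Cmod2_alt. unfold y, Re, Im. simpl. ring. }
  simpl in HM. clearbody M y d.
  replace ((d + M) * (d + M)) with (d * d + 2 * (M * d) + M * M) by ring.
  rewrite HM. assert (0 <= y * y) by nra. assert (0 < d * d) by nra. lra.
Qed.

(** The discs centred far to the left on the real axis exhaust a left half
    plane, so the identity theorem on discs is enough. *)
Lemma identity_half_plane (f g : C -> C) (N : R) :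
  hol (fun z => Re z < - N) f -> hol (fun z => Re z < - N) g ->
  (forall x : R, x < - N -> f x = g x) ->
  forall z, Re z < - N -> f z = g z.
Proof.
  intros Hf Hg H z Hz. destruct (half_plane_disc N z Hz) as (p & Hp & Hzp).
  assert (S : forall w, Cmod (w - p)%C < - N - p -> Re w < - N).
  { intros w Hw. assert (Y := re_le_Cmod (w - p)%C).
    replace (Re (w - p)%C) with (Re w - p) in Y by (unfold Re; simpl; ring).
    apply Rle_lt_trans with (2 := Hw) in Y. apply Rabs_def2 in Y. lra. }
  apply (hol_identity f g p (- N - p) (- N - p)); auto; try lra.
  - apply hol_subset with (2 := Hf). auto.
  - apply hol_subset with (2 := Hg). auto.
  - intros x Hx. rewrite <- RtoC_plus. apply H. lra.
Qed.

Lemma identity_entire (f g : C -> C) (N : R) :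
  entire f -> entire g ->
  (forall x : R, x < - N -> f x = g x) -> forall z, f z = g z.
Proof.
  intros Hf Hg H z.
  apply (hol_identity f g (RtoC (- N - 1)) (Cmod (z - RtoC (- N - 1))%C + 1) 1); try lra.
  - assert (Y := Cmod_ge_0 (z - RtoC (- N - 1))%C). lra.
  - apply hol_subset with (2 := Hf). auto.
  - apply hol_subset with (2 := Hg). auto.
  - intros x Hx. rewrite <- RtoC_plus. apply H. lra.
Qed.

Lemma entire_taylor (f : C -> C) :
  entire f -> exists a, entire_seq a /\ forall z, f z = psum a z.
Proof.
  intros Hf.
  assert (T : forall r, 0 < r -> exists a, cv_on a r /\
    forall z, Cmod z < r -> f z = psum a z).
  { intros r Hr. destruct (hol_taylor f 0 r Hr) as (a & Ha & Ea).
    - apply hol_subset with (2 := Hf). auto.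
    - exists a. split; auto. intros z Hz. rewrite Ea.
      + f_equal. ring.
      + replace (z - 0)%C with z by ring. auto. }
  destruct (T 1 Rlt_0_1) as (a & Ha & Ea).
  assert (A : forall r, 1 <= r -> cv_on a r /\ forall z, Cmod z < r -> f z = psum a z).
  { intros r Hr. destruct (T r) as (b & Hb & Eb); [lra|].
    replace a with b; auto.
    apply (psum_unique_disc b a 1); auto; [lra|apply cv_on_le with r; auto|].
    intros z Hz. rewrite <- Ea, <- Eb; auto. lra. }
  exists a. split.
  - intros r. apply cv_on_le with (Rmax 1 r); [apply Rmax_r|]. apply A, Rmax_l.
  - intros z. apply (A (Rmax 1 (Cmod z + 1))); [apply Rmax_l|].
    eapply Rlt_le_trans; [|apply Rmax_r]. lra.
Qed.

Lemma entire_psum (a : cseq) : entire_seq a -> entire (psum a).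
Proof.
  intros H. apply hol_local. intros z _.
  exists 1, (psum a). split; [lra|]. split; auto.
  apply hol_subset with (fun w => Cmod (w - 0)%C < Cmod z + 1).
  - intros w Hw. replace (w - 0)%C with ((w - z) + z)%C by ring.
    eapply Rle_lt_trans; [apply Cmod_triangle|]. lra.
  - apply hol_ext with (fun w => psum a (w - 0)%C); [intros; f_equal; ring|].
    apply hol_psum. apply H.
Qed.

Lemma entire_shift (f : C -> C) (c : C) : entire f -> entire (fun z => f (z + c)%C).
Proof.
  intros H. apply (hol_comp _ (fun _ => True) f); auto.
  apply hol_plus; [apply hol_id|apply hol_const].
Qed.

Definition two_pi_i : C := (2 * PI * Ci)%C.

Lemma two_pi_i_nz : two_pi_i <> 0.
Proof.
  assert (P := PI_RGT_0). apply Cmult_neq_0; [|apply Ci_nz].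
  rewrite <- RtoC_mult. intros E. apply RtoC_inj in E. lra.
Qed.

Lemma Cexp_two_pi_i (z : C) : Cexp (z + two_pi_i)%C = Cexp z.
Proof.
  rewrite Cexp_plus. replace (Cexp two_pi_i) with (RtoC 1); [ring|].
  unfold Cexp, two_pi_i. 
  replace (Re (2 * PI * Ci)%C) with 0 by (unfold Re; simpl; ring).
  replace (Im (2 * PI * Ci)%C) with (2 * PI) by (unfold Im; simpl; ring).
  rewrite exp_0, cos_2PI, sin_2PI. apply injective_projections; simpl; ring.
Qed.

Lemma periodic_factors (D : C -> C) :
  (forall z, D (z + two_pi_i)%C = D z) ->
  forall x y, Cexp x = Cexp y -> D x = D y.
Proof.
  intros HD x y E.
  assert (Hn : forall n z, D (z + INR n * two_pi_i)%C = D z).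
  { induction n; intros z.
    - simpl. f_equal. ring.
    - rewrite S_INR, RtoC_plus.
      replace (z + (INR n + 1) * two_pi_i)%C with ((z + INR n * two_pi_i) + two_pi_i)%C by ring.
      rewrite HD. auto. }
  destruct (Cexp_eq_1 (x - y)%C) as [k Hk].
  { replace (Cexp (x - y)) with (Cexp x * Cexp (- y))%C
      by (rewrite <- Cexp_plus; f_equal).
    rewrite E. apply Cexp_opp_mult. }
  assert (Hx : x = (y + IZR k * two_pi_i)%C).
  { replace x with (y + (x - y))%C by ring. rewrite Hk. unfold two_pi_i. ring. }
  destruct (Z.le_gt_cases 0 k) as [L|L].
  - rewrite Hx, <- (Z2Nat.id k L), <- INR_IZR_INZ. apply Hn.
  - rewrite <- (Hn (Z.to_nat (- k)) x). f_equal.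
    rewrite INR_IZR_INZ, Z2Nat.id by lia. rewrite Hx, opp_IZR, RtoC_opp. ring.
Qed.

(** A periodic entire function that is a power series in [exp x] far to the left
    is a holomorphic function of [exp x] on the punctured plane; the power
    series removes the singularity at the origin, so it converges everywhere. *)
Lemma entire_of_periodic (D : C -> C) (v : cseq) (r N : R) :
  entire D -> (forall z, D (z + two_pi_i)%C = D z) ->
  0 < r -> cv_on v r -> exp (- N) <= r ->
  (forall z, Re z < - N -> D z = psum v (Cexp z)) ->
  entire_seq v /\ forall z, D z = psum v (Cexp z).
Proof.
  intros HD Hper Hr Hv HN HE.
  assert (HF := periodic_factors D Hper).
  set (W := fun z : C => match Ceq_dec z 0 with
    | left _ => v O
    | right n => D (proj1_sig (constructive_indefinite_description _ (Cexp_surj z n)))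
    end).
  assert (WE : forall x, W (Cexp x) = D x).
  { intros x. unfold W. destruct (Ceq_dec (Cexp x) 0) as [E|n].
    - destruct (Cexp_nz x E).
    - destruct (constructive_indefinite_description _ _) as [y Hy]. simpl. auto. }
  assert (W0 : forall z, Cmod z < exp (- N) -> W z = psum v z).
  { intros z Hz. destruct (Ceq_dec z 0) as [->|n].
    - unfold W. destruct (Ceq_dec 0 0) as [_|F]; [|exfalso; apply F; reflexivity].
      symmetry. apply (psum_0 v r); auto.
    - destruct (Cexp_surj z n) as [x <-]. rewrite WE. apply HE.
      rewrite Cmod_Cexp in Hz. apply exp_lt_inv in Hz. auto. }
  assert (HW : entire W).
  { apply hol_local. intros z _. destruct (Ceq_dec z 0) as [->|n].
    - exists (exp (- N)), (psum v). split; [apply exp_pos|]. split.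
      + apply hol_ext with (fun w => psum v (w - 0)%C); [intros; f_equal; ring|].
        apply hol_psum. apply cv_on_le with r; auto.
      + intros w Hw. apply W0. replace (w - 0)%C with w in Hw by ring. auto.
    - assert (Z0 : 0 < Cmod z) by (apply Cmod_gt_0; auto).
      destruct (Cexp_surj z n) as [x Hx].
      assert (B : forall w, Cmod (w - z)%C < Cmod z -> Cmod (1 - w / z)%C < 1).
      { intros w Hw. replace (1 - w / z)%C with (- ((w - z) / z))%C by (field; auto).
        rewrite Cmod_opp, Cmod_div by auto. apply Rdiv_lt_one; auto. }
      exists (Cmod z), (fun w => D (x + Clog1m (1 - w / z))%C). split; auto. split.
      + apply (hol_comp _ (fun _ => True) D); auto.
        apply hol_plus; [apply hol_const|]. apply hol_Clog1m; auto.
        apply hol_minus; [apply hol_const|]. unfold Cdiv.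
        apply hol_mult; [apply hol_id|apply hol_const].
      + intros w Hw. rewrite <- WE. f_equal.
        rewrite Cexp_plus, Hx, Cexp_Clog1m by auto. field. auto. }
  destruct (entire_taylor W HW) as (a & Ha & Ea).
  assert (E : a = v).
  { assert (P := exp_pos (- N)).
    apply (psum_unique_disc a v (exp (- N))); auto.
    - apply cv_on_le with r; auto.
    - intros z Hz. rewrite <- Ea. apply W0. auto. }
  subst a. split; auto. intros z. rewrite <- Ea, WE. reflexivity.
Qed.

(** The monodromy around [omega] of a lift of the given shape is [v (exp x)] up
    to a constant; it is entire and periodic, and so is what is left of the lift
    after removing the polar and logarithmic parts. *)
Lemma lift_structure (Phi : C -> C) (N r : R) (c : C) (v rho : cseq) :
  entire Phi -> 0 < r -> cv_on v r -> cv_on rho r -> exp (- N) <= r ->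
  (forall x : R, x < - N ->
      Phi x = (c * Cexp (- x) + psum v (Cexp x) * x + psum rho (Cexp x))%C) ->
  entire_seq v /\ entire_seq rho /\
  forall z, Phi z = (c * Cexp (- z) + psum v (Cexp z) * z + psum rho (Cexp z))%C.
Proof.
  intros HPhi Hr Hv Hrho HN HE.
  assert (Hlt : forall z, Re z < - N -> Cmod (Cexp z) < r).
  { intros z Hz. rewrite Cmod_Cexp. apply Rlt_le_trans with (2 := HN).
    apply exp_increasing. auto. }
  assert (Hps : forall a, cv_on a r -> hol (fun z => Re z < - N) (fun z => psum a (Cexp z))).
  { intros a Ha. apply (hol_comp _ (fun w => Cmod (w - 0)%C < r) (psum a) Cexp).
    - apply hol_ext with (fun w => psum a (w - 0)%C); [intros; f_equal; ring|].
      apply hol_psum; auto.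
    - apply hol_Cexp, hol_id.
    - intros z Hz. replace (Cexp z - 0)%C with (Cexp z) by ring. auto. }
  assert (HH : forall z, Re z < - N ->
      Phi z = (c * Cexp (- z) + psum v (Cexp z) * z + psum rho (Cexp z))%C).
  { apply (identity_half_plane Phi
      (fun z => c * Cexp (- z) + psum v (Cexp z) * z + psum rho (Cexp z))%C N); auto.
    - apply hol_subset with (2 := HPhi). auto.
    - apply hol_plus; auto. apply hol_plus.
      + apply hol_mult; [apply hol_const|]. apply hol_Cexp, hol_opp, hol_id.
      + apply hol_mult; auto. apply hol_id. }
  assert (Reshift : forall z, Re (z + two_pi_i)%C = Re z).
  { intros z. unfold two_pi_i, Re. simpl. ring. }
  assert (Eopp : forall z, Cexp (- (z + two_pi_i)) = Cexp (- z)).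
  { intros z. rewrite <- (Cexp_two_pi_i (- (z + two_pi_i))). f_equal. ring. }
  (* The monodromy of the lift, divided by that of the logarithm. *)
  set (D := fun z => (/ two_pi_i * (Phi (z + two_pi_i) - Phi z))%C).
  assert (HD : entire D).
  { apply hol_mult; [apply hol_const|]. apply hol_minus; auto. apply entire_shift; auto. }
  assert (HDv : forall z, Re z < - N -> D z = psum v (Cexp z)).
  { intros z Hz. unfold D. rewrite (HH z Hz), (HH (z + two_pi_i)%C) by (rewrite Reshift; auto).
    rewrite Cexp_two_pi_i, Eopp. field. apply two_pi_i_nz. }
  assert (Dper : forall z, D (z + two_pi_i)%C = D z).
  { apply (identity_entire (fun z => D (z + two_pi_i)%C) D N); auto.
    - apply entire_shift; auto.
    - intros x Hx. rewrite !HDv; auto; [|rewrite Reshift; auto].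
      rewrite Cexp_two_pi_i. reflexivity. }
  destruct (entire_of_periodic D v r N HD Dper Hr Hv HN HDv) as [EV EDv].
  set (E := fun z => (Phi z - c * Cexp (- z) - D z * z)%C).
  assert (HEe : entire E).
  { apply hol_minus; [apply hol_minus; auto|].
    - apply hol_mult; [apply hol_const|]. apply hol_Cexp, hol_opp, hol_id.
    - apply hol_mult; auto. apply hol_id. }
  assert (HEr : forall z, Re z < - N -> E z = psum rho (Cexp z)).
  { intros z Hz. unfold E. rewrite HH, HDv by auto. ring. }
  assert (Eper : forall z, E (z + two_pi_i)%C = E z).
  { apply (identity_entire (fun z => E (z + two_pi_i)%C) E N); auto.
    - apply entire_shift; auto.
    - intros x Hx. rewrite !HEr; auto; [|rewrite Reshift; auto].
      rewrite Cexp_two_pi_i. reflexivity. }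
  destruct (entire_of_periodic E rho r N HEe Eper Hr Hrho HN HEr) as [ER EEr].
  split; auto. split; auto.
  intros z. rewrite <- EDv, <- EEr. unfold E. ring.
Qed.

(** ** Finite sums and Cauchy products *)

Fixpoint Csum (f : nat -> C) (n : nat) : C :=
  match n with O => RtoC 0 | S m => (Csum f m + f m)%C end.

Lemma Csum_ext (f g : nat -> C) (n : nat) :
  (forall k, (k < n)%nat -> f k = g k) -> Csum f n = Csum g n.
Proof.
  intros H. induction n; simpl; auto. rewrite IHn, H; auto.
Qed.

Definition conv (a b : cseq) : cseq := fun n => Csum (fun k => a k * b (n - k)%nat)%C (S n).

Lemma Re_Csum (f : nat -> C) (n : nat) :
  Re (Csum f (S n)) = sum_f_R0 (fun k => Re (f k)) n.
Proof.
  induction n; [cbn [Csum sum_f_R0]; rewrite Cplus_0_l; reflexivity|].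
  change (Csum f (S (S n))) with (Csum f (S n) + f (S n))%C.
  rewrite re_plus, IHn. reflexivity.
Qed.

Lemma Im_Csum (f : nat -> C) (n : nat) :
  Im (Csum f (S n)) = sum_f_R0 (fun k => Im (f k)) n.
Proof.
  induction n; [cbn [Csum sum_f_R0]; rewrite Cplus_0_l; reflexivity|].
  change (Csum f (S (S n))) with (Csum f (S n) + f (S n))%C.
  rewrite im_plus, IHn. reflexivity.
Qed.

Lemma Csum_scal (c : C) (f : nat -> C) (n : nat) :
  Csum (fun k => c * f k)%C n = (c * Csum f n)%C.
Proof. induction n; simpl; [ring|]. rewrite IHn. ring. Qed.

Lemma psum_mult (a b : cseq) (r : R) (z : C) :
  cv_on a r -> cv_on b r -> Cmod z < r ->
  sums_to (conv a b) z (psum a z * psum b z)%C.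
Proof.
  intros Ha Hb Hz.
  set (A := fun n => (a n * z ^ n)%C). set (B := fun n => (b n * z ^ n)%C).
  assert (SA := psum_summable a r z Ha Hz). assert (SB := psum_summable b r z Hb Hz).
  fold A in SA. fold B in SB.
  apply sums_to_iff_series.
  apply (is_series_ext (K := C_AbsRing) (V := C_NormedModule)
    (fun n => Csum (fun k => A k * B (n - k)%nat)%C (S n))).
  { intros n. transitivity (conv a b n * z ^ n)%C; [|reflexivity].
    unfold conv. rewrite Cmult_comm, <- Csum_scal. apply Csum_ext. intros k Hk.
    unfold A, B. replace (z ^ n)%C with (z ^ k * z ^ (n - k))%C; [ring|].
    rewrite <- Cpow_add_r. f_equal. lia. }
  assert (IA := is_series_CSeries A SA). assert (IB := is_series_CSeries B SB).
  apply is_series_C_iff in IA, IB. destruct IA as [IA1 IA2]. destruct IB as [IB1 IB2].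
  assert (abs : forall (f : nat -> C), summable f ->
     ex_series (fun n => Rabs (Re (f n))) /\ ex_series (fun n => Rabs (Im (f n)))).
  { intros f Hf. split;
    apply (ex_series_le (K := R_AbsRing) (V := R_CompleteNormedModule))
      with (fun n => Cmod (f n)); auto; intros n.
    - change (Rabs (Rabs (Re (f n))) <= Cmod (f n)). rewrite Rabs_Rabsolu. apply re_le_Cmod.
    - change (Rabs (Rabs (Im (f n))) <= Cmod (f n)). rewrite Rabs_Rabsolu. apply im_le_Cmod. }
  destruct (abs A SA) as [A1 A2]. destruct (abs B SB) as [B1 B2].
  change (psum a z) with (CSeries A). change (psum b z) with (CSeries B).
  apply is_series_C_iff. split.
  - rewrite re_mult.
    apply (is_series_ext (fun n => minus (sum_f_R0 (fun k => Re (A k) * Re (B (n - k)%nat)) n)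
       (sum_f_R0 (fun k => Im (A k) * Im (B (n - k)%nat)) n))).
    + intros n. rewrite Re_Csum.
      transitivity (sum_f_R0 (fun k => Re (A k) * Re (B (n - k)%nat)
        - Im (A k) * Im (B (n - k)%nat)) n); [rewrite minus_sum; reflexivity|].
      apply sum_eq. intros k _. rewrite re_mult. reflexivity.
    + apply (is_series_minus (V := R_NormedModule)).
      * apply (is_series_mult (fun n => Re (A n)) (fun n => Re (B n))); auto.
      * apply (is_series_mult (fun n => Im (A n)) (fun n => Im (B n))); auto.
  - rewrite im_mult.
    apply (is_series_ext (fun n => plus (sum_f_R0 (fun k => Re (A k) * Im (B (n - k)%nat)) n)
       (sum_f_R0 (fun k => Im (A k) * Re (B (n - k)%nat)) n))).
    + intros n. rewrite Im_Csum.
      transitivity (sum_f_R0 (fun k => Re (A k) * Im (B (n - k)%nat)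
        + Im (A k) * Re (B (n - k)%nat)) n); [rewrite plus_sum; reflexivity|].
      apply sum_eq. intros k _. rewrite im_mult. reflexivity.
    + apply (is_series_plus (V := R_NormedModule)).
      * apply (is_series_mult (fun n => Re (A n)) (fun n => Im (B n))); auto.
      * apply (is_series_mult (fun n => Im (A n)) (fun n => Re (B n))); auto.
Qed.

Lemma cv_on_conv (a b : cseq) (r : R) : cv_on a r -> cv_on b r -> cv_on (conv a b) r.
Proof.
  intros Ha Hb rho Hrho. set (s := (rho + r) / 2).
  assert (Hs : rho <= s < r) by (unfold s; lra).
  assert (Cs : Cmod (RtoC s) = s) by (rewrite Cmod_R, Rabs_pos_eq; lra).
  assert (X := psum_mult a b r s Ha Hb ltac:(lra)).
  apply cv_on_sums_to in X. rewrite Cs in X. apply X. unfold s; lra.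
Qed.

Definition geom1 : cseq := fun _ => RtoC 1.

Lemma cv_on_geom1 : cv_on geom1 1.
Proof.
  intros rho Hr. exists 1. intros n. unfold geom1. rewrite Cmod_1, Rmult_1_l.
  rewrite <- (pow1 n). apply pow_incr. lra.
Qed.

Lemma psum_geom1 (z : C) : Cmod z < 1 -> psum geom1 z = (/ (1 - z))%C.
Proof.
  intros Hz.
  assert (N := one_minus_nz z Hz).
  assert (E := psum_shift geom1 1 z cv_on_geom1 Hz).
  change (fun n => geom1 (S n)) with geom1 in E. change (geom1 0%nat) with (RtoC 1) in E.
  replace (psum geom1 z) with ((psum geom1 z - z * psum geom1 z) / (1 - z))%C by (field; auto).
  rewrite E at 1. field. auto.
Qed.

(** The Taylor coefficients of a germ whose only singularity is a simple one:
    the pole gives a constant, the logarithm a finite convolution with [1 / n],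
    and the regular part a rapidly decreasing remainder. *)
Lemma coefficient_formula (F : cseq) (omega : C) :
  convergent F -> omega <> 0 -> only_simple_singularities F ->
  (forall gamma, is_path gamma -> gamma 0 = 0 ->
     (forall t, I01 t -> gamma t <> omega) -> continuable_along F gamma) ->
  cv_on F (Cmod omega) /\
  exists (c : C) (w rem : cseq), entire_seq w /\ entire_seq rem /\
    forall n, (F n * omega ^ n)%C =
      (c - Csum (fun k => w k / INR (n - k)) n + rem n)%C.
Proof.
  intros hF Ho sF Hs.
  destruct (lift_entire F omega hF Ho Hs) as (Phi & HPhi & d & Hd & HE).
  destruct (lift_on_disc F omega Phi d hF Ho HPhi Hd HE) as [HF HFP].
  destruct (lift_near_singularity F omega Phi Ho sF HF HFP)
    as (N & r & c & v & rho & Hr & Hv & Hrho & HN & HX).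
  destruct (lift_structure Phi N r c v rho HPhi Hr Hv Hrho HN HX) as (EV & ER & EQ).
  assert (O0 : 0 < Cmod omega) by (apply Cmod_gt_0; auto).
  (* From the variable [exp x = 1 - s] to the variable [s]. *)
  assert (Refl : forall a, entire_seq a ->
    exists b, entire_seq b /\ forall s, psum a (1 - s)%C = psum b s).
  { intros a Ha. apply (entire_taylor (fun s => psum a (1 - s)%C)).
    apply (hol_comp _ (fun _ => True) (psum a)); auto.
    - apply entire_psum; auto.
    - apply hol_minus; [apply hol_const|apply hol_id]. }
  destruct (Refl v EV) as (w & Hw & Ew). destruct (Refl rho ER) as (rem & Hrem & Erem).
  split; auto. exists c, w, rem. split; auto. split; auto.
  assert (Hconv : cv_on (conv w log1m) 1) by (apply cv_on_conv; auto; apply cv_on_log1m).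
  assert (H1 : cv_on (fun n => F n * omega ^ n)%C 1)
    by (apply cv_on_scale with (Cmod omega); auto; lra).
  set (lhs := fun n => (F n * omega ^ n)%C) in *.
  set (t1 := fun n => (conv w log1m n + c * geom1 n)%C).
  assert (Ht1 : cv_on t1 1) by (apply cv_on_lin; auto; apply cv_on_geom1).
  assert (E : lhs = (fun n => t1 n + 1 * rem n)%C).
  { apply (psum_unique_disc _ _ 1); auto; [lra|apply cv_on_lin; auto|].
    intros s Hs1. unfold lhs. rewrite psum_scale.
    rewrite HFP by (rewrite Cmod_mult; nra).
    replace (omega * s / omega)%C with s by (field; auto).
    rewrite (psum_lin t1 rem 1 1) by auto.
    unfold t1. rewrite (psum_lin (conv w log1m) geom1 c 1) by (auto; apply cv_on_geom1).
    rewrite psum_geom1 by auto.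
    rewrite (sums_to_unique _ _ _ (psum_mult w log1m 1 s (Hw 1) cv_on_log1m Hs1)).
    fold (Clog1m s). rewrite EQ, Cexp_Clog1m by auto. rewrite Ew, Erem.
    assert (Einv : Cexp (- Clog1m s)%C = (/ (1 - s))%C).
    { rewrite <- (Cexp_Clog1m s Hs1).
      rewrite <- (Cmult_1_l (/ Cexp (Clog1m s))), <- (Cexp_opp_mult (Clog1m s)).
      field. apply Cexp_nz. }
    rewrite Einv. ring. }
  intros n. change (lhs n = (c - Csum (fun k => w k / INR (n - k)) n + rem n)%C).
  rewrite E. unfold t1, conv, geom1. simpl Csum. rewrite Nat.sub_diag.
  change (log1m 0%nat) with (RtoC 0).
  replace (Csum (fun k => w k * log1m (n - k)%nat)%C n)
    with (- (1) * Csum (fun k => w k / INR (n - k)) n)%C; [ring|].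
  rewrite <- Csum_scal. apply Csum_ext. intros k Hk.
  destruct (n - k)%nat eqn:Ek; [lia|]. unfold log1m, Cdiv. ring.
Qed.

(** * Taylor coefficients as iterated derivatives *)

Definition der (a : cseq) : cseq := fun n => (INR (fact n) * a n)%C.

(** [der a] lists the derivatives at the centre and [pdern m a] is the Taylor
    series of the [m]-th derivative. *)
Fixpoint pdern (m : nat) (a : cseq) : cseq :=
  match m with O => a | S m => pder (pdern m a) end.

Lemma INR_fact_nz (n : nat) : RtoC (INR (fact n)) <> 0.
Proof. intros E. apply RtoC_inj in E. revert E. apply INR_fact_neq_0. Qed.

Lemma pdern_fact (m : nat) (a : cseq) (i : nat) :
  (INR (fact i) * pdern m a i)%C = der a (i + m)%nat.
Proof.
  revert i. induction m; intros i.
  - rewrite Nat.add_0_r. reflexivity.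
  - simpl pdern. unfold pder.
    replace (i + S m)%nat with (S i + m)%nat by lia. rewrite <- IHm.
    rewrite fact_simpl, mult_INR, RtoC_mult. ring.
Qed.

Lemma pdern_eq (m : nat) (a : cseq) (i : nat) :
  pdern m a i = (der a (i + m)%nat / INR (fact i))%C.
Proof. rewrite <- pdern_fact. field. apply INR_fact_nz. Qed.

Lemma cv_on_pdern (m : nat) (a : cseq) (r : R) : cv_on a r -> cv_on (pdern m a) r.
Proof. intros H. induction m; simpl; auto. apply cv_on_pder; auto. Qed.

Lemma is_derive_psum_at (a : cseq) (r : R) (p z : C) :
  cv_on a r -> Cmod (z - p)%C < r ->
  is_derive (fun w => psum a (w - p)%C) z (psum (pder a) (z - p)%C).
Proof.
  intros Ha Hz.
  replace (psum (pder a) (z - p)%C) with (1 * psum (pder a) (z - p))%C by ring.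
  apply (is_derive_comp (K := C_AbsRing) (V := C_NormedModule) (psum a) (fun w => w - p)%C).
  - apply is_derive_psum with r; auto.
  - apply is_derive_C_AbsRing.
    assert (X := is_derive_affine (- p) 1 z).
    apply (is_derive_ext (K := C_AbsRing) (V := C_NormedModule)) with (2 := X).
    intros t. change (- p + 1 * t = t - p)%C. ring.
Qed.

(** Naming the successive derivatives [f m] lets the coefficients be read off
    without iterating a derivative operator. *)
Lemma taylor_coefs (f : nat -> C -> C) (a : cseq) (p : C) (r : R) :
  0 < r -> cv_on a r ->
  (forall z, Cmod (z - p)%C < r -> f O z = psum a (z - p)%C) ->
  (forall m z, Cmod (z - p)%C < r -> is_derive (f m) z (f (S m) z)) ->
  forall m, der a m = f m p.
Proof.
  intros Hr Ha H0 Hd m.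
  assert (H : forall m z, Cmod (z - p)%C < r -> f m z = psum (pdern m a) (z - p)%C).
  { clear m. induction m; auto. intros z Hz.
    assert (D1 := is_derive_psum_at (pdern m a) r p z (cv_on_pdern m a r Ha) Hz).
    assert (D2 := Hd m z Hz).
    assert (D3 : is_derive (f m) z (psum (pder (pdern m a)) (z - p)%C)).
    { apply (is_derive_ext_loc (K := C_AbsRing) (V := C_NormedModule)) with (2 := D1).
      apply locally_C. apply locally_disc. exists (r - Cmod (z - p)%C). split; [lra|].
      intros y Hy. symmetry. apply IHm.
      assert (T := Cmod_sub_triangle y z p). lra. }
    rewrite <- (is_C_derive_unique _ _ _ D2), (is_C_derive_unique _ _ _ D3). reflexivity. }
  assert (Z : (p - p)%C = 0) by ring.
  rewrite (H m p), Z by (rewrite Z, Cmod_0; auto).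
  rewrite (psum_0 _ r) by auto using cv_on_pdern.
  change (der a m) with (der a (0 + m)%nat).
  rewrite <- (pdern_fact m a O). simpl. ring.
Qed.

Lemma der_recenter (a b : cseq) (r e : R) (h : C) :
  cv_on a r -> Cmod h < r -> 0 < e -> cv_on b e ->
  (forall w, Cmod w < e -> psum a (h + w)%C = psum b w) ->
  forall m, der b m = psum (pdern m a) h.
Proof.
  intros Ha Hh He Hb E m.
  set (e' := Rmin e (r - Cmod h)).
  assert (He' : 0 < e') by (apply Rmin_pos; lra).
  assert (M1 : e' <= e) by apply Rmin_l. assert (M2 : e' <= r - Cmod h) by apply Rmin_r.
  apply (taylor_coefs (fun m z => psum (pdern m a) z) b h e' He').
  - apply cv_on_le with e; auto.
  - intros z Hz. rewrite <- E by lra. simpl. f_equal. ring.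
  - intros k z Hz. apply is_derive_psum with r; auto using cv_on_pdern.
    replace z with ((z - h) + h)%C by ring.
    eapply Rle_lt_trans; [apply Cmod_triangle|]. lra.
Qed.

(** ** Power series in the exponential *)

(** The coefficients after [m] applications of [z d/dz], which is [d/dx] when
    [z = exp x]. *)
Definition theta (m : nat) (b : cseq) : cseq := fun n => (INR n ^ m * b n)%C.

Lemma cv_on_theta (m : nat) (b : cseq) (r : R) : cv_on b r -> cv_on (theta m b) r.
Proof.
  intros Hb. induction m.
  - intros rho Hr. destruct (Hb rho Hr) as [M HM]. exists M. intros n.
    unfold theta. simpl. rewrite Cmult_1_l. auto.
  - intros rho Hr. destruct (cv_on_pder _ _ IHm rho Hr) as [M HM].
    assert (M0 := cv_bound_nonneg _ _ _ HM).
    exists (M * rho). intros [|n].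
    + unfold theta. simpl. replace (0 * 0 ^ m * b 0%nat)%C with (RtoC 0) by ring.
      rewrite Cmod_0, Rmult_0_l. apply Rmult_le_pos; lra.
    + replace (theta (S m) b (S n)) with (pder (theta m b) n)
        by (unfold pder, theta; rewrite Cpow_S; ring).
      simpl pow. replace (Cmod (pder (theta m b) n) * (rho * rho ^ n))
        with (Cmod (pder (theta m b) n) * rho ^ n * rho) by ring.
      apply Rmult_le_compat_r; auto. lra.
Qed.

Lemma is_derive_exp_series (b : cseq) (r : R) (m : nat) (x : C) :
  cv_on b r -> Cmod (Cexp x) < r ->
  is_derive (fun x => psum (theta m b) (Cexp x)) x (psum (theta (S m) b) (Cexp x)).
Proof.
  intros Hb Hx.
  assert (Hm := cv_on_theta m b r Hb). assert (Hm' := cv_on_theta (S m) b r Hb).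
  replace (psum (theta (S m) b) (Cexp x))
    with (Cexp x * psum (pder (theta m b)) (Cexp x))%C.
  - apply (is_derive_comp (K := C_AbsRing) (V := C_NormedModule) (psum (theta m b)) Cexp).
    + apply is_derive_psum with r; auto.
    + apply is_derive_C_AbsRing, is_derive_Cexp.
  - rewrite (psum_shift (theta (S m) b) r) by auto.
    replace (theta (S m) b O) with (RtoC 0) by (unfold theta; simpl; ring).
    rewrite Cplus_0_l. f_equal. apply CSeries_ext. intros n. f_equal.
    unfold pder, theta. rewrite Cpow_S. ring.
Qed.

Lemma exp_series_taylor (b : cseq) (r : R) (x1 : C) :
  cv_on b r -> Cmod (Cexp x1) < r ->
  exists a e, 0 < e /\ cv_on a e /\
    (forall h, Cmod h < e -> Cmod (Cexp (x1 + h)) < r /\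
       psum a h = psum b (Cexp (x1 + h))) /\
    forall m, der a m = psum (theta m b) (Cexp x1).
Proof.
  intros Hb Hx.
  assert (Hc : continuous Cexp x1) by (eapply is_derive_continuous, is_derive_Cexp).
  destruct (proj1 (continuous_C_iff _ _) Hc (r - Cmod (Cexp x1))) as (e & He & W); [lra|].
  assert (B : forall z, Cmod (z - x1)%C < e -> Cmod (Cexp z) < r).
  { intros z Hz. specialize (W z Hz).
    replace (Cexp z) with ((Cexp z - Cexp x1) + Cexp x1)%C by ring.
    eapply Rle_lt_trans; [apply Cmod_triangle|]. lra. }
  destruct (hol_taylor (fun z => psum b (Cexp z)) x1 e He) as (a & Ha & Ea).
  { apply (hol_comp _ (fun w => Cmod (w - 0)%C < r) (psum b) Cexp).
    - apply hol_ext with (fun w => psum b (w - 0)%C); [intros; f_equal; ring|].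
      apply hol_psum; auto.
    - apply hol_Cexp, hol_id.
    - intros z Hz. replace (Cexp z - 0)%C with (Cexp z) by ring. auto. }
  exists a, e. split; auto. split; auto. split.
  - intros h Hh. assert (X : (x1 + h - x1)%C = h) by ring. split.
    + apply B. rewrite X. auto.
    + rewrite Ea, X; auto. rewrite X; auto.
  - intros m. apply (taylor_coefs (fun m x => psum (theta m b) (Cexp x)) a x1 e); auto.
    + intros z Hz. rewrite <- Ea by auto. apply CSeries_ext. intros n.
      unfold theta. simpl. ring.
    + intros k z Hz. apply is_derive_exp_series with r; auto.
Qed.

Lemma exp_series_taylor_entire (b : cseq) (x1 : C) :
  entire_seq b ->
  exists a, entire_seq a /\ (forall h, psum a h = psum b (Cexp (x1 + h))) /\
    forall m, der a m = psum (theta m b) (Cexp x1).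
Proof.
  intros Hb.
  destruct (entire_taylor (fun h => psum b (Cexp (x1 + h)))) as (a & Ha & Ea).
  { apply (hol_comp _ (fun _ => True) (psum b) (fun h => Cexp (x1 + h))); auto.
    - apply entire_psum; auto.
    - apply hol_Cexp, hol_plus; [apply hol_const|apply hol_id]. }
  destruct (exp_series_taylor b (Cmod (Cexp x1) + 1) x1 (Hb _)) as (a' & e & He & Ha' & Ea' & Ed);
    [lra|].
  assert (E : a = a').
  { apply (psum_unique_disc a a' e); auto. intros z Hz.
    rewrite <- Ea. symmetry. apply Ea'. auto. }
  subst a'. exists a. auto.
Qed.

(** * A Volterra equation for germs *)

Lemma Csum_split (f : nat -> C) (n m : nat) :
  Csum f (n + m) = (Csum f n + Csum (fun k => f (n + k)%nat) m)%C.
Proof.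
  induction m; [rewrite Nat.add_0_r; simpl; ring|].
  rewrite Nat.add_succ_r. simpl. rewrite IHm. ring.
Qed.

Lemma Csum_zero (f : nat -> C) (n : nat) :
  (forall k, (k < n)%nat -> f k = 0) -> Csum f n = 0.
Proof. intros H. induction n; simpl; auto. rewrite IHn, H; auto. ring. Qed.

Fixpoint Rsum (f : nat -> R) (n : nat) : R :=
  match n with O => 0 | S m => Rsum f m + f m end.

Lemma Cmod_Csum_le (f : nat -> C) (g : nat -> R) (n : nat) :
  (forall k, (k < n)%nat -> Cmod (f k) <= g k) -> Cmod (Csum f n) <= Rsum g n.
Proof.
  intros H. induction n; simpl; [rewrite Cmod_0; lra|].
  eapply Rle_trans; [apply Cmod_triangle|].
  apply Rplus_le_compat; auto.
Qed.

Lemma Rsum_scal (c : R) (f : nat -> R) (n : nat) :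
  Rsum (fun k => c * f k) n = c * Rsum f n.
Proof. induction n; simpl; [ring|]. rewrite IHn. ring. Qed.

Lemma Rsum_const (c : R) (n : nat) : Rsum (fun _ => c) n = INR n * c.
Proof.
  induction n as [|n IH]; [simpl; ring|].
  rewrite S_INR. cbn [Rsum]. rewrite IH. ring.
Qed.

Lemma Rsum_le_Series (f : nat -> R) (n : nat) :
  (forall k, 0 <= f k) -> ex_series f -> Rsum f n <= Series f.
Proof.
  intros H0 Hf.
  assert (E : forall n, Rsum f (S n) = sum_n f n).
  { clear n. induction n; [rewrite sum_O; simpl; ring|].
    rewrite sum_Sn, <- IHn. reflexivity. }
  assert (X : forall n, Rsum f (S n) <= Series f).
  { intros m. rewrite E. apply (is_lim_seq_incr_compare (sum_n f)).
    - exact (Series_correct _ Hf).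
    - intros k. rewrite sum_Sn. unfold plus; simpl. specialize (H0 (S k)). lra. }
  eapply Rle_trans; [|apply (X n)]. simpl. specialize (H0 n). lra.
Qed.

Lemma fact_mult_le (i j : nat) : INR (fact i) * INR (fact j) <= INR (fact (i + j)).
Proof.
  rewrite <- mult_INR. apply le_INR.
  induction j; [rewrite Nat.add_0_r; simpl; lia|].
  rewrite Nat.add_succ_r, !fact_simpl. nia.
Qed.

Lemma fact_add_le (n : nat) : forall a b, (a + b)%nat = n ->
  INR (fact n) <= 2 ^ n * (INR (fact a) * INR (fact b)).
Proof.
  induction n; intros a b Hab.
  - destruct a, b; try lia. simpl. lra.
  - assert (P : 0 <= 2 ^ n) by (apply pow_le; lra).
    destruct a as [|a]; [|destruct b as [|b]].
    + replace b with (S n) by lia. change (fact 0) with 1%nat.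
      assert (1 <= 2 ^ (S n)) by (apply pow_R1_Rle; lra).
      assert (0 <= INR (fact (S n))) by apply pos_INR. simpl (INR 1). nra.
    + replace (S a) with (S n) by lia. change (fact 0) with 1%nat.
      assert (1 <= 2 ^ (S n)) by (apply pow_R1_Rle; lra).
      assert (0 <= INR (fact (S n))) by apply pos_INR. simpl (INR 1). nra.
    + assert (H1 := IHn a (S b) ltac:(lia)). assert (H2 := IHn (S a) b ltac:(lia)).
      rewrite (fact_simpl n). replace (S n) with (S a + S b)%nat at 1 by lia.
      rewrite mult_INR, plus_INR.
      rewrite (fact_simpl a), (fact_simpl b) in *.
      rewrite mult_INR in *. rewrite !mult_INR in *. simpl pow.
      assert (A0 := pos_INR (S a)). assert (B0 := pos_INR (S b)).
      assert (X1 := Rmult_le_compat_l _ _ _ A0 H1).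
      assert (X2 := Rmult_le_compat_l _ _ _ B0 H2). nra.
Qed.

Lemma finite_bound (f : nat -> R) (n0 : nat) :
  exists A, 0 <= A /\ forall n, (n < n0)%nat -> f n <= A.
Proof.
  induction n0.
  - exists 0. split; [lra|]. intros; lia.
  - destruct IHn0 as (A & HA & H). exists (Rmax A (f n0)). split.
    + eapply Rle_trans; [apply HA|apply Rmax_l].
    + intros n Hn. destruct (Nat.eq_dec n n0) as [->|D]; [apply Rmax_r|].
      eapply Rle_trans; [apply H; lia|apply Rmax_l].
Qed.

(** When [k] is the Taylor series of an entire function at [0] and [a] that of a
    function [g] at some point, [conv (der k) (der a)] lists the derivatives there
    of [k 0 * g] plus the Volterra convolution of the derivative of [k] with [g].  The kernel is entire, so the equation can be
    solved on every disc on which the right hand side [p] is holomorphic: the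
    factor [1 / n] gained from the factorials makes the recursion for the
    coefficients of [a] contracting. *)
Lemma volterra_radius (k a p : cseq) (v : nat) (rho : R) :
  entire_seq k -> k v <> 0 -> (forall j, (j < v)%nat -> k j = 0) ->
  cv_on p rho -> (forall n, conv (der k) (der a) n = der p n) -> cv_on a rho.
Proof.
  intros Hk Hv Hlow Hp HE s Hs.
  set (kv := Cmod (der k v)).
  assert (Hkv : 0 < kv).
  { apply Cmod_gt_0. unfold der. apply Cmult_neq_0; auto. apply INR_fact_nz. }
  assert (Hmu : ex_series (fun i => Cmod (pdern (S v) k i) * s ^ i)).
  { apply cv_on_summable with (s + 1); [apply cv_on_pdern; auto|lra]. }
  set (Sm := Series (fun i => Cmod (pdern (S v) k i) * s ^ i)) in *.
  assert (Hmu0 : forall i, 0 <= Cmod (pdern (S v) k i) * s ^ i).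
  { intros i. apply Rmult_le_pos; [apply Cmod_ge_0|apply pow_le; lra]. }
  assert (S0 : 0 <= Sm) by (eapply Rle_trans; [|apply (Rsum_le_Series _ 0 Hmu0 Hmu)]; simpl; lra).
  destruct (cv_on_pdern v p rho Hp s Hs) as [Mq HMq].
  assert (Mq0 := cv_bound_nonneg _ _ _ HMq).
  assert (Eq : forall n, pdern v p n = (der k v * a n +
     Csum (fun i => pdern (S v) k i * ((INR (fact i) * INR (fact (n - 1 - i)) / INR (fact n))
        * a (n - 1 - i)%nat)) n)%C).
  { intros n. rewrite pdern_eq, <- HE. unfold conv.
    replace (S (n + v)) with (v + (1 + n))%nat by lia.
    rewrite Csum_split, Csum_split.
    rewrite (Csum_zero _ v).
    2:{ intros j Hj. unfold der. rewrite Hlow by auto. ring. }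
    cbn [Csum].
    replace (v + 0)%nat with v by lia. replace (n + v - v)%nat with n by lia.
    match goal with |- ((_ + (_ + ?t)) / _)%C = (_ + ?u)%C =>
      replace u with (/ INR (fact n) * t)%C end.
    - change (der a n) with (INR (fact n) * a n)%C. field. apply INR_fact_nz.
    - rewrite <- Csum_scal. apply Csum_ext. intros i Hi.
      replace (n + v - (v + (1 + i)))%nat with (n - 1 - i)%nat by lia.
      rewrite pdern_eq. replace (i + S v)%nat with (v + (1 + i))%nat by lia.
      change (der a (n - 1 - i)%nat) with (INR (fact (n - 1 - i)) * a (n - 1 - i)%nat)%C.
      field. split; apply INR_fact_nz. }
  assert (Bound : forall M' n, (1 <= n)%nat ->
    (forall j, (j < n)%nat -> Cmod (a j) * s ^ j <= M') ->
    kv * (Cmod (a n) * s ^ n) <= Mq + s / INR n * M' * Sm).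
  { intros M' n Hn HM.
    assert (N0 : 0 < INR n) by (apply lt_0_INR; lia).
    assert (Sn : 0 <= s ^ n) by (apply pow_le; lra).
    assert (M'0 : 0 <= M').
    { eapply Rle_trans; [|apply (HM O); lia]. simpl. rewrite Rmult_1_r. apply Cmod_ge_0. }
    set (T := Csum (fun i => pdern (S v) k i * ((INR (fact i) * INR (fact (n - 1 - i)) / INR (fact n))
        * a (n - 1 - i)%nat))%C n) in *.
    assert (HT : Cmod T * s ^ n <= s / INR n * M' * Sm).
    { apply Rle_trans with (Rsum (fun i => s / INR n * M' * (Cmod (pdern (S v) k i) * s ^ i)) n).
      2:{ rewrite Rsum_scal. apply Rmult_le_compat_l; [|apply Rsum_le_Series; auto].
          apply Rmult_le_pos; auto. apply Rmult_le_pos; [lra|].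
          left; apply Rinv_0_lt_compat; auto. }
      rewrite <- (Rabs_pos_eq (s ^ n)) by auto. rewrite <- Cmod_R, <- Cmod_mult.
      unfold T. rewrite Cmult_comm, <- Csum_scal.
      apply Cmod_Csum_le. intros i Hi.
      rewrite !Cmod_mult, Cmod_div by apply INR_fact_nz.
      rewrite Cmod_mult, !Cmod_R, !(Rabs_pos_eq (INR _)) by apply pos_INR.
      rewrite (Rabs_pos_eq (s ^ n)) by auto.
      assert (HMi := HM (n - 1 - i)%nat ltac:(lia)).
      replace (s ^ n) with (s ^ i * (s * s ^ (n - 1 - i)))
        by (change (s * s ^ (n - 1 - i)) with (s ^ S (n - 1 - i)); rewrite <- pow_add; f_equal; lia).
      assert (F : INR (fact i) * INR (fact (n - 1 - i)) / INR (fact n) <= / INR n).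
      { assert (X := fact_mult_le i (n - 1 - i)).
        replace (i + (n - 1 - i))%nat with (n - 1)%nat in X by lia.
        destruct n as [|m]; [lia|]. rewrite fact_simpl, mult_INR.
        replace (S m - 1)%nat with m in * by lia.
        assert (Fm : 0 < INR (fact m)) by apply INR_fact_lt_0.
        apply Rmult_le_reg_r with (INR (S m) * INR (fact m)); [apply Rmult_lt_0_compat; auto|].
        replace (INR (fact i) * INR (fact (m - i)) / (INR (S m) * INR (fact m)) * (INR (S m) * INR (fact m)))
          with (INR (fact i) * INR (fact (m - i))) by (field; lra).
        replace (/ INR (S m) * (INR (S m) * INR (fact m))) with (INR (fact m)) by (field; lra).
        auto. }
      assert (F0 : 0 <= INR (fact i) * INR (fact (n - 1 - i)) / INR (fact n)).
      { apply Rmult_le_pos; [apply Rmult_le_pos; apply pos_INR|].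
        left; apply Rinv_0_lt_compat, INR_fact_lt_0. }
      apply Rle_trans with (Cmod (pdern (S v) k i) * s ^ i * s *
        ((INR (fact i) * INR (fact (n - 1 - i)) / INR (fact n)) *
         (Cmod (a (n - 1 - i)%nat) * s ^ (n - 1 - i)))); [right; ring|].
      apply Rle_trans with (Cmod (pdern (S v) k i) * s ^ i * s * (/ INR n * M')); [|right; unfold Rdiv; ring].
      apply Rmult_le_compat_l; [apply Rmult_le_pos; auto; lra|].
      apply Rmult_le_compat; auto.
      apply Rmult_le_pos; [apply Cmod_ge_0|apply pow_le; lra]. }
    assert (E1 : (der k v * a n)%C = (pdern v p n - T)%C) by (rewrite Eq; fold T; ring).
    assert (E2 : kv * Cmod (a n) <= Cmod (pdern v p n) + Cmod T).
    { unfold kv. rewrite <- Cmod_mult, E1. unfold Cminus.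
      eapply Rle_trans; [apply Cmod_triangle|]. rewrite Cmod_opp. lra. }
    specialize (HMq n). nra. }
  assert (X : exists n0, (1 <= n0)%nat /\ forall n, (n0 <= n)%nat -> s / INR n * Sm <= kv / 2).
  { destruct (INR_unbounded (2 * s * Sm / kv)) as [m Hm].
    exists (S m). split; [lia|]. intros n Hn.
    assert (N0 : 0 < INR n) by (apply lt_0_INR; lia).
    assert (Nm : INR m <= INR n) by (apply le_INR; lia).
    apply Rmult_le_reg_r with (2 * INR n); [lra|].
    replace (s / INR n * Sm * (2 * INR n)) with (2 * s * Sm / kv * kv) by (field; lra).
    replace (kv / 2 * (2 * INR n)) with (INR n * kv) by field.
    apply Rmult_le_compat_r; lra. }
  (* From [n0] on, the earlier coefficients contribute at most half of the bound;
     the finitely many others are absorbed in [A0]. *)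
  destruct X as (n0 & Hn0 & Hsmall).
  destruct (finite_bound (fun n => Cmod (a n) * s ^ n) n0) as (A0 & HA0 & HA).
  exists (A0 + 2 * Mq / kv).
  assert (Q0 : 0 <= Mq / kv) by (apply Rmult_le_pos; auto; left; apply Rinv_0_lt_compat; auto).
  intros n. induction n as [n IH] using (well_founded_induction Wf_nat.lt_wf).
  destruct (Nat.lt_ge_cases n n0) as [L|L].
  - specialize (HA n L). simpl in HA. replace (2 * Mq / kv) with (2 * (Mq / kv)) by (unfold Rdiv; ring). lra.
  - assert (B := Bound (A0 + 2 * Mq / kv) n ltac:(lia) IH).
    assert (Sml := Hsmall n L).
    set (M' := A0 + 2 * Mq / kv) in *.
    assert (EM : M' = A0 + 2 * (Mq / kv)) by (unfold M', Rdiv; ring).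
    assert (B2 : s / INR n * M' * Sm <= kv / 2 * M').
    { replace (s / INR n * M' * Sm) with (s / INR n * Sm * M') by ring.
      apply Rmult_le_compat_r; lra. }
    apply Rmult_le_reg_l with kv; auto.
    apply Rle_trans with (Mq + kv / 2 * M'); [lra|].
    rewrite EM. replace Mq with (kv * (Mq / kv)) at 1 by (field; lra). nra.
Qed.

Lemma summable_Csum (c : nat -> C) (f : nat -> nat -> C) (n : nat) :
  (forall j, summable (f j)) -> summable (fun i => Csum (fun j => c j * f j i)%C n).
Proof.
  intros H. induction n.
  - simpl. apply summable_ext with (fun i => 0 * f O i)%C; [intros; ring|].
    apply summable_scal; auto.
  - simpl. apply summable_plus; auto using summable_scal.
Qed.

Lemma CSeries_Csum (c : nat -> C) (f : nat -> nat -> C) (n : nat) :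
  (forall j, summable (f j)) ->
  CSeries (fun i => Csum (fun j => c j * f j i)%C n) = Csum (fun j => c j * CSeries (f j))%C n.
Proof.
  intros H. induction n.
  - simpl. rewrite (CSeries_ext _ (fun i => 0 * f O i)%C) by (intros; ring).
    rewrite CSeries_scal by auto. ring.
  - simpl. rewrite CSeries_plus; auto using summable_scal, summable_Csum.
    rewrite IHn, CSeries_scal; auto.
Qed.

(** Moving the base point of the Volterra convolution from [0] to [h] changes
    it by the integral over the segment [[0, h]], which is entire; in
    coefficients this is the part of the Cauchy product that the recentred
    product misses. *)
Lemma volterra_recenter (k a b q : cseq) (r e : R) (h : C) :
  entire_seq k -> cv_on a r -> cv_on q r -> Cmod h < r -> 0 < e -> cv_on b e ->
  (forall w, Cmod w < e -> psum a (h + w)%C = psum b w) ->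
  (forall n, conv (der k) (der a) n = der q n) ->
  exists d, entire_seq d /\
    forall m, conv (der k) (der b) m = (psum (pdern m q) h + der d m)%C.
Proof.
  intros Hk Ha Hq Hh He Hb Eb HE.
  assert (h0 := Cmod_ge_0 h).
  assert (Db := der_recenter a b r e h Ha Hh He Hb Eb).
  set (miss := fun m i => (h ^ i / INR (fact i) *
     Csum (fun l => der k (m + (1 + l))%nat * der a (i - 1 - l)%nat) i)%C).
  assert (Sa : forall m, summable (fun i => pdern m a i * h ^ i)%C).
  { intros m. apply psum_summable with r; auto using cv_on_pdern. }
  (* The product of [k] and [a] at index [i + m] splits at [j = m]: the first part
     recentres to the product of [k] and [b], the rest is [miss]. *)
  assert (Split : forall m i, (pdern m q i * h ^ i)%C =
     (Csum (fun j => der k j * (pdern (m - j) a i * h ^ i)) (S m) + miss m i)%C).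
  { intros m i. rewrite pdern_eq, <- HE. unfold conv, miss.
    replace (S (i + m)) with (S m + i)%nat by lia. rewrite Csum_split.
    unfold Cdiv. rewrite !Cmult_plus_distr_r. f_equal.
    - rewrite (Cmult_comm (Csum _ _)), Cmult_comm, <- !Csum_scal. apply Csum_ext. intros j Hj.
      rewrite pdern_eq. replace (i + m - j)%nat with (i + (m - j))%nat by lia.
      unfold Cdiv. ring.
    - rewrite (Cmult_comm (Csum _ _)), Cmult_comm, Cmult_assoc. f_equal.
      apply Csum_ext. intros l Hl.
      replace (m + (1 + l))%nat with (S m + l)%nat by lia.
      replace (i + m - (S m + l))%nat with (i - 1 - l)%nat by lia. reflexivity. }
  assert (Sq : forall m, summable (fun i => pdern m q i * h ^ i)%C).
  { intros m. apply psum_summable with r; auto using cv_on_pdern. }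
  assert (Sfin : forall m, summable (fun i => Csum (fun j => der k j * (pdern (m - j) a i * h ^ i))%C (S m))).
  { intros m. apply (summable_Csum (der k) (fun j i => pdern (m - j) a i * h ^ i)%C). auto. }
  assert (Smiss : forall m, summable (miss m)).
  { intros m. apply summable_ext with
      (fun i => pdern m q i * h ^ i + (-(1)) * Csum (fun j => der k j * (pdern (m - j) a i * h ^ i)) (S m))%C.
    - intros i. rewrite Split. ring.
    - apply summable_plus; auto. apply summable_scal. auto. }
  assert (Main : forall m, psum (pdern m q) h = (conv (der k) (der b) m + CSeries (miss m))%C).
  { intros m. unfold psum. rewrite (CSeries_ext _ _ (Split m)).
    rewrite CSeries_plus by auto. f_equal.
    rewrite (CSeries_Csum (der k) (fun j i => pdern (m - j) a i * h ^ i)%C) by auto.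
    unfold conv. apply Csum_ext. intros j Hj. rewrite Db. reflexivity. }
  exists (fun m => (- CSeries (miss m) / INR (fact m))%C). split.
  2:{ intros m. rewrite Main.
      replace (der (fun m => (- CSeries (miss m) / INR (fact m))%C) m)
        with (- CSeries (miss m))%C; [ring|].
      unfold der. field. apply INR_fact_nz. }
  (* A common ratio for the coefficients of [a] and of the kernel at [h]. *)
  set (s := (Cmod h + r) / 2).
  destruct (Ha s) as [A HA]; [unfold s; lra|].
  assert (A0 := cv_bound_nonneg _ _ _ HA).
  set (th := Rmax (Cmod h / s) (1 / 2)).
  assert (s0 : 0 < s) by (unfold s; lra).
  assert (Hth : 1 / 2 <= th < 1).
  { split; [apply Rmax_r|]. apply Rmax_lub_lt; [|lra].
    apply Rdiv_lt_one; auto. unfold s; lra. }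
  assert (HAt : forall n, Cmod (a n) * Cmod h ^ n <= A * th ^ n).
  { intros n. specialize (HA n).
    assert (Hq1 : Cmod h / s <= th) by apply Rmax_l.
    assert (Hq0 : 0 <= Cmod h / s) by (apply Rmult_le_pos; auto; left; apply Rinv_0_lt_compat; auto).
    replace (Cmod h ^ n) with (s ^ n * (Cmod h / s) ^ n)
      by (rewrite <- Rpow_mult_distr; f_equal; field; lra).
    rewrite <- Rmult_assoc. apply Rmult_le_compat; auto.
    - apply Rmult_le_pos; [apply Cmod_ge_0|apply pow_le; lra].
    - apply pow_le; auto.
    - apply pow_incr; auto. }
  assert (Hgeo : ex_series (fun i => INR (S i) * th ^ i)).
  { apply (ex_series_ext (fun i => Cmod (pder geom1 i) * th ^ i)).
    - intros i. unfold pder, geom1. rewrite Cmult_1_r, Cmod_R, Rabs_pos_eq; auto. apply pos_INR.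
    - apply cv_on_summable with 1; [apply cv_on_pder, cv_on_geom1|lra]. }
  set (Th := Series (fun i => INR (S i) * th ^ i)) in *.
  intros R1 R HR.
  set (R' := R + Cmod h + 1).
  (* The factor 4: a binomial coefficient costs a factor 2 in
     the ratio, and the other factor 2 leaves the ratio 1/2 for [l]. *)
  destruct (Hk (4 * R' + 1) (4 * R')) as [Ck HCk]; [unfold R'; lra|].
  assert (R'1 : 1 <= R') by (unfold R'; lra).
  assert (Ck0 := cv_bound_nonneg _ _ _ HCk).
  exists (Ck * (A * Cmod h * Th)). intros m.
  set (Cm := INR (fact (S m)) * Ck / (2 * R') ^ S m).
  assert (P2 : 0 < (2 * R') ^ S m) by (apply pow_lt; lra).
  assert (Fm := INR_fact_lt_0 m). assert (FSm := INR_fact_lt_0 (S m)).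
  assert (Cm0 : 0 <= Cm).
  { apply Rmult_le_pos; [apply Rmult_le_pos; lra|left; apply Rinv_0_lt_compat; auto]. }
  assert (Kb : forall l, Cmod (pdern (S m) k l) * Cmod h ^ l <= Cm * th ^ l).
  { intros l. rewrite pdern_eq, Cmod_div by apply INR_fact_nz.
    unfold der. rewrite Cmod_mult, !Cmod_R, !(Rabs_pos_eq (INR _)) by apply pos_INR.
    assert (Fl := INR_fact_lt_0 l).
    set (n := (l + S m)%nat).
    assert (F := fact_add_le n l (S m) eq_refl).
    assert (HC := HCk n).
    assert (Pn : 0 < (2 * R') ^ n) by (apply pow_lt; lra).
    assert (K1 : Cmod (k n) <= Ck / (4 * R') ^ n).
    { assert (0 < (4 * R') ^ n) by (apply pow_lt; lra).
      apply Rmult_le_reg_r with ((4 * R') ^ n); auto.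
      unfold Rdiv. rewrite Rmult_assoc, Rinv_l; lra. }
    apply Rle_trans with (2 ^ n * (INR (fact l) * INR (fact (S m))) * (Ck / (4 * R') ^ n)
       / INR (fact l) * Cmod h ^ l).
    - apply Rmult_le_compat_r; [apply pow_le; auto|].
      apply Rmult_le_compat_r; [left; apply Rinv_0_lt_compat; auto|].
      apply Rmult_le_compat; auto using pos_INR, Cmod_ge_0.
    - replace ((4 * R') ^ n) with (2 ^ n * (2 * R') ^ n)
        by (rewrite <- Rpow_mult_distr; f_equal; ring).
      replace ((2 * R') ^ n) with ((2 * R') ^ S m * (2 * R') ^ l)
        by (unfold n; rewrite <- pow_add; f_equal; lia).
      assert (Pl : 0 < (2 * R') ^ l) by (apply pow_lt; lra).
      assert (P2n : 0 < 2 ^ n) by (apply pow_lt; lra).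
      apply Rle_trans with (Cm * (Cmod h / (2 * R')) ^ l).
      + right. unfold Cm, Rdiv. rewrite (Rpow_mult_distr (Cmod h)), pow_inv. field.
        repeat split; lra.
      + apply Rmult_le_compat_l; auto. apply pow_incr. split.
        * apply Rmult_le_pos; auto. left; apply Rinv_0_lt_compat; lra.
        * apply Rle_trans with (1 / 2); [|lra].
          apply Rmult_le_reg_r with (2 * R'); [lra|].
          unfold Rdiv. rewrite Rmult_assoc, Rinv_l by lra. unfold R'. lra. }
  assert (Dm : Cmod (CSeries (miss m)) <= Cm * (A * Cmod h * Th)).
  { assert (Sm1 := proj1 (summable_incr_1 (miss m)) (Smiss m)).
    rewrite (CSeries_incr_1 _ (Smiss m)).
    replace (miss m O) with (RtoC 0) by (unfold miss; simpl; ring).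
    rewrite Cplus_0_l.
    replace (Cm * (A * Cmod h * Th)) with ((Cm * A * Cmod h) * Th) by ring.
    unfold Th. rewrite <- Series_scal_l. apply Cmod_CSeries_le.
    2:{ apply (ex_series_scal (Cm * A * Cmod h) _ Hgeo). }
    intros i. unfold miss. rewrite <- Csum_scal.
    replace (Cm * A * Cmod h * (INR (S i) * th ^ i))
      with (Rsum (fun _ => Cm * A * Cmod h * th ^ i) (S i))
      by (rewrite Rsum_const; ring).
    apply Cmod_Csum_le. intros l Hl.
    replace (S i - 1 - l)%nat with (i - l)%nat by lia.
    replace (h ^ S i / INR (fact (S i)) * (der k (m + (1 + l))%nat * der a (i - l)%nat))%C
      with (RtoC (INR (fact l) * INR (fact (i - l)) / INR (fact (S i)))
         * (h * ((pdern (S m) k l * h ^ l) * (a (i - l)%nat * h ^ (i - l)))))%C.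
    2:{ rewrite pdern_eq. replace (l + S m)%nat with (m + (1 + l))%nat by lia.
        replace (h ^ S i)%C with (h * (h ^ l * h ^ (i - l)))%C
          by (rewrite Cpow_S, <- Cpow_add_r; do 2 f_equal; lia).
        rewrite RtoC_div, RtoC_mult by apply INR_fact_neq_0.
        unfold der at 3. field. split; apply INR_fact_nz. }
    rewrite Cmod_mult, Cmod_R.
    assert (Fi := INR_fact_lt_0 (S i)).
    assert (F1 : 0 <= INR (fact l) * INR (fact (i - l)) / INR (fact (S i)) <= 1).
    { split.
      - apply Rmult_le_pos; [apply Rmult_le_pos; apply pos_INR|left; apply Rinv_0_lt_compat; auto].
      - apply Rmult_le_reg_r with (INR (fact (S i))); auto.
        unfold Rdiv. rewrite Rmult_assoc, Rinv_l, Rmult_1_r, Rmult_1_l by lra.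
        eapply Rle_trans; [apply fact_mult_le|]. replace (l + (i - l))%nat with i by lia.
        apply le_INR. apply fact_le. lia. }
    rewrite Rabs_pos_eq by lra.
    rewrite !Cmod_mult, !Cmod_pow.
    assert (K1 := Kb l). assert (K2 := HAt (i - l)%nat).
    assert (N1 : 0 <= Cmod (pdern (S m) k l) * Cmod h ^ l)
      by (apply Rmult_le_pos; [apply Cmod_ge_0|apply pow_le; auto]).
    assert (N2 : 0 <= Cmod (a (i - l)%nat) * Cmod h ^ (i - l))
      by (apply Rmult_le_pos; [apply Cmod_ge_0|apply pow_le; auto]).
    assert (K3 := Rmult_le_compat _ _ _ _ N1 N2 K1 K2).
    replace (Cm * th ^ l * (A * th ^ (i - l))) with (Cm * A * th ^ i) in K3.
    2:{ replace (th ^ i) with (th ^ l * th ^ (i - l)) by (rewrite <- pow_add; f_equal; lia). ring. }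
    assert (K4 := Rmult_le_compat_l _ _ _ h0 K3).
    assert (N3 := Rmult_le_pos _ _ h0 (Rmult_le_pos _ _ N1 N2)).
    nra. }
  unfold Cdiv. rewrite Cmod_mult, Cmod_opp, Cmod_inv, Cmod_R by apply INR_fact_nz.
  rewrite (Rabs_pos_eq (INR (fact m))) by apply pos_INR.
  assert (Rm : 0 <= R ^ m) by (apply pow_le; lra).
  assert (Th0 : 0 <= A * Cmod h * Th).
  { apply Rmult_le_pos; [apply Rmult_le_pos; auto|].
    eapply Rle_trans; [|apply (Rsum_le_Series (fun i => INR (S i) * th ^ i) 0)]; auto.
    - simpl; lra.
    - intros i. apply Rmult_le_pos; [apply pos_INR|apply pow_le; lra]. }
  apply Rle_trans with (Cm * (A * Cmod h * Th) * / INR (fact m) * R ^ m).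
  - apply Rmult_le_compat_r; auto. apply Rmult_le_compat_r; auto.
    left; apply Rinv_0_lt_compat; auto.
  - replace (Cm * (A * Cmod h * Th) * / INR (fact m) * R ^ m)
      with ((Cm / INR (fact m) * R ^ m) * (A * Cmod h * Th)) by (unfold Rdiv; ring).
    apply Rmult_le_compat_r; auto.
    unfold Cm. rewrite fact_simpl, mult_INR.
    apply Rle_trans with (Ck * (INR (S m) * R ^ m / (2 * R') ^ S m)).
    { right. field. split; lra. }
    rewrite <- (Rmult_1_r Ck) at 2. apply Rmult_le_compat_l; auto.
    apply Rmult_le_reg_r with ((2 * R') ^ S m); auto.
    unfold Rdiv. rewrite Rmult_assoc, Rinv_l, Rmult_1_l, Rmult_1_r by lra.
    rewrite Rpow_mult_distr.
    assert (I2 : INR (S m) <= 2 ^ S m).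
    { clear. induction m; [simpl; lra|]. rewrite S_INR. simpl pow in *.
      assert (1 <= 2 ^ m) by (apply pow_R1_Rle; lra). lra. }
    apply Rmult_le_compat; auto using pos_INR.
    apply Rle_trans with (R' ^ m).
    + apply pow_incr. unfold R'. lra.
    + simpl. assert (0 <= R' ^ m) by (apply pow_le; lra). nra.
Qed.

(** ** Germs that satisfy the equation with right hand side [1 / (1 - exp x)] *)

(** [P] is the Taylor series of [1 / (1 - exp x)] at [x1]; the product form avoids
    a division. *)
Definition pole_taylor_at (x1 : C) (P : cseq) : Prop :=
  exists r, 0 < r /\ cv_on P r /\
    forall h, Cmod h < r -> (psum P h * (1 - Cexp (x1 + h)))%C = 1.

Lemma pole_taylor_radius (x1 : C) (P : cseq) (rho : R) :
  pole_taylor_at x1 P -> 0 < rho -> (forall h, Cmod h < rho -> Cexp (x1 + h) <> 1) ->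
  cv_on P rho /\
  forall h, Cmod h < rho -> (psum P h * (1 - Cexp (x1 + h)))%C = 1.
Proof.
  intros (r & Hr & HP & EP) Hrho Hne.
  assert (N : forall h, Cmod h < rho -> (1 - Cexp (x1 + h))%C <> 0).
  { intros h Hh E. apply (Hne h Hh). symmetry. apply Ceq_minus. exact E. }
  destruct (hol_taylor (fun h => / (1 - Cexp (x1 + h)))%C 0 rho Hrho) as (a & Ha & Ea).
  { apply hol_inv.
    - apply hol_minus; [apply hol_const|]. apply hol_Cexp, hol_plus; [apply hol_const|apply hol_id].
    - intros z Hz. apply N. replace (z - 0)%C with z in Hz by ring. auto. }
  assert (Ea' : forall h, Cmod h < rho -> (/ (1 - Cexp (x1 + h)))%C = psum a h).
  { intros h Hh. assert (X : (h - 0)%C = h) by ring.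
    rewrite (Ea h); rewrite X; auto. }
  assert (E : P = a).
  { assert (M1 := Rmin_l r rho). assert (M2 := Rmin_r r rho).
    apply (psum_unique_disc P a (Rmin r rho)); [apply Rmin_pos; auto| | |].
    - apply cv_on_le with r; auto.
    - apply cv_on_le with rho; auto.
    - intros h Hh. rewrite <- Ea' by lra.
      assert (Nh := N h ltac:(lra)). assert (Eh := EP h ltac:(lra)).
      replace (psum P h) with (psum P h * (1 - Cexp (x1 + h)) / (1 - Cexp (x1 + h)))%C
        by (field; auto).
      rewrite Eh. field. auto. }
  subst a. split; auto. intros h Hh. rewrite <- Ea' by auto. field. auto.
Qed.

(** The germ [a] at [x1] solves, up to an entire function, the Volterra
    equation with kernel [k].  Working modulo entire functions makes the
    condition independent of the base point of the convolution. *)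
Definition volterra_germ (k : cseq) (x1 : C) (a : cseq) : Prop :=
  convergent a /\
  exists P e, pole_taylor_at x1 P /\ entire_seq e /\
    forall n, conv (der k) (der a) n = der (fun n => P n + 1 * e n)%C n.

Lemma least_nat (P : nat -> Prop) :
  (exists j, P j) -> exists v, P v /\ forall j, (j < v)%nat -> ~ P j.
Proof.
  intros [j Hj]. revert Hj.
  induction j as [j IH] using (well_founded_induction Wf_nat.lt_wf). intros Hj.
  destruct (classic (exists i, (i < j)%nat /\ P i)) as [(i & Hi & HPi)|N].
  - apply (IH i); auto.
  - exists j. split; auto. intros i Hi HPi. apply N. exists i. auto.
Qed.

Lemma volterra_germ_radius (k : cseq) (x1 : C) (a : cseq) (rho : R) :
  entire_seq k -> (exists j, k j <> 0) -> volterra_germ k x1 a -> 0 < rho ->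
  (forall h, Cmod h < rho -> Cexp (x1 + h) <> 1) -> cv_on a rho.
Proof.
  intros Hk Hj (_ & P & e & HP & He & HE) Hrho Hne.
  destruct (least_nat _ Hj) as (v & Hv & Hlow).
  destruct (pole_taylor_radius x1 P rho HP Hrho Hne) as [CP _].
  apply (volterra_radius k a (fun n => P n + 1 * e n)%C v rho); auto.
  - intros j Hjv. apply NNPP. apply Hlow. auto.
  - apply cv_on_lin; auto.
Qed.

Lemma der_lin (a b : cseq) (c : C) (n : nat) :
  der (fun n => a n + c * b n)%C n = (der a n + c * der b n)%C.
Proof. unfold der. ring. Qed.

Lemma entire_lin (a b : cseq) (c : C) :
  entire_seq a -> entire_seq b -> entire_seq (fun n => a n + c * b n)%C.
Proof. intros Ha Hb r. apply cv_on_lin; auto. Qed.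

(** The right hand side is recentred term by term; the defect of the convolution
    is entire and joins [e]. *)
Lemma volterra_germ_recenter (k : cseq) (x1 : C) (a b : cseq) (rho eps : R) (h : C) :
  entire_seq k -> (exists j, k j <> 0) -> volterra_germ k x1 a -> 
  (forall h, Cmod h < rho -> Cexp (x1 + h) <> 1) -> Cmod h < rho ->
  0 < eps -> cv_on b eps ->
  (forall w, Cmod w < eps -> psum a (h + w)%C = psum b w) ->
  volterra_germ k (x1 + h)%C b.
Proof.
  intros Hk Hj Hgood Hne Hh Heps Hb Eb.
  assert (Hrho : 0 < rho) by (generalize (Cmod_ge_0 h); lra).
  assert (Ha := volterra_germ_radius k x1 a rho Hk Hj Hgood Hrho Hne).
  destruct Hgood as (_ & P & e & HP & He & HE).
  destruct (pole_taylor_radius x1 P rho HP Hrho Hne) as [CP EP].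
  assert (Hq : cv_on (fun n => P n + 1 * e n)%C rho) by (apply cv_on_lin; auto).
  destruct (volterra_recenter k a b _ rho eps h Hk Ha Hq Hh Heps Hb Eb HE) as (d & Hd & Ed).
  destruct (psum_recenter P rho h CP Hh) as (P' & HP' & EP').
  destruct (entire_taylor (fun w => psum e (h + w)%C)) as (e' & He' & Ee').
  { apply hol_ext with (fun w => psum e (w + h)%C); [intros; f_equal; ring|].
    apply entire_shift, entire_psum; auto. }
  split; [apply convergent_cv_on; exists eps; auto|].
  exists P', (fun n => e' n + 1 * d n)%C. split; [|split].
  - exists (rho - Cmod h). split; [lra|]. split; auto. intros w Hw.
    rewrite <- EP' by auto. replace (x1 + h + w)%C with (x1 + (h + w))%C by ring.
    apply EP. eapply Rle_lt_trans; [apply Cmod_triangle|]. lra.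
  - apply entire_lin; auto.
  - intros n. rewrite Ed.
    rewrite <- (der_recenter _ (fun n => P' n + 1 * e' n)%C rho (rho - Cmod h) h Hq Hh);
      [rewrite !der_lin; ring|lra|apply cv_on_lin; auto|].
    intros w Hw.
    rewrite (psum_lin P e 1 rho), (psum_lin P' e' 1 (rho - Cmod h)); auto.
    + rewrite EP', Ee' by auto. reflexivity.
    + eapply Rle_lt_trans; [apply Cmod_triangle|]. lra.
Qed.

(** ** The kernel attached to the singularity of [F] *)

(** The primitive of [- K], with [c] as constant of integration: its derivatives
    at [0] are [c], [- K 0], [- K' 0], ... as the Volterra equation requires. *)
Definition kernel (c : C) (K : cseq) : cseq :=
  fun n => match n with O => c | S j => (- (K j / INR (S j)))%C end.

Lemma entire_kernel (c : C) (K : cseq) : entire_seq K -> entire_seq (kernel c K).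
Proof.
  intros HK r rho Hrho. destruct (HK r rho Hrho) as [M HM].
  assert (M0 := cv_bound_nonneg _ _ _ HM).
  exists (Cmod c + M * rho). intros [|j].
  - simpl. assert (0 <= M * rho) by (apply Rmult_le_pos; lra). lra.
  - unfold kernel. specialize (HM j).
    assert (N1 : 1 <= INR (S j)) by (rewrite S_INR; generalize (pos_INR j); lra).
    assert (Nz := INR_S_nz j).
    rewrite Cmod_opp, Cmod_div, Cmod_R, Rabs_pos_eq by (auto; lra).
    assert (X : Cmod (K j) / INR (S j) <= Cmod (K j)).
    { apply Rmult_le_reg_r with (INR (S j)); [lra|].
      unfold Rdiv. rewrite Rmult_assoc, Rinv_l by lra.
      generalize (Cmod_ge_0 (K j)). nra. }
    assert (P : 0 <= rho ^ S j) by (apply pow_le; lra).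
    apply Rle_trans with (Cmod (K j) * rho ^ S j); [apply Rmult_le_compat_r; auto|].
    simpl. assert (0 <= Cmod c) by apply Cmod_ge_0. nra.
Qed.

Lemma der_kernel_S (c : C) (K : cseq) (j : nat) : der (kernel c K) (S j) = (- der K j)%C.
Proof.
  unfold der, kernel. rewrite fact_simpl, mult_INR, RtoC_mult. field.
  apply INR_S_nz.
Qed.

(** A vanishing kernel would leave only rapidly decreasing coefficients, whose
    inverses cannot be the coefficients of a convergent series. *)
Lemma kernel_nontrivial (c : C) (w rem beta K : cseq) :
  entire_seq w -> entire_seq rem -> convergent beta ->
  (forall h, psum K h = psum w (Cexp (0 + h))) ->
  (forall n, ((c - Csum (fun k => w k / INR (n - k)) n + rem n) * beta n)%C = 1) ->
  exists j, kernel c K j <> 0.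
Proof.
  intros Hw Hrem Hb EK HE. apply NNPP. intros N.
  assert (Z : forall j, kernel c K j = 0).
  { intros j. apply NNPP. intros F. apply N. exists j. exact F. }
  assert (Zc : c = 0) by apply (Z O).
  assert (ZK : forall j, K j = 0).
  { intros j. specialize (Z (S j)). unfold kernel in Z.
    assert (Nz := INR_S_nz j).
    replace (K j) with (- (- (K j / INR (S j))) * INR (S j))%C by (field; auto).
    rewrite Z. ring. }
  assert (Zw : forall k, w k = 0).
  { intros k. apply (psum_zero_real k w 1); [lra|auto|].
    intros x Hx. destruct (Cexp_surj x) as [y Hy].
    - intros E. apply RtoC_inj in E. lra.
    - rewrite <- Hy. replace y with (0 + y)%C by ring. rewrite <- EK.
      rewrite psum_const; auto. }
  assert (Hone : forall n, (rem n * beta n)%C = 1).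
  { intros n. rewrite <- (HE n). rewrite Csum_zero.
    - rewrite Zc. ring.
    - intros k _. rewrite Zw. unfold Cdiv. ring. }
  apply convergent_cv_on in Hb. destruct Hb as (r & Hr & Hb).
  destruct (Hb (r / 2)) as [M HM]; [lra|].
  assert (R2 : 0 < 4 / r) by (apply Rdiv_lt_0_compat; lra).
  destruct (Hrem (4 / r + 1) (4 / r)) as [M' HM']; [lra|].
  assert (X : forall n, 2 ^ n <= M * M').
  { intros n. assert (H1 := HM n). assert (H2 := HM' n).
    replace (2 ^ n) with ((Cmod (beta n) * (r / 2) ^ n) * (Cmod (rem n) * (4 / r) ^ n)).
    - apply Rmult_le_compat; auto; apply Rmult_le_pos; try apply Cmod_ge_0; apply pow_le; lra.
    - replace 2 with ((r / 2) * (4 / r)) at 2 by (field; lra).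
      rewrite Rpow_mult_distr.
      replace (Cmod (beta n) * (r / 2) ^ n * (Cmod (rem n) * (4 / r) ^ n))
        with (Cmod (rem n) * Cmod (beta n) * ((r / 2) ^ n * (4 / r) ^ n)) by ring.
      rewrite <- Cmod_mult, Hone, Cmod_1. ring. }
  destruct (Pow_x_infinity 2 ltac:(rewrite Rabs_pos_eq; lra) (M * M' + 1)) as [n Hn].
  specialize (Hn n (le_n n)). rewrite Rabs_pos_eq in Hn by (apply pow_le; lra).
  specialize (X n). lra.
Qed.

Lemma geometric_difference (n k : C) (m : nat) :
  ((n - k) * Csum (fun j => n ^ (m - 1 - j) * k ^ j) m)%C = (n ^ m - k ^ m)%C.
Proof.
  induction m; [simpl; ring|].
  cbn [Csum]. replace (S m - 1 - m)%nat with 0%nat by lia.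
  replace (Csum (fun j => n ^ (S m - 1 - j) * k ^ j) m)%C
    with (n * Csum (fun j => n ^ (m - 1 - j) * k ^ j) m)%C.
  - rewrite Cmult_plus_distr_l.
    replace ((n - k) * (n * Csum (fun j => n ^ (m - 1 - j) * k ^ j) m))%C
      with (n * ((n - k) * Csum (fun j => n ^ (m - 1 - j) * k ^ j) m))%C by ring.
    rewrite IHm, !Cpow_S. simpl. ring.
  - rewrite <- Csum_scal. apply Csum_ext. intros j Hj.
    replace (S m - 1 - j)%nat with (S (m - 1 - j)) by lia. rewrite Cpow_S. ring.
Qed.

Lemma CSeries_finite (f : nat -> C) (n : nat) :
  (forall k, (n <= k)%nat -> f k = 0) -> summable f /\ CSeries f = Csum f n.
Proof.
  revert f. induction n; intros f H.
  - assert (Z : forall k, f k = 0) by (intros; apply H; lia).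
    assert (S0 : summable (fun _ : nat => RtoC 0)).
    { apply summable_le with (fun n => 0 ^ n); [|apply ex_series_geom_le; lra].
      intros k. rewrite Cmod_0. apply pow_le. lra. }
    split.
    + apply summable_ext with (fun _ => RtoC 0); auto.
    + rewrite (CSeries_ext _ (fun k => 0 * 0)%C) by (intros; rewrite Z; ring).
      rewrite CSeries_scal by auto. simpl. ring.
  - destruct (IHn (fun k => f (S k))) as [S1 E1]; [intros; apply H; lia|].
    assert (Sf : summable f) by (apply summable_incr_1; auto).
    split; auto. rewrite (CSeries_incr_1 f Sf), E1.
    replace (S n) with (1 + n)%nat by lia. rewrite Csum_split. simpl. ring.
Qed.

(** The defect between the sum [sum_(k < n) w k / (n - k)] and the truncated
    moments of [w].  The identity [n^m - k^m = (n - k) (...)] removes the terms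
    that grow with [n], so the bound is uniform in [n]. *)
Lemma moment_defect_bound (w : cseq) (rho : R) :
  entire_seq w -> 0 < rho ->
  exists V, 0 <= V /\ forall m n,
    Cmod (INR n ^ m * Csum (fun k => w k / INR (n - k)) n
          - Csum (fun j => INR n ^ (m - 1 - j) * psum (theta j w) 1) m)%C
    <= INR (S m) * INR (fact m) / rho ^ m * V.
Proof.
  intros Hw Hrho.
  assert (Hex : ex_series (fun k => Cmod (w k) * exp rho ^ k)).
  { apply cv_on_summable with (exp rho + 1); auto. generalize (exp_pos rho). lra. }
  exists (exp rho * Series (fun k => Cmod (w k) * exp rho ^ k)). split.
  { apply Rmult_le_pos; [left; apply exp_pos|].
    eapply Rle_trans; [|apply (Rsum_le_Series (fun k => Cmod (w k) * exp rho ^ k) 0)]; auto.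
    - simpl; lra.
    - intros k. apply Rmult_le_pos; [apply Cmod_ge_0|apply pow_le; left; apply exp_pos]. }
  intros m n.
  set (f := fun j k => (w k * INR k ^ j)%C).
  assert (Sf : forall j, summable (f j)).
  { intros j. apply summable_ext with (fun k => theta j w k * 1 ^ k)%C.
    - intros k. unfold theta, f. rewrite Cpow_1_l. ring.
    - apply psum_summable with 2; [apply cv_on_theta; auto|rewrite Cmod_1; lra]. }
  assert (EK : forall j, psum (theta j w) 1 = CSeries (f j)).
  { intros j. apply CSeries_ext. intros k. unfold theta, f. rewrite Cpow_1_l. ring. }
  set (t := fun k => if (k <? n)%nat then (INR n ^ m * (w k / INR (n - k)))%C else RtoC 0).
  destruct (CSeries_finite t n) as [St Et].
  { intros k Hk. unfold t. rewrite (proj2 (Nat.ltb_ge k n) Hk). reflexivity. }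
  assert (E1 : (INR n ^ m * Csum (fun k => w k / INR (n - k)) n)%C = CSeries t).
  { rewrite Et, <- Csum_scal. apply Csum_ext. intros k Hk. unfold t.
    rewrite (proj2 (Nat.ltb_lt k n) Hk). reflexivity. }
  set (g := fun k => Csum (fun j => INR n ^ (m - 1 - j) * f j k)%C m).
  assert (E2 : Csum (fun j => INR n ^ (m - 1 - j) * psum (theta j w) 1)%C m = CSeries g).
  { unfold g. rewrite (CSeries_Csum (fun j => INR n ^ (m - 1 - j))%C f m Sf).
    apply Csum_ext. intros j _. rewrite EK. reflexivity. }
  assert (Sg : summable g) by (apply (summable_Csum (fun j => INR n ^ (m - 1 - j))%C f m Sf)).
  rewrite E1, E2, <- CSeries_minus by auto.
  replace (INR (S m) * INR (fact m) / rho ^ m * (exp rho * Series (fun k => Cmod (w k) * exp rho ^ k)))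
    with ((INR (S m) * INR (fact m) / rho ^ m * exp rho) * Series (fun k => Cmod (w k) * exp rho ^ k)) by ring.
  rewrite <- Series_scal_l. apply Cmod_CSeries_le.
  2:{ apply (ex_series_scal (INR (S m) * INR (fact m) / rho ^ m * exp rho) _ Hex). }
  intros k.
  assert (Eg : g k = (w k * Csum (fun j => INR n ^ (m - 1 - j) * INR k ^ j) m)%C).
  { unfold g, f. rewrite <- Csum_scal. apply Csum_ext. intros; ring. }
  assert (K0 := pos_INR k). assert (N0 := pos_INR n).
  assert (P1 : 1 <= (INR k + 1) ^ m) by (apply pow_R1_Rle; lra).
  assert (U : Cmod (t k - g k)%C <= Cmod (w k) * (INR (S m) * (INR k + 1) ^ m)).
  { rewrite S_INR. assert (M0 := pos_INR m). rewrite Eg. unfold t.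
    destruct (Nat.ltb_spec k n) as [L|L].
    - assert (Nk : 1 <= INR (n - k)).
      { change 1 with (INR 1). apply le_INR. lia. }
      assert (Nz : RtoC (INR (n - k)) <> 0) by (intros E; apply RtoC_inj in E; lra).
      assert (D : RtoC (INR (n - k)) = (INR n - INR k)%C)
        by (rewrite minus_INR, RtoC_minus by lia; reflexivity).
      replace (INR n ^ m * (w k / INR (n - k)) -
         w k * Csum (fun j => INR n ^ (m - 1 - j) * INR k ^ j) m)%C
        with (w k * (INR k ^ m / INR (n - k)))%C.
      2:{ assert (GD := geometric_difference (INR n) (INR k) m). rewrite <- D in GD.
          replace (INR n ^ m)%C with (INR k ^ m + INR (n - k) *
            Csum (fun j => INR n ^ (m - 1 - j) * INR k ^ j) m)%C by (rewrite GD; ring).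
          field. auto. }
      rewrite Cmod_mult. apply Rmult_le_compat_l; [apply Cmod_ge_0|].
      rewrite Cmod_div, Cmod_pow, !Cmod_R, !Rabs_pos_eq by (auto; lra).
      apply Rle_trans with (INR k ^ m).
      + apply Rmult_le_reg_r with (INR (n - k)); [lra|].
        unfold Rdiv. rewrite Rmult_assoc, Rinv_l by lra.
        assert (0 <= INR k ^ m) by (apply pow_le; auto). nra.
      + apply Rle_trans with ((INR k + 1) ^ m); [apply pow_incr; lra|]. nra.
    - replace (0 - w k * Csum (fun j => INR n ^ (m - 1 - j) * INR k ^ j) m)%C
        with (- (w k * Csum (fun j => INR n ^ (m - 1 - j) * INR k ^ j) m))%C by ring.
      rewrite Cmod_opp, Cmod_mult. apply Rmult_le_compat_l; [apply Cmod_ge_0|].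
      apply Rle_trans with (Rsum (fun _ => (INR k + 1) ^ m) m).
      + apply Cmod_Csum_le. intros j Hj.
        rewrite Cmod_mult, !Cmod_pow, !Cmod_R, !Rabs_pos_eq by auto.
        apply le_INR in L.
        apply Rle_trans with ((INR k + 1) ^ (m - 1 - j) * (INR k + 1) ^ j).
        * apply Rmult_le_compat; try (apply pow_le; auto); apply pow_incr; lra.
        * rewrite <- pow_add. apply Rle_pow; [lra|lia].
      + rewrite Rsum_const. nra. }
  eapply Rle_trans; [apply U|].
  (* One term of the exponential series of [rho * (k + 1)]. *)
  assert (Ex : (INR k + 1) ^ m <= INR (fact m) / rho ^ m * (exp rho * exp rho ^ k)).
  { assert (Rm : 0 < rho ^ m) by (apply pow_lt; auto).
    assert (Fm := INR_fact_lt_0 m).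
    assert (T : (rho * (INR k + 1)) ^ m / INR (fact m) <= exp (rho * (INR k + 1))).
    { eapply Rle_trans; [|apply (exp_ge_taylor (rho * (INR k + 1)) m); nra].
      destruct m as [|m']; [simpl; lra|]. rewrite tech5.
      assert (0 <= sum_f_R0 (fun k0 => (rho * (INR k + 1)) ^ k0 / INR (fact k0)) m'); [|lra].
      apply cond_pos_sum. intros i. apply Rmult_le_pos; [apply pow_le; nra|].
      left; apply Rinv_0_lt_compat, INR_fact_lt_0. }
    rewrite Rpow_mult_distr in T.
    replace (exp (rho * (INR k + 1))) with (exp rho * exp rho ^ k) in T.
    - apply Rmult_le_reg_l with (rho ^ m / INR (fact m)); [apply Rdiv_lt_0_compat; auto|].
      replace (rho ^ m / INR (fact m) * (INR (fact m) / rho ^ m * (exp rho * exp rho ^ k)))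
        with (exp rho * exp rho ^ k) by (field; lra).
      unfold Rdiv in *. lra.
    - replace (rho * (INR k + 1)) with (rho + INR k * rho) by ring. rewrite exp_plus. f_equal.
      clear. induction k; [simpl; rewrite Rmult_0_l, exp_0; auto|].
      rewrite S_INR, Rmult_plus_distr_r, exp_plus, <- IHk, Rmult_1_l. simpl. ring. }
  replace (INR (S m) * INR (fact m) / rho ^ m * exp rho * (Cmod (w k) * exp rho ^ k))
    with (Cmod (w k) * (INR (S m) * (INR (fact m) / rho ^ m * (exp rho * exp rho ^ k))))
    by (unfold Rdiv; ring).
  apply Rmult_le_compat_l; [apply Cmod_ge_0|].
  apply Rmult_le_compat_l; [apply pos_INR|]. auto.
Qed.

Lemma entire_mult_coefs (rem beta : cseq) (r : R) :
  entire_seq rem -> 0 < r -> cv_on beta r -> entire_seq (fun n => rem n * beta n)%C.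
Proof.
  intros Hrem Hr Hb R1 R HR.
  destruct (Hb (r / 2)) as [M HM]; [lra|].
  assert (P0 : 0 <= R / (r / 2)) by (apply Rmult_le_pos; [lra|left; apply Rinv_0_lt_compat; lra]).
  destruct (Hrem (R / (r / 2) + 1) (R / (r / 2))) as [M' HM']; [lra|].
  exists (M * M'). intros n. specialize (HM n). specialize (HM' n).
  replace (R ^ n) with ((r / 2) ^ n * (R / (r / 2)) ^ n)
    by (rewrite <- Rpow_mult_distr; f_equal; field; lra).
  rewrite Cmod_mult.
  replace (Cmod (rem n) * Cmod (beta n) * ((r / 2) ^ n * (R / (r / 2)) ^ n))
    with (Cmod (beta n) * (r / 2) ^ n * (Cmod (rem n) * (R / (r / 2)) ^ n)) by ring.
  apply Rmult_le_compat; auto; apply Rmult_le_pos; try apply Cmod_ge_0; apply pow_le; lra.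
Qed.

(** The relation between the coefficients of [F] and [G] becomes the Volterra
    equation for [x |-> G (exp x / omega)]. *)
Lemma volterra_germ_start (c : C) (w rem beta K : cseq) (r : R) (x1 : C) :
  entire_seq w -> entire_seq rem -> cv_on beta r ->
  Cmod (Cexp x1) < r -> Cmod (Cexp x1) < 1 ->
  (forall m, der K m = psum (theta m w) 1) ->
  (forall n, ((c - Csum (fun k => w k / INR (n - k)) n + rem n) * beta n)%C = 1) ->
  exists a e, 0 < e /\ cv_on a e /\
    (forall h, Cmod h < e -> psum a h = psum beta (Cexp (x1 + h))) /\
    volterra_germ (kernel c K) x1 a.
Proof.
  intros Hw Hrem Hb Hx Hx1 HK HE. set (X := Cexp x1) in *.
  assert (X0 := Cmod_ge_0 X).
  destruct (exp_series_taylor beta r x1 Hb Hx) as (a & ea & Hea & Ha & Ea & Da).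
  destruct (exp_series_taylor geom1 1 x1 cv_on_geom1 Hx1) as (P & eP & HeP & HP & EP & DP).
  assert (Hrb : entire_seq (fun n => rem n * beta n)%C)
    by (apply entire_mult_coefs with r; auto; lra).
  destruct (exp_series_taylor_entire _ x1 Hrb) as (qe & Hqe & _ & Dq).
  exists a, ea. split; auto. split; auto. split; [intros h Hh; apply Ea; auto|].
  split; [apply convergent_cv_on; exists ea; auto|].
  set (Kj := fun j => psum (theta j w) 1).
  set (tau := fun m n => (INR n ^ m * Csum (fun k => w k / INR (n - k)) n
          - Csum (fun j => INR n ^ (m - 1 - j) * Kj j) m)%C).
  set (y := fun n => (beta n * X ^ n)%C).
  assert (Sy : summable y) by (apply psum_summable with r; auto).
  set (Y := fun m n => (theta m beta n * X ^ n)%C).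
  assert (SY : forall m, summable (Y m))
    by (intros m; apply psum_summable with r; auto using cv_on_theta).
  assert (EY : forall m n, Y m n = (INR n ^ m * y n)%C).
  { intros m n. unfold Y, theta, y. ring. }
  set (G1 := fun m n => (theta m geom1 n * X ^ n)%C).
  assert (SG : forall m, summable (G1 m)).
  { intros m. apply psum_summable with 1; auto. apply cv_on_theta, cv_on_geom1. }
  set (Q := fun m n => (theta m (fun n => rem n * beta n) n * X ^ n)%C).
  assert (SQ : forall m, summable (Q m)).
  { intros m. apply psum_summable with (Cmod X + 1); [apply cv_on_theta; auto|lra]. }
  set (Z := fun m n => Csum (fun j => (- Kj j) * Y (m - 1 - j)%nat n)%C m).
  assert (SZ : forall m, summable (Z m)).
  { intros m. apply (summable_Csum (fun j => (- Kj j)%C) (fun j => Y (m - 1 - j)%nat)). auto. }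
  assert (Econv : forall m, conv (der (kernel c K)) (der a) m
     = (c * CSeries (Y m) + CSeries (Z m))%C).
  { intros m. unfold conv. replace (S m) with (1 + m)%nat by lia. rewrite Csum_split.
    f_equal.
    - simpl Csum. rewrite Nat.sub_0_r, Da. fold X. unfold der, kernel, psum. simpl. fold (Y m). ring.
    - unfold Z. rewrite (CSeries_Csum (fun j => (- Kj j)%C) (fun j => Y (m - 1 - j)%nat)) by auto.
      apply Csum_ext. intros j Hj. change (1 + j)%nat with (S j). rewrite der_kernel_S, HK, Da.
      replace (m - S j)%nat with (m - 1 - j)%nat by lia. reflexivity. }
  (* The coefficient relation, multiplied by [n ^ m * X ^ n] and solved for the
     left hand side of the equation. *)
  assert (Pt : forall m n, (c * Y m n + Z m n)%C = (G1 m n + (-(1)) * Q m n + y n * tau m n)%C).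
  { intros m n.
    assert (EZ : Z m n = (- y n * Csum (fun j => INR n ^ (m - 1 - j) * Kj j) m)%C).
    { unfold Z. rewrite <- Csum_scal. apply Csum_ext. intros j _. rewrite EY. ring. }
    assert (EG : G1 m n = (INR n ^ m * X ^ n * ((c - Csum (fun k => w k / INR (n - k)) n + rem n) * beta n))%C).
    { rewrite HE. unfold G1, theta, geom1. ring. }
    rewrite EZ, EG, EY. unfold Q, theta, tau, y. ring. }
  assert (Sl : forall m, summable (fun n => c * Y m n + Z m n)%C)
    by (intros m; apply summable_plus; auto using summable_scal).
  assert (St : forall m, summable (fun n => y n * tau m n)%C).
  { intros m. apply summable_ext with
      (fun n => (c * Y m n + Z m n) + (-(1)) * (G1 m n + (-(1)) * Q m n))%C.
    - intros n. rewrite Pt. ring.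
    - apply summable_plus; auto. apply summable_scal. apply summable_plus; auto using summable_scal. }
  set (e1 := fun m => (CSeries (fun n => y n * tau m n) / INR (fact m))%C).
  exists P, (fun n => e1 n + (-(1)) * qe n)%C. split; [|split].
  - exists eP. split; auto. split; auto. intros h Hh. destruct (EP h Hh) as [H1 H2].
    rewrite H2, psum_geom1 by auto. field. apply one_minus_nz. auto.
  - apply entire_lin; auto. intros R1 rho Hrho.
    destruct (moment_defect_bound w (2 * rho + 1) Hw) as (V & V0 & HV); [lra|].
    exists (Series (fun n => Cmod (y n)) * V). intros m.
    assert (B : Cmod (CSeries (fun n => y n * tau m n)%C)
      <= (INR (S m) * INR (fact m) / (2 * rho + 1) ^ m * V) * Series (fun n => Cmod (y n))).
    { rewrite <- Series_scal_l. apply Cmod_CSeries_le.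
      - intros n. rewrite Cmod_mult, Rmult_comm. apply Rmult_le_compat_r; [apply Cmod_ge_0|].
        apply HV.
      - apply (ex_series_scal (INR (S m) * INR (fact m) / (2 * rho + 1) ^ m * V) _ Sy). }
    assert (Fm := INR_fact_lt_0 m).
    assert (Y0 : 0 <= Series (fun n => Cmod (y n))).
    { eapply Rle_trans; [|apply (Rsum_le_Series (fun n => Cmod (y n)) 0)]; auto.
      - simpl; lra.
      - intros; apply Cmod_ge_0. }
    unfold e1. rewrite Cmod_div, Cmod_R, Rabs_pos_eq by (try apply INR_fact_nz; lra).
    assert (Rm : 0 <= rho ^ m) by (apply pow_le; lra).
    assert (R2 : 0 < (2 * rho + 1) ^ m) by (apply pow_lt; lra).
    apply Rle_trans with ((INR (S m) * INR (fact m) / (2 * rho + 1) ^ m * V) * Series (fun n => Cmod (y n))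
       / INR (fact m) * rho ^ m).
    + apply Rmult_le_compat_r; auto. apply Rmult_le_compat_r; auto.
      left; apply Rinv_0_lt_compat; auto.
    + replace (INR (S m) * INR (fact m) / (2 * rho + 1) ^ m * V * Series (fun n => Cmod (y n)) / INR (fact m) * rho ^ m)
        with ((INR (S m) * rho ^ m / (2 * rho + 1) ^ m) * (Series (fun n => Cmod (y n)) * V))
        by (field; lra).
      rewrite <- (Rmult_1_l (Series (fun n => Cmod (y n)) * V)) at 2.
      apply Rmult_le_compat_r; [apply Rmult_le_pos; auto|].
      apply Rmult_le_reg_r with ((2 * rho + 1) ^ m); auto.
      unfold Rdiv. rewrite Rmult_assoc, Rinv_l, Rmult_1_l, Rmult_1_r by lra.
      assert (I2 : INR (S m) <= 2 ^ m).
      { clear. induction m; [simpl; lra|]. rewrite S_INR. simpl pow.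
        assert (1 <= 2 ^ m) by (apply pow_R1_Rle; lra). lra. }
      apply Rle_trans with (2 ^ m * rho ^ m); [apply Rmult_le_compat_r; auto|].
      rewrite <- Rpow_mult_distr. apply pow_incr. lra.
  - intros m. rewrite der_lin, der_lin, DP, Dq, Econv.
    fold X. change (psum (theta m geom1) X) with (CSeries (G1 m)).
    change (psum (theta m (fun n => rem n * beta n)%C) X) with (CSeries (Q m)).
    rewrite <- CSeries_scal, <- CSeries_plus by auto using summable_scal.
    rewrite (CSeries_ext _ _ (Pt m)).
    rewrite CSeries_plus, CSeries_plus, CSeries_scal; auto using summable_scal, summable_plus.
    replace (der e1 m) with (CSeries (fun n => y n * tau m n)%C); [ring|].
    unfold der, e1. field. apply INR_fact_nz.
Qed.

(** * Continuation along paths from a local extension property *)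

(** If membership in [Q] bounds the radius of convergence from below, locally
    uniformly on the open set [U], and passes to nearby expansions, then a germ
    in [Q] can be continued along every path of [U]. *)
Lemma continuation_of_invariant (U : C -> Prop) (Q : C -> cseq -> Prop)
    (f b0 : cseq) (gamma : R -> C) :
  (forall p, U p -> exists d, 0 < d /\ forall p', Cmod (p' - p)%C < d ->
     forall b, Q p' b -> cv_on b d /\
       forall p'' b'', Cmod (p'' - p')%C < d -> induces p' b p'' b'' -> Q p'' b'') ->
  is_path gamma -> (forall t, I01 t -> U (gamma t)) ->
  induces 0 f (gamma 0) b0 -> Q (gamma 0) b0 ->
  continuable_along f gamma.
Proof.
  intros Hloc Hg HU Hst HQ0.
  assert (I0 : I01 0) by (unfold I01; lra).
  set (ok := fun (A : R -> cseq) (t : R) =>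
    A 0 = b0 /\ forall s, I01 s -> s <= t ->
      Q (gamma s) (A s) /\ convergent (A s) /\
      exists d, 0 < d /\ forall u, I01 u -> u <= t -> Rabs (u - s) < d ->
        induces (gamma s) (A s) (gamma u) (A u)).
  assert (Hcv : forall p b, U p -> Q p b -> convergent b).
  { intros p b Hp Hb. destruct (Hloc p Hp) as (d & Hd & H).
    destruct (H p) with (b := b) as [X _]; auto.
    - replace (p - p)%C with (RtoC 0) by ring. rewrite Cmod_0; auto.
    - apply convergent_cv_on. exists d. auto. }
  destruct (I01_locally_constant (fun t => exists A, ok A t)) with (t := 1) as [A HA].
  - intros t Ht. destruct (Hloc _ (HU t Ht)) as (d & Hd & H).
    destruct (continuous_on_I01_eps gamma t (d / 16) Hg Ht) as (eta & Heta & W); [lra|].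
    assert (Step : forall s s', I01 s -> I01 s' -> Rabs (s - t) < eta -> Rabs (s' - t) < eta ->
      (exists A, ok A s) -> exists A, ok A s').
    { intros s s' Hs Hs' Hst1 Hst2 (A & HA0 & HA).
      destruct (Rle_dec s' s) as [L|L].
      { exists A. split; auto. intros u Hu Hus.
        destruct (HA u Hu ltac:(lra)) as (q1 & q2 & e & He & q3).
        split; auto. split; auto. exists e. split; auto. intros v Hv Hvs. apply q3; auto. lra. }
      assert (Hss : s < s') by lra.
      assert (Dist : forall u, I01 u -> s <= u <= s' -> Cmod (gamma u - gamma s)%C < d / 8).
      { intros u Hu Hus.
        apply Rabs_def2 in Hst1. apply Rabs_def2 in Hst2.
        assert (W1 := W u Hu ltac:(apply Rabs_def1; lra)).
        assert (W2 := W s Hs ltac:(apply Rabs_def1; lra)).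
        rewrite Cmod_sub_comm in W2.
        assert (T := Cmod_sub_triangle (gamma u) (gamma t) (gamma s)). lra. }
      destruct (HA s Hs (Rle_refl s)) as (Qs & Cs & _).
      destruct (H (gamma s)) with (b := A s) as [CVs Hext]; auto.
      { assert (W2 := W s Hs Hst1). lra. }
      set (B := fun u => epsilon (inhabits b0) (fun b => induces (gamma s) (A s) (gamma u) b)).
      assert (HB : forall u, I01 u -> s <= u <= s' -> induces (gamma s) (A s) (gamma u) (B u)).
      { intros u Hu Hus. apply epsilon_spec. apply induces_exists with d; auto.
        assert (X := Dist u Hu Hus). lra. }
      (* Beyond [s] the continuation is given by expansions of the single germ
         [A s], whose disc covers the rest of the path. *)
      set (A' := fun u => if Rle_dec u s then A u else B u).
      assert (EL : forall u, u <= s -> A' u = A u).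
      { intros u Hu. unfold A'. destruct (Rle_dec u s); [auto|lra]. }
      assert (EB : forall u, s <= u -> I01 u -> u <= s' -> A' u = B u).
      { intros u Hu Iu Hus. unfold A'. destruct (Rle_dec u s) as [L'|L']; auto.
        assert (u = s) by lra. subst u.
        apply (induces_unique (gamma s) (A s) (gamma s)); [apply induces_refl; auto|].
        apply HB; auto. }
      exists A'. split; [rewrite EL; auto; apply Hs|].
      intros u Hu Hus. destruct (Rle_dec u s) as [L'|L'].
      - rewrite EL by auto. destruct (HA u Hu L') as (q1 & q2 & e & He & q3).
        split; auto. split; auto.
        destruct (Req_dec u s) as [->|Ne].
        + exists e. split; auto. intros v Hv Hvs Hvu.
          destruct (Rle_dec v s) as [L2|L2].
          * rewrite EL by auto. apply q3; auto.
          * rewrite EB by (auto; lra). apply HB; auto. lra.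
        + exists (Rmin e (s - u)). split; [apply Rmin_pos; lra|].
          intros v Hv Hvs Hvu.
          assert (V1 := Rlt_le_trans _ _ _ Hvu (Rmin_l _ _)).
          assert (V2 := Rlt_le_trans _ _ _ Hvu (Rmin_r _ _)).
          apply Rabs_def2 in V2. rewrite EL by lra. apply q3; auto. lra.
      - rewrite EB by (auto; lra).
        assert (IB := HB u Hu ltac:(lra)). assert (Du := Dist u Hu ltac:(lra)).
        split; [apply (Hext (gamma u)); auto; lra|].
        destruct (induces_spec (gamma s) (A s) (gamma u) (B u) d CVs ltac:(lra) IB) as [CB _].
        split; [apply convergent_cv_on; exists (d - Cmod (gamma u - gamma s)%C); split; auto; lra|].
        exists (u - s). split; [lra|]. intros v Hv Hvs Hvu. apply Rabs_def2 in Hvu.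
        rewrite EB by (auto; lra).
        assert (Dv := Dist v Hv ltac:(lra)).
        apply (induces_trans (gamma u) (B u) (gamma s) (A s) (gamma v) (B v)
          (d - Cmod (gamma u - gamma s)%C)); auto.
        + rewrite (Cmod_sub_comm (gamma s)). lra.
        + apply induces_sym with d; auto. lra.
        + apply HB; auto. lra. }
    exists eta. split; auto. intros s Hs Hst'.
    assert (Rabs (t - t) < eta) by (rewrite Rminus_diag, Rabs_R0; auto).
    split; apply Step; auto.
  - exists (fun _ => b0). split; auto. intros s Hs Hs0.
    assert (s = 0) by (unfold I01 in Hs; lra). subst s.
    assert (Cb : convergent b0) by (apply (Hcv (gamma 0)); auto).
    split; auto. split; auto. exists 1. split; [lra|]. intros u Hu Hu0 _.
    assert (u = 0) by (unfold I01 in Hu; lra). subst u. apply induces_refl; auto.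
  - unfold I01; lra.
  - destruct HA as [HA0 HA]. exists A. split; [rewrite HA0; auto|].
    intros t Ht. destruct (HA t Ht (proj2 Ht)) as (_ & q2 & e & He & q3).
    split; auto. exists (mkposreal e He). intros u Hu Iu. apply q3; auto. apply Iu.
Qed.

(** * Back to the plane of [G] *)

(** [volterra_germ] transported by [zeta = exp x / omega]. *)
Definition volterra_germ_at (k : cseq) (omega p : C) (b : cseq) : Prop :=
  exists x1 a r, Cexp x1 = (omega * p)%C /\ volterra_germ k x1 a /\ 0 < r /\ cv_on b r /\
    forall z, Cmod (z - p)%C < r -> psum b (z - p)%C = psum a (Clog1m (1 - z / p)%C).

Lemma Cmod_one_minus_div (z p : C) (e : R) :
  p <> 0 -> Cmod (z - p)%C < e * Cmod p -> Cmod (1 - z / p)%C < e.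
Proof.
  intros Hp H. assert (P0 : 0 < Cmod p) by (apply Cmod_gt_0; auto).
  replace (1 - z / p)%C with (- ((z - p) / p))%C by (field; auto).
  rewrite Cmod_opp, Cmod_div by auto. apply Rmult_lt_reg_r with (Cmod p); auto.
  replace (Cmod (z - p)%C / Cmod p * Cmod p) with (Cmod (z - p)%C) by (field; lra). auto.
Qed.

Lemma hol_log_ratio (p : C) (V : C -> Prop) :
  p <> 0 -> (forall z, V z -> Cmod (1 - z / p)%C < 1) ->
  hol V (fun z => Clog1m (1 - z / p)%C).
Proof.
  intros Hp HV. apply hol_Clog1m; auto.
  apply hol_minus; [apply hol_const|]. unfold Cdiv.
  apply hol_mult; [apply hol_id|apply hol_const].
Qed.

(** The logarithm carries the disc around [p] into a disc on which the right hand
    side is holomorphic, so the germ [a] converges there and composition gives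
    the radius of [b].  For the new centre, [a] is recentred at the logarithm of
    [p' / p]. *)
Lemma volterra_germ_at_step (k : cseq) (omega p : C) (b : cseq) (rho delta : R) :
  entire_seq k -> (exists j, k j <> 0) -> omega <> 0 -> p <> 0 ->
  volterra_germ_at k omega p b -> 0 < rho -> 0 < delta ->
  (forall x1 h, Cexp x1 = (omega * p)%C -> Cmod h < rho -> Cexp (x1 + h) <> 1) ->
  (forall z, Cmod (z - p)%C < delta ->
     Cmod (1 - z / p)%C < 1 /\ Cmod (Clog1m (1 - z / p)%C) < rho) ->
  cv_on b delta /\
  forall p' b', Cmod (p' - p)%C < delta -> induces p b p' b' -> volterra_germ_at k omega p' b'.
Proof.
  intros Hk Hj Ho Hp (x1 & a & r & Ex & Hgood & Hr & Hb & Eb) Hrho Hdelta Hne Hlog.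
  assert (P0 : 0 < Cmod p) by (apply Cmod_gt_0; auto).
  assert (Hne1 : forall h, Cmod h < rho -> Cexp (x1 + h) <> 1) by (intros; auto).
  assert (Ha := volterra_germ_radius k x1 a rho Hk Hj Hgood Hrho Hne1).
  set (f := fun z => psum a (Clog1m (1 - z / p)%C)).
  assert (Hf : hol (fun z => Cmod (z - p)%C < delta) f).
  { apply (hol_comp _ (fun w => Cmod (w - 0)%C < rho) (psum a)).
    - apply hol_ext with (fun w => psum a (w - 0)%C); [intros; f_equal; ring|].
      apply hol_psum; auto.
    - apply hol_log_ratio; auto. intros z Hz. apply (Hlog z Hz).
    - intros z Hz.
      replace (Clog1m (1 - z / p) - 0)%C with (Clog1m (1 - z / p)) by ring.
      apply (Hlog z Hz). }
  destruct (hol_taylor f p delta Hdelta Hf) as (b0 & Hb0 & Eb0).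
  assert (E : b = b0).
  { assert (M1 := Rmin_l r delta). assert (M2 := Rmin_r r delta).
    apply (psum_unique_disc b b0 (Rmin r delta)); [apply Rmin_pos; auto| | |].
    - apply cv_on_le with r; auto.
    - apply cv_on_le with delta; auto.
    - intros w Hw. specialize (Eb (p + w)%C). specialize (Eb0 (p + w)%C).
      replace (p + w - p)%C with w in Eb, Eb0 by ring.
      rewrite Eb by lra. rewrite <- Eb0 by lra. reflexivity. }
  subst b0. split; auto.
  intros p' b' Hp' Hind.
  destruct (induces_spec p b p' b' delta Hb0 Hp' Hind) as [Hb' Eb'].
  set (h := Clog1m (1 - p' / p)%C).
  destruct (Hlog p' Hp') as [Hl1 Hh]. fold h in Hh.
  assert (Eh : Cexp h = (p' / p)%C) by (unfold h; rewrite Cexp_Clog1m by auto; ring).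
  assert (Hp'0 : p' <> 0).
  { intros Z. apply (Cexp_nz h). rewrite Eh, Z. unfold Cdiv. ring. }
  assert (P'0 : 0 < Cmod p') by (apply Cmod_gt_0; auto).
  destruct (psum_recenter a rho h Ha Hh) as (a' & Ha' & Ea').
  assert (Hgood' : volterra_germ k (x1 + h)%C a').
  { apply (volterra_germ_recenter k x1 a a' rho (rho - Cmod h) h); auto. lra. }
  destruct Cexp_near_0 as (d0 & Hd0 & Inj & _).
  destruct (Clog1m_small (rho - Cmod h)) as (e1 & He1 & Sm1); [lra|].
  (* The two logarithms agree at [p'] and have the same exponential, hence agree
     as long as their difference stays small. *)
  set (D := fun z => (Clog1m (1 - z / p) - h - Clog1m (1 - z / p'))%C).
  assert (Dz : forall z, Cmod (z - p)%C < delta -> Cmod (1 - z / p')%C < 1 -> Cexp (D z) = 1).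
  { intros z Hz Hz'.
    assert (S1 : (Cexp (D z) * (Cexp h * Cexp (Clog1m (1 - z / p'))))%C = Cexp (Clog1m (1 - z / p)%C)).
    { rewrite <- !Cexp_plus. f_equal. unfold D. ring. }
    rewrite Eh, !Cexp_Clog1m in S1 by (auto; apply (Hlog z Hz)).
    assert (Nz : z <> 0).
    { intros Z. destruct (Hlog z Hz) as [L1 _]. rewrite Z in L1.
      replace (1 - 0 / p)%C with (RtoC 1) in L1 by (field; auto). rewrite Cmod_1 in L1. lra. }
    replace (Cexp (D z)) with ((Cexp (D z) * (p' / p * (1 - (1 - z / p')))) * p / z)%C
      by (field; auto).
    rewrite S1. field. auto. }
  assert (D0 : D p' = 0).
  { unfold D. fold h. replace (1 - p' / p')%C with (RtoC 0) by (field; auto).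
    rewrite Clog1m_0. ring. }
  set (V := fun z => Cmod (z - p)%C < delta /\ Cmod (1 - z / p')%C < 1).
  assert (HD : hol V D).
  { apply hol_minus; [apply hol_minus; [|apply hol_const]|].
    - apply hol_log_ratio; auto. intros z [Hz _]. apply (Hlog z Hz).
    - apply hol_log_ratio; auto. intros z [_ Hz]. auto. }
  assert (Vp : V p').
  { split; auto. replace (1 - p' / p')%C with (RtoC 0) by (field; auto). rewrite Cmod_0; lra. }
  destruct (proj1 (continuous_C_iff D p') (hol_continuous V D p' HD Vp) d0) as (e2 & He2 & W);
    [lra|].
  set (r' := Rmin (Rmin (e1 * Cmod p') e2) (delta - Cmod (p' - p)%C)).
  assert (M1 := Rmin_l (Rmin (e1 * Cmod p') e2) (delta - Cmod (p' - p)%C)).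
  assert (M2 := Rmin_r (Rmin (e1 * Cmod p') e2) (delta - Cmod (p' - p)%C)).
  assert (M3 := Rmin_l (e1 * Cmod p') e2). assert (M4 := Rmin_r (e1 * Cmod p') e2).
  fold r' in M1, M2.
  exists (x1 + h)%C, a', r'. split; [|split; [auto|split; [|split]]].
  - rewrite Cexp_plus, Ex, Eh. field. auto.
  - unfold r'. repeat apply Rmin_pos; auto; try lra. apply Rmult_lt_0_compat; lra.
  - apply cv_on_le with (2 := Hb'). auto.
  - intros z Hz. rewrite <- Eb' by lra.
    assert (Hzp : Cmod (z - p)%C < delta).
    { assert (T := Cmod_sub_triangle z p' p). lra. }
    assert (Hz1 : Cmod (1 - z / p')%C < e1) by (apply Cmod_one_minus_div; auto; lra).
    assert (Hz2 : Cmod (1 - z / p')%C < 1) by lra.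
    rewrite <- Eb0 by auto. unfold f.
    assert (ED : D z = 0).
    { apply Inj; auto. replace (D z) with (D z - D p')%C by (rewrite D0; ring).
      apply W. lra. }
    rewrite <- Ea' by (apply Sm1; auto). f_equal.
    replace (Clog1m (1 - z / p)%C) with (D z + h + Clog1m (1 - z / p'))%C by (unfold D; ring).
    rewrite ED. ring.
Qed.

(** The radius granted by [volterra_germ_at_step] is bounded from below near each point
    other than [0] and [/ omega]. *)
Lemma volterra_germ_at_local (k : cseq) (omega : C) :
  entire_seq k -> (exists j, k j <> 0) -> omega <> 0 ->
  forall p : C, ~ (p = 0 \/ p = (/ omega)%C) ->
  exists d, 0 < d /\ forall p', Cmod (p' - p)%C < d ->
    forall b, volterra_germ_at k omega p' b -> cv_on b d /\
      forall p'' b'', Cmod (p'' - p')%C < d -> induces p' b p'' b'' -> volterra_germ_at k omega p'' b''.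
Proof.
  intros Hk Hj Ho p Hp.
  assert (Hp0 : p <> 0) by tauto.
  assert (Hp1 : (1 - omega * p)%C <> 0).
  { intros E. apply Hp. right.
    replace p with ((1 - (1 - omega * p)) / omega)%C by (field; auto). rewrite E. field. auto. }
  assert (O0 : 0 < Cmod omega) by (apply Cmod_gt_0; auto).
  assert (P0 : 0 < Cmod p) by (apply Cmod_gt_0; auto).
  assert (Q0 : 0 < Cmod (1 - omega * p)%C) by (apply Cmod_gt_0; auto).
  set (q := Cmod (1 - omega * p)%C) in *.
  destruct Cexp_near_0 as (d0 & Hd0 & _ & Lip).
  set (rho := Rmin d0 (q / (8 * (Cmod omega * Cmod p)))).
  assert (OP : 0 < Cmod omega * Cmod p) by (apply Rmult_lt_0_compat; auto).
  assert (Hrho : 0 < rho) by (apply Rmin_pos; [lra|apply Rdiv_lt_0_compat; lra]).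
  assert (R1 : rho <= d0) by apply Rmin_l.
  assert (R2 : rho * (8 * (Cmod omega * Cmod p)) <= q).
  { apply Rmult_le_reg_r with (/ (8 * (Cmod omega * Cmod p))); [apply Rinv_0_lt_compat; lra|].
    rewrite Rmult_assoc, Rinv_r, Rmult_1_r by lra. apply Rmin_r. }
  destruct (Clog1m_small rho Hrho) as (e & He & Sm).
  set (d1 := Rmin (Cmod p / 2) (q / (2 * Cmod omega))).
  assert (Hd1 : 0 < d1) by (apply Rmin_pos; [lra|apply Rdiv_lt_0_compat; lra]).
  assert (D1 : d1 <= Cmod p / 2) by apply Rmin_l.
  assert (D2 : d1 * (2 * Cmod omega) <= q).
  { apply Rmult_le_reg_r with (/ (2 * Cmod omega)); [apply Rinv_0_lt_compat; lra|].
    rewrite Rmult_assoc, Rinv_r, Rmult_1_r by lra. apply Rmin_r. }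
  exists (Rmin d1 (e * (Cmod p / 2))).
  assert (M1 := Rmin_l d1 (e * (Cmod p / 2))). assert (M2 := Rmin_r d1 (e * (Cmod p / 2))).
  assert (Hd : 0 < Rmin d1 (e * (Cmod p / 2)))
    by (apply Rmin_pos; auto; apply Rmult_lt_0_compat; lra).
  set (d := Rmin d1 (e * (Cmod p / 2))) in *.
  split; auto. intros p' Hp' b Hb.
  assert (Hp'2 : Cmod p / 2 < Cmod p').
  { assert (T : Cmod p <= Cmod (p - p')%C + Cmod p').
    { replace p with ((p - p') + p')%C at 1 by ring. apply Cmod_triangle. }
    rewrite Cmod_sub_comm in T. lra. }
  assert (Hp'3 : Cmod p' < 2 * Cmod p).
  { assert (T : Cmod p' <= Cmod (p' - p)%C + Cmod p).
    { replace p' with ((p' - p) + p)%C at 1 by ring. apply Cmod_triangle. }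
    lra. }
  assert (Hp'0 : p' <> 0) by (intros Z; rewrite Z, Cmod_0 in Hp'2; lra).
  apply (volterra_germ_at_step k omega p' b rho d); auto.
  - intros x1 h Ex Hh E. rewrite Cexp_plus, Ex in E.
    assert (L := Lip h ltac:(lra)).
    assert (A1 : q / 2 <= Cmod (1 - omega * p')%C).
    { assert (T : q <= Cmod (1 - omega * p')%C + Cmod (omega * (p' - p))%C).
      { unfold q. replace (1 - omega * p)%C with ((1 - omega * p') + omega * (p' - p))%C by ring.
        apply Cmod_triangle. }
      rewrite Cmod_mult in T. nra. }
    assert (A2 : Cmod (1 - omega * p')%C < q / 2).
    { replace (1 - omega * p')%C with (omega * p' * (Cexp h - 1))%C by (rewrite <- E at 2; ring).
      rewrite !Cmod_mult.
      assert (H0 := Cmod_ge_0 h).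
      apply Rle_lt_trans with (Cmod omega * Cmod p' * (2 * Cmod h)).
      - apply Rmult_le_compat_l; auto. apply Rmult_le_pos; lra.
      - apply Rle_lt_trans with (Cmod omega * (2 * Cmod p) * (2 * Cmod h)).
        + apply Rmult_le_compat_r; [lra|]. apply Rmult_le_compat_l; lra.
        + apply Rlt_le_trans with (Cmod omega * (2 * Cmod p) * (2 * rho)); [|lra].
          apply Rmult_lt_compat_l; lra. }
    lra.
  - intros z Hz.
    assert (Hz1 : Cmod (1 - z / p')%C < e).
    { apply Cmod_one_minus_div; auto. nra. }
    split; [lra|]. apply Sm. auto.
Qed.

(** Uniqueness of the Taylor coefficients of [1 / (1 - z)]. *)
Lemma hadamard_coefs (F G : cseq) :
  locally (0 : C) (fun z => sums_to (hadamard F G) z (1 / (1 - z))%C) ->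
  forall n, (F n * G n)%C = 1.
Proof.
  intros H. apply locally_disc in H. destruct H as (e & He & H).
  set (r := Rmin (e / 2) (1 / 2)).
  assert (Hr : 0 < r) by (apply Rmin_pos; lra).
  assert (M1 : r <= e / 2) by apply Rmin_l. assert (M2 : r <= 1 / 2) by apply Rmin_r.
  assert (Hc : cv_on (hadamard F G) r).
  { assert (X := H (RtoC r)). replace (r - 0)%C with (RtoC r) in X by ring.
    assert (Cr : Cmod (RtoC r) = r) by (rewrite Cmod_R, Rabs_pos_eq; lra).
    rewrite Cr in X. specialize (X ltac:(lra)). apply cv_on_sums_to in X.
    rewrite Cr in X. auto. }
  assert (E : hadamard F G = geom1).
  { apply (psum_unique_disc _ _ r); auto.
    - apply cv_on_le with 1; [lra|apply cv_on_geom1].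
    - intros z Hz. rewrite psum_geom1 by lra.
      rewrite (sums_to_unique _ _ _ (H z ltac:(replace (z - 0)%C with z by ring; lra))).
      unfold Cdiv. ring. }
  intros n. change (hadamard F G n = 1). rewrite E. reflexivity.
Qed.

(** For [r' < r] and [s' < s] the numbers [(r' * s') ^ n] are products of terms of
    two bounded sequences. *)
Lemma radius_product_le (F G : cseq) (r s : R) :
  (forall n, (F n * G n)%C = 1) -> cv_on F r -> cv_on G s -> 0 < r -> 0 < s -> r * s <= 1.
Proof.
  intros H HF HG Hr Hs. apply Rnot_lt_le. intros L.
  assert (X : exists r' s', 0 < r' < r /\ 0 < s' < s /\ 1 < r' * s').
  { set (t := (1 + / (r * s)) / 2).
    assert (I1 : / (r * s) < 1) by (rewrite <- Rinv_1; apply Rinv_lt_contravar; lra).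
    assert (I0 : 0 < / (r * s)) by (apply Rinv_0_lt_compat; lra).
    assert (T : (r * s) * / (r * s) = 1) by (apply Rinv_r; lra).
    assert (Ht : 0 < t < 1) by (unfold t; lra).
    assert (Hrt : 1 < (r * s) * t) by (unfold t; nra).
    set (u := (1 + / (r * s * t)) / 2).
    assert (J1 : / (r * s * t) < 1) by (rewrite <- Rinv_1; apply Rinv_lt_contravar; lra).
    assert (J0 : 0 < / (r * s * t)) by (apply Rinv_0_lt_compat; lra).
    assert (T2 : (r * s * t) * / (r * s * t) = 1) by (apply Rinv_r; lra).
    assert (Hu : 0 < u < 1) by (unfold u; lra).
    exists (r * t), (s * u). split; [nra|]. split; [nra|].
    replace (r * t * (s * u)) with ((r * s * t) * u) by ring. unfold u. nra. }
  destruct X as (r' & s' & Hr' & Hs' & L').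
  destruct (HF r') as [M HM]; [lra|]. destruct (HG s') as [N HN]; [lra|].
  assert (B : forall n, (r' * s') ^ n <= M * N).
  { intros n. rewrite <- (Rmult_1_l ((r' * s') ^ n)), <- Cmod_1, <- (H n), Cmod_mult, Rpow_mult_distr.
    replace (Cmod (F n) * Cmod (G n) * (r' ^ n * s' ^ n))
      with ((Cmod (F n) * r' ^ n) * (Cmod (G n) * s' ^ n)) by ring.
    apply Rmult_le_compat; auto; apply Rmult_le_pos; try apply Cmod_ge_0; apply pow_le; lra. }
  destruct (Pow_x_infinity (r' * s') ltac:(rewrite Rabs_pos_eq; lra) (M * N + 1)) as [n Hn].
  specialize (Hn n (le_n n)). rewrite Rabs_pos_eq in Hn by (apply pow_le; lra).
  specialize (B n). lra.
Qed.

Theorem theorem2 (F G : cseq) (omega : C)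
  (hF : convergent F) (hG : convergent G)
  (rF : resurgent F) (rG : resurgent G)
  (hFG : locally (0 : C) (fun z => sums_to (hadamard F G) z (1 / (1 - z))%C))
  (sF : only_simple_singularities F) (sG : only_simple_singularities G)
  (homega : omega <> 0)
  (hsing : only_singular_point F omega) :
  continuable (fun z => z = 0 \/ z = (/ omega)%C) G.
Proof.
  assert (O0 : 0 < Cmod omega) by (apply Cmod_gt_0; auto).
  assert (FG := hadamard_coefs F G hFG).
  destruct (coefficient_formula F omega hF homega sF (proj1 hsing))
    as (CF & c & w & rem & Hw & Hrem & Ecoef).
  assert (Oinv : Cmod (/ omega)%C = / Cmod omega) by (apply Cmod_inv; auto).
  set (beta := fun n => (G n * (/ omega) ^ n)%C).
  assert (Hone : forall n, ((c - Csum (fun k => w k / INR (n - k)) n + rem n) * beta n)%C = 1).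
  { intros n. rewrite <- Ecoef. unfold beta. rewrite Cpow_inv by auto.
    replace (F n * omega ^ n * (G n * / omega ^ n))%C with (F n * G n)%C; auto.
    field. apply Cpow_nz. auto. }
  destruct (exp_series_taylor_entire w 0 Hw) as (K & HK & EK & DK).
  rewrite Cexp_0 in DK.
  assert (Hbeta : forall r, cv_on G r -> cv_on beta (Cmod omega * r)).
  { intros r Hr. apply cv_on_scale with r; auto; rewrite Oinv.
    - right. field. lra.
    - apply Rinv_0_lt_compat; auto. }
  assert (Hk := entire_kernel c K HK).
  assert (Hj : exists j, kernel c K j <> 0).
  { apply (kernel_nontrivial c w rem beta K); auto.
    apply convergent_cv_on in hG. destruct hG as (r & Hr & HG).
    apply convergent_cv_on. exists (Cmod omega * r). split; auto.
    apply Rmult_lt_0_compat; auto. }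
  intros gamma Hg Havoid Hstart.
  destruct (lt_radius_cv_on G (Cmod (gamma 0)) (Cmod_ge_0 _) Hstart) as (r & Hr & HG).
  set (p := gamma 0) in *.
  assert (Hp : p <> 0).
  { intros E. apply (Havoid 0); [unfold I01; lra|]. left. exact E. }
  assert (P0 : 0 < Cmod p) by (apply Cmod_gt_0; auto).
  assert (Hp0 : Cmod (p - 0)%C < r) by (replace (p - 0)%C with p by ring; auto).
  destruct (induces_exists 0 G p r HG Hp0) as [b0 Hb0].
  destruct (induces_spec 0 G p b0 r HG Hp0 Hb0) as [Cb0 Eb0].
  replace (p - 0)%C with p in Cb0, Eb0 by ring.
  assert (Hop : (omega * p)%C <> 0) by (apply Cmult_neq_0; auto).
  destruct (Cexp_surj _ Hop) as [x1 Ex1].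
  (* The path starts where the equation holds: [exp x1 = omega * gamma 0] has
     modulus less than [1], since the radii of [F] and [G] multiply to at most [1]. *)
  assert (RP := radius_product_le F G (Cmod omega) r FG CF HG O0 ltac:(lra)).
  assert (X1 : Cmod (Cexp x1) < Cmod omega * r).
  { rewrite Ex1, Cmod_mult. apply Rmult_lt_compat_l; auto. }
  destruct (volterra_germ_start c w rem beta K (Cmod omega * r) x1 Hw Hrem (Hbeta r HG) X1
    ltac:(lra) DK Hone) as (a & e & He & Ha & Ea & Hgood).
  apply (continuation_of_invariant (fun z : C => ~ (z = 0 \/ z = (/ omega)%C))
    (volterra_germ_at (kernel c K) omega) G b0 gamma); auto.
  { apply volterra_germ_at_local; auto. }
  fold p. destruct (Clog1m_small e He) as (e1 & He1 & Sm).
  set (r' := Rmin (r - Cmod p) (e1 * Cmod p)).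
  assert (M1 : r' <= r - Cmod p) by apply Rmin_l.
  assert (M2 : r' <= e1 * Cmod p) by apply Rmin_r.
  exists x1, a, r'. split; auto. split; auto. split; [|split].
  - apply Rmin_pos; [lra|apply Rmult_lt_0_compat; lra].
  - apply cv_on_le with (2 := Cb0). auto.
  - intros z Hz. rewrite <- Eb0 by lra. replace (z - 0)%C with z by ring.
    assert (Hz1 : Cmod (1 - z / p)%C < e1) by (apply Cmod_one_minus_div; auto; lra).
    rewrite Ea by auto. rewrite Cexp_plus, Ex1, Cexp_Clog1m by lra.
    unfold beta. rewrite psum_scale. f_equal. field. auto.
Qed.
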